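(* Graphs in $1$-$HNG$ can be recognized in polynomial time; specifically, there is an algorithm that, given a graph $G$ on $n$ vertices, decides in $O(n^8)$ time whether $G$ is in $1$-$HNG$.
   Context: All graphs are finite, simple, and have at least one vertex; induced subgraphs are taken on nonempty vertex sets. $\chi$ is the chromatic number and $\theta(G)=\chi(\overline{G})$ the clique cover number. A graph $G$ is in the class $1$-$HNG$ if every induced subgraph $H$ of $G$ (including $G$ itself) satisfies $\chi(H)+\theta(H)\ge |V(H)|$. *)

(* Defs.v *)
From mathcomp Require Import all_boot.

Set Implicit Arguments.
Unset Strict Implicit.
Unset Printing Implicit Defensive.

Record sgraph := SGraph {
  vertex :> finType;
  adj : rel vertex;
  adj_sym : symmetric adj;
  adj_irrefl : irreflexive adj
}.

Section GraphOperations.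
Variable G : sgraph.

Definition co_adj : rel G := fun x y => (x != y) && ~~ adj x y.

Lemma co_adj_sym : symmetric co_adj.
Proof. by move=> x y; rewrite /co_adj eq_sym adj_sym. Qed.

Lemma co_adj_irrefl : irreflexive co_adj.
Proof. by move=> x; rewrite /co_adj eqxx. Qed.

Definition complement : sgraph := SGraph co_adj_sym co_adj_irrefl.

Variable A : {set G}.

Definition sub_adj : rel {x : G | x \in A} := fun x y => adj (val x) (val y).

Lemma sub_adj_sym : symmetric sub_adj.
Proof. by move=> x y; rewrite /sub_adj adj_sym. Qed.

Lemma sub_adj_irrefl : irreflexive sub_adj.
Proof. by move=> x; rewrite /sub_adj adj_irrefl. Qed.

Definition induced : sgraph := SGraph sub_adj_sym sub_adj_irrefl.

Definition colorable (k : nat) : bool :=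
  [exists f : {ffun G -> 'I_k}, [forall x, forall y, adj x y ==> (f x != f y)]].

Lemma colorable_card : exists k, colorable k.
Proof.
exists #|G|; apply/existsP; exists [ffun x => enum_rank x].
apply/forallP=> x; apply/forallP=> y; apply/implyP=> xy.
rewrite !ffunE (inj_eq enum_rank_inj).
by apply: contraTneq xy => ->; rewrite adj_irrefl.
Qed.

Definition chi : nat := ex_minn colorable_card.

End GraphOperations.

Definition theta (G : sgraph) : nat := chi (complement G).

Definition one_HNG (G : sgraph) : Prop :=
  forall A : {set G}, A != set0 ->
    #|induced A| <= chi (induced A) + theta (induced A).

(* Algorithms are programs of a word RAM: finitely many directly addressed
   registers are used by any given program, and memory is accessed through
   addresses held in registers.  Every instruction costs one unit of time; this
   is made legitimate by the bound on word sizes in [recognizable_in]. *)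

Inductive binop := OpAdd | OpSub | OpMul | OpDiv | OpMod.

Definition eval_binop (o : binop) : nat -> nat -> nat :=
  match o with
  | OpAdd => addn
  | OpSub => subn
  | OpMul => muln
  | OpDiv => divn
  | OpMod => modn
  end.

Inductive instr :=
  | Const of nat & nat             (* Const d c:    r_d := c                  *)
  | Op of binop & nat & nat & nat  (* Op o d s1 s2: r_d := r_s1 o r_s2        *)
  | Read of nat & nat              (* Read d s:     r_d := store[r_s]         *)
  | Write of nat & nat             (* Write d s:    store[r_d] := r_s         *)
  | Jump_pos of nat & nat          (* Jump_pos s l: if r_s > 0 then goto l    *)
  | Halt of bool.                  (* Halt b:       stop with answer b        *)

Definition program := seq instr.

Record config := Config {
  pc : nat;
  reg : nat -> nat;
  store : nat -> nat
}.

(* Leaving the program text counts as rejection. *)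
Definition fetch (P : program) (s : config) : instr :=
  nth (Halt false) P (pc s).

Definition step (P : program) (s : config) : config :=
  let: Config l r m := s in
  match fetch P s with
  | Const d c => Config l.+1 [eta r with d |-> c] m
  | Op o d a b => Config l.+1 [eta r with d |-> eval_binop o (r a) (r b)] m
  | Read d a => Config l.+1 [eta r with d |-> m (r a)] m
  | Write d a => Config l.+1 r [eta m with r d |-> r a]
  | Jump_pos a l' => Config (if 0 < r a then l' else l.+1) r m
  | Halt _ => s
  end.

Definition run (P : program) (s : config) (t : nat) : config :=
  iter t (step P) s.

Definition answer (P : program) (s : config) : option bool :=
  if fetch P s is Halt b then Some b else None.

Definition words_below (B : nat) (s : config) : Prop :=
  forall a, reg s a < B /\ store s a < B.

(* The input: n in register 0, and the adjacency matrix of G, for the numbering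
   v of its vertices, stored row by row from address 0 on; all else is 0. *)
Definition input (G : sgraph) (n : nat) (v : 'I_n -> G) : config :=
  Config 0
    [fun _ : nat => 0 with 0 |-> n]
    (fun a => [exists i : 'I_n, exists j : 'I_n, (a == i * n + j) && adj (v i) (v j)]).

(* A single program decides membership in C for all graphs on n >= 1 vertices,
   however numbered, in O(f n) steps on words of O(log n) bits: at all times
   every cell is below (n + 1) ^ w, for a constant w. *)
Definition recognizable_in (C : sgraph -> Prop) (f : nat -> nat) : Prop :=
  exists (P : program) (c w : nat),
  forall (G : sgraph) (n : nat) (v : 'I_n -> G), 0 < n -> bijective v ->
    (forall t, words_below (n.+1 ^ w) (run P (input v) t)) /\
    exists (t : nat) (b : bool),
      [/\ t <= c * f n, answer P (run P (input v) t) = Some b & b <-> C G].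

Definition recognizable_in_polynomial_time (C : sgraph -> Prop) : Prop :=
  exists k : nat, recognizable_in C (fun n => n ^ k).

(* Main.v *)
(** A graph violates [chi + theta >= n] iff its vertices can be partitioned both
    into stable sets and into cliques, with fewer than [n] parts altogether.
    Call this a certificate, and regard the parts as the nodes and the vertices
    as the edges of a bipartite graph.  In a certificate on as few vertices as
    possible there is exactly one node less than edges and every node has degree
    at least 2, so that all parts are pairs except for one part of size 4 or two
    of size 3.  Starting from the large parts, one explores the pairs which
    contain the vertices met so far.  A finite case analysis on this exploration
    and on the adjacencies of the explored vertices always ends with a certificate
    on at most 8 vertices, or with a way to replace some of the explored parts
    which makes the certificate smaller (or brings its large parts into a position
    already excluded).  The case analysis is a tree, found by computer search and
    checked by evaluation.

    So membership in 1-HNG can be decided by inspecting all 8-tuples of vertices.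
    The program lets a counter run through the numbers below [n ^ 8], whose digits
    in base [n] are the tuple, encodes the equalities and adjacencies between its
    entries as one number, and compares this number with a fixed finite list. *)

Require Import Defs.
From mathcomp Require Import all_boot.
From mathcomp Require Import zify.

Set Implicit Arguments.
Unset Strict Implicit.
Unset Printing Implicit Defensive.

(** * Certificates *)

(** A certificate may have arbitrarily many pairs, yet finitely many cases suffice because exchanges
    are local: deleting [d] vertices is allowed only if the listed parts become fewer by at least
    [d], and then the strict inequality survives whatever the unlisted pairs are, even if these lose
    vertices. A path of pairs cannot be followed for long. Otherwise one more adjacency is known,
    and enough of these produce a small certificate.

    Exchanges that delete nothing make no progress in size; the order of the positions of the large
    parts is what keeps the argument well-founded. Complementation exchanges stable sets and
    cliques, so four starting positions are enough.

    The number 8 is the same throughout: the size up to which a certificate is accepted as it is,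
    the length of the tuples, the exponent of the running time. *)

Section Certificates.
Variables (T : eqType) (e : rel T).
Implicit Types (b : bool) (p V : seq T) (c : bool -> seq (seq T)).

Definition homog b p := {in p &, forall x y, x != y -> e x y = b}.

(* [c false] lists the stable sets and [c true] the cliques. *)
Definition cert V c :=
  [/\ uniq V, forall b, perm_eq (flatten (c b)) V,
      forall b p, p \in c b -> homog b p
    & size (c false) + size (c true) < size V].

(* The positions of the large parts, in the order in which they are excluded:
   when position [l] is treated, a certificate may be exchanged for one of the same
   size in an earlier position. *)
Definition special (l : nat) c :=
  [\/ 0 < l /\ exists b, exists2 p, p \in c b & 3 < size p,
      1 < l /\ exists p q, [/\ p \in c false, q \in c true, size p = 3, size q = 3
                            & has (mem p) q]
    | 2 < l /\ exists p q, [/\ p \in c false, q \in c true, size p = 3 & size q = 3]].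

(** Made for a contradiction: if [V] carries a certificate with the fewest vertices and has more
    than 8 of them, only the last alternative is left, and it leads to a position that has already
    been excluded. *)
Definition improvable (l : nat) V := exists V' c', cert V' c' /\
  [\/ size V' <= 8, size V' < size V | size V' = size V /\ special l c'].

Lemma special_le l l' c : l <= l' -> special l c -> special l' c.
Proof.
move=> ll [[lt H]|[lt H]|[lt H]].
- by constructor 1; split; first exact: leq_trans ll.
- by constructor 2; split; first exact: leq_trans ll.
- by constructor 3; split; first exact: leq_trans ll.
Qed.

Lemma improvable_le l l' V : l <= l' -> improvable l V -> improvable l' V.
Proof.
move=> ll [V' [c' [Hc [H|H|[H S]]]]]; exists V', c'; split=> //.
- by constructor 1.
- by constructor 2.
- by constructor 3; split=> //; exact: special_le S.
Qed.

Lemma homog_sub b p q : {subset q <= p} -> homog b p -> homog b q.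
Proof. by move=> qp hp x y /qp xp /qp yp; apply: hp. Qed.

End Certificates.

(** * The case analysis *)

(* Explored vertices are numbered [0 .. verts - 1].  The parts which are not
   listed in a state are pairs. *)
Record state := State {
  level : nat;
  verts : nat;
  nonedges : seq (nat * nat);
  edges : seq (nat * nat);
  stables : seq (seq nat);
  cliques : seq (seq nat)
}.

Definition facts s b := if b then edges s else nonedges s.
Definition parts s b := if b then cliques s else stables s.

Definition learn s b i j : state :=
  let: State l m ne ed st cl := s in
  if b then State l m ne ((i, j) :: ed) st cl else State l m ((i, j) :: ne) ed st cl.

Definition extend s := State (level s) (verts s).+1 (nonedges s) (edges s) (stables s) (cliques s).

(** Pairs are listed in increasing order because [check_cite] compares parts as sequences, after
    sorting their images. *)
Definition pair_up s b v u : state :=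
  let: State l m ne ed st cl := s in
  let p := [:: minn v u; maxn v u] in
  learn (if b then State l m ne ed st (p :: cl) else State l m ne ed (p :: st) cl) b v u.

Definition reveal s b v u := pair_up (if u == verts s then extend s else s) b v u.

Definition knows s b i j := ((i, j) \in facts s b) || ((j, i) \in facts s b).
Definition knows_homog s b p := all (fun i => all (fun j => (i == j) || knows s b i j) p) p.
(** A state that mentions only numbers below [verts s] keeps its meaning when a vertex with the
    number [verts s] is added, and different numbers in it stand for different vertices. *)
Definition wf s :=
  all (fun b => all (ltn^~ (verts s)) (flatten (parts s b)) &&
                all (fun ij => (ij.1 < verts s) && (ij.2 < verts s)) (facts s b))
      [:: false; true].

(* [Small A B]: the parts A, B are a certificate on at most 8 vertices.
   [Swap D A B]: delete the vertices D and replace all listed parts that meet D or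
     A (respectively B) by A, B.
   [Branch i j t1 t2]: are i and j adjacent (t1) or not (t2)?
   [Partner b v ts]: which vertex u shares a part (a clique if b) with v?  It is
     new if it is numbered [verts].
   [Cite k f]: the situation contains the k-th one treated before, with its i-th
     vertex as the i-th entry of f. *)
Inductive tree :=
  | Small of seq (seq nat) & seq (seq nat)
  | Swap of seq nat & seq (seq nat) & seq (seq nat)
  | Branch of nat & nat & tree & tree
  | Partner of bool & nat & seq (nat * tree)
  | Cite of nat & seq nat.

(** The children of [Partner] are nested in a list, for which the generated principle gives no
    induction hypothesis. *)
Lemma tree_nested_ind (P : tree -> Prop) :
  (forall S Q, P (Small S Q)) -> (forall D S Q, P (Swap D S Q)) ->
  (forall i j t1 t2, P t1 -> P t2 -> P (Branch i j t1 t2)) ->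
  (forall b v ts, foldr (fun ut => and (P ut.2)) True ts -> P (Partner b v ts)) ->
  (forall k f, P (Cite k f)) -> forall t, P t.
Proof.
move=> H1 H2 H3 H4 H5; fix IH 1; case=> [S Q|D S Q|i j t1 t2|b v ts|k f].
- exact: H1.
- exact: H2.
- by apply: H3; apply: IH.
- by apply: H4; elim: ts => [|[u t] ts IHts]; [|split; [exact: IH|]].
- exact: H5.
Qed.

Definition bpick (S Q : seq (seq nat)) b := if b then Q else S.

Definition special_parts (l : nat) (S Q : seq (seq nat)) :=
  [|| (0 < l) && has (fun p => 3 < size p) (S ++ Q),
      (1 < l) && has (fun p => (size p == 3) &&
                        has (fun q => (size q == 3) && has (mem p) q) Q) S
    | (2 < l) && has (fun p => size p == 3) S && has (fun p => size p == 3) Q].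

Definition check_small s S Q :=
  let V := flatten S in
  [&& uniq V, all (ltn^~ (verts s)) V, perm_eq (flatten Q) V,
      all (knows_homog s false) S, all (knows_homog s true) Q,
      size S + size Q < size V & size V <= 8].

Definition touched (D : seq nat) (N : bool -> seq (seq nat)) b p := has (mem (D ++ flatten (N b))) p.

Definition check_swap s D S Q :=
  let N := bpick S Q in
  let O b := [seq p <- parts s b | touched D N b p] in
  [&& wf s, uniq D, all (ltn^~ (verts s)) D,
      all (fun b => perm_eq (flatten (N b)) [seq x <- flatten (O b) | x \notin D])
          [:: false; true],
      all (knows_homog s false) S, all (knows_homog s true) Q,
      size S + size Q + size D <= size (O false) + size (O true)
    & (D != [::]) || special_parts (level s) S Q].

Definition image_parts (f : seq nat) (P : seq (seq nat)) := [seq sort leq (map (nth 0 f) p) | p <- P].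

(** A listed part of [s] outside the image becomes unlisted in the cited situation, where all
    unlisted parts are pairs; hence the condition on its size. A lower level of [s'] only makes its
    conclusion stronger. *)
Definition check_cite s s' (f : seq nat) :=
  [&& level s' <= level s, size f == verts s', uniq f, all (ltn^~ (verts s)) f, wf s',
      all (fun b => all (fun ij => knows s b (nth 0 f ij.1) (nth 0 f ij.2)) (facts s' b))
          [:: false; true]
    & all (fun b =>
        let I := image_parts f (parts s' b) in
        [&& uniq I, uniq (parts s b), all (mem (parts s b)) I
          & all (fun p => (p \in I) || (size p == 2)) (parts s b)])
      [:: false; true]].

Fixpoint check (db : seq state) (t : tree) (s : state) {struct t} : bool :=
  match t with
  | Small A B => check_small s A B
  | Swap D A B => check_swap s D A B
  | Branch i j t1 t2 => [&& i != j, i < verts s, j < verts s,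
      check db t1 (learn s true i j) & check db t2 (learn s false i j)]
  | Partner b v ts => [&& wf s, v < verts s, v \notin flatten (parts s b),
      all (fun u => [|| u == v, u \in flatten (parts s b), knows s (~~ b) u v
                      | u \in [seq ut.1 | ut <- ts]]) (verts s :: iota 0 (verts s))
    & all (fun ut => check db ut.2 (reveal s b v ut.1)) ts]
  | Cite k f => (k < size db) && check_cite s (nth s db k) f
  end.

(** Citations reach only entries that were checked before, so there is no circularity. *)
Fixpoint check_all (db : seq state) (l : seq (state * tree)) :=
  if l is (s, t) :: l' then check db t s && check_all (rcons db s) l' else true.

(** * Soundness of the case analysis *)

Section Soundness.
Variables (T : eqType) (x0 : T) (e : rel T).
Hypothesis e_sym : symmetric e.
Implicit Types (xs V : seq T) (rest : bool -> seq (seq T)).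

Definition glue xs s rest b := map (map (nth x0 xs)) (parts s b) ++ rest b.

(** The unlisted parts [rest] are all pairs: the starting positions list every large part. *)
Definition models s xs rest V :=
  [/\ uniq xs /\ size xs = verts s, {subset xs <= V},
      forall b i j, (i, j) \in facts s b -> e (nth x0 xs i) (nth x0 xs j) = b,
      forall b p, p \in rest b -> size p = 2
    & cert e V (glue xs s rest)].

Lemma knowsP s xs rest V b i j : models s xs rest V -> knows s b i j ->
  e (nth x0 xs i) (nth x0 xs j) = b.
Proof. by case=> _ _ H _ _ /orP[]/H // <-; rewrite e_sym. Qed.

Lemma knows_homogP s xs rest V b p : models s xs rest V -> knows_homog s b p ->
  homog e b (map (nth x0 xs) p).
Proof.
move=> M /allP kp _ _ /mapP[i ip ->] /mapP[j jp ->] ne.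
have /orP[/eqP ij|] := allP (kp i ip) j jp; first by rewrite ij eqxx in ne.
exact: knowsP M.
Qed.

Lemma check_small_sound s xs rest V S Q : models s xs rest V -> check_small s S Q ->
  improvable e (level s) V.
Proof.
move=> M /and5P[uS /allP lS pQ hS /and3P[hQ sz le8]].
have [[uxs sxs] _ _ _ _] := M.
have inj : {in flatten S &, injective (nth x0 xs)}.
  by move=> i j /lS li /lS lj /eqP; rewrite nth_uniq ?sxs // => /eqP.
exists (map (nth x0 xs) (flatten S)), (fun b => map (map (nth x0 xs)) (bpick S Q b)).
split; last by constructor 1; rewrite size_map.
split.
- by rewrite map_inj_in_uniq.
- by case; rewrite -map_flatten ?perm_map.
- move=> b p /mapP[p' p'in ->]; apply: (knows_homogP M).
  by case: b p'in => /= p'in; [apply: (allP hQ)|apply: (allP hS)].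
- by rewrite !size_map.
Qed.

Lemma wfP s b i : wf s -> i \in flatten (parts s b) -> i < verts s.
Proof.
move=> /and3P[/andP[wf0 _] /andP[wf1 _] _].
by case: b => [/(allP wf1)|/(allP wf0)].
Qed.

Lemma wf_facts s b i j : wf s -> (i, j) \in facts s b -> (i < verts s) /\ (j < verts s).
Proof.
move=> /and3P[/andP[_ wf0] /andP[_ wf1] _].
by case: b => [/(allP wf1)|/(allP wf0)] /andP[].
Qed.

(** The number of vertices falls by [size D] and that of the parts by at least as much, so the
    strict inequality of a certificate is kept. With [D] empty the size stays the same, and the new
    parts themselves must show an excluded position. *)
Lemma check_swap_sound s xs rest V D S Q : models s xs rest V -> check_swap s D S Q ->
  improvable e (level s) V.
Proof.
move=> M; rewrite /check_swap; set N := bpick S Q.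
set O := fun b => [seq p <- parts s b | touched D N b p].
move=> /and5P[wfs uD /allP lD pN /and4P[hS hQ sz sp]].
have {}pN b : perm_eq (flatten (N b)) [seq x <- flatten (O b) | x \notin D].
  by move: pN => /and3P[p1 p2 _]; case: b.
have [[uxs sxs] xsV _ r2 [uV pV hV ltV]] := M.
pose X := nth x0 xs; pose XD := map X D.
pose K b := [seq p <- parts s b | ~~ touched D N b p].
pose del := map (filter [predC XD]).
(* The untouched listed parts avoid [D], so the filter affects only unlisted pairs. These may even
   become empty, which [cert] allows. *)
pose c b := map (map X) (N b) ++ del (map (map X) (K b) ++ rest b).
have OK b : perm_eq (O b ++ K b) (parts s b) by apply/permPl/perm_filterC.
have inj i j : i < verts s -> j < verts s -> X i = X j -> i = j.
  by move=> li lj /eqP; rewrite nth_uniq ?sxs // => /eqP.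
have XDV : {subset XD <= V}.
  by move=> _ /mapP[i /lD li ->]; apply/xsV/mem_nth; rewrite sxs.
have uXD : uniq XD.
  by rewrite map_inj_in_uniq // => i j /lD li /lD lj; apply: inj.
have szV : size V = size D + size (filter [predC XD] V).
  rewrite -(size_map X D) -size_cat; apply: perm_size.
  have p1 : perm_eq (filter (mem XD) V ++ filter [predC XD] V) V.
    by apply/permPl/perm_filterC.
  rewrite perm_sym -(permPr p1) perm_cat2r.
  apply: uniq_perm => [||x]; rewrite ?filter_uniq //.
  by rewrite mem_filter /=; case: (boolP (x \in XD)) => // /XDV.
have pO b : perm_eq (flatten (map (map X) (N b)))
                    (filter [predC XD] (flatten (map (map X) (O b)))).
  rewrite -!map_flatten filter_map; apply: perm_map.
  rewrite (permPl (pN b)); apply/permP=> a; congr (count _ _); apply: eq_in_filter => i iO /=.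
  congr (~~ _); apply/idP/mapP=> [iD|[j jD Xij]]; first by exists i.
  suff -> : i = j by [].
  apply: inj Xij; last exact: lD.
  apply: (wfP (b := b) wfs); case/flattenP: iO => p.
  by rewrite mem_filter => /andP[_ pp] ip; apply/flattenP; exists p.
have pc b : perm_eq (flatten (c b)) (filter [predC XD] V).
  rewrite flatten_cat (permPl (perm_cat (pO b) (perm_refl _))).
  rewrite -filter_flatten -filter_cat; apply: perm_filter.
  rewrite -flatten_cat catA -map_cat -(permPr (pV b)).
  by apply: perm_flatten; rewrite perm_cat2r; apply: perm_map.
have szc b : size (c b) + size (O b) = size (glue xs s rest b) + size (N b).
  rewrite /glue !size_cat !size_map size_cat size_map -(perm_size (OK b)) size_cat.
  by move: (size (N b)) (size (O b)) (size (K b)) (size (rest b)) => n1 n2 n3 n4; lia.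
exists (filter [predC XD] V), c; split; last first.
  case/orP: sp => [D0|sp].
    by constructor 2; rewrite szV; case: (D) D0 => //= *; lia.
  case: (posnP (size D)) => D0; last by constructor 2; rewrite szV; lia.
  constructor 3; split; first by rewrite szV; lia.
  have inN b p : p \in N b -> map X p \in c b.
    by move=> pin; rewrite mem_cat map_f.
  have hasX p q : has (mem p) q -> has (mem (map X p)) (map X q).
    by move=> /hasP[i iq ip]; apply/hasP; exists (X i); rewrite /= map_f.
  case/or3P: sp => [/andP[l0 /hasP[p pin p4]]
      |/andP[l1 /hasP[p pin /andP[/eqP p3 /hasP[q qin /andP[/eqP q3 pq]]]]]
      |/andP[/andP[l2 /hasP[p pin /eqP p3]] /hasP[q qin /eqP q3]]].
  - constructor 1; split=> //; move: pin; rewrite mem_cat => /orP[]pin.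
      by exists false, (map X p); rewrite ?size_map //; apply: inN.
    by exists true, (map X p); rewrite ?size_map //; apply: inN.
  - constructor 2; split=> //; exists (map X p), (map X q); rewrite !size_map.
    by split=> //; [apply: inN|apply: inN|apply: hasX].
  - constructor 3; split=> //; exists (map X p), (map X q); rewrite !size_map.
    by split=> //; apply: inN.
split=> //.
- exact: filter_uniq.
- move=> b p; rewrite mem_cat => /orP[/mapP[p' p'in ->]|/mapP[p' p'in ->]].
    apply: (knows_homogP M).
    by case: b p'in => /= p'in; [apply: (allP hQ)|apply: (allP hS)].
  apply: (@homog_sub _ _ _ p'); first by move=> x; rewrite mem_filter => /andP[].
  apply: hV; rewrite /glue mem_cat; move: p'in; rewrite mem_cat => /orP[|->]; last by rewrite orbT.
  by case/mapP=> p1; rewrite mem_filter => /andP[_ p1in] ->; rewrite map_f.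
- have {}sz : size (N false) + size (N true) + size D <= size (O false) + size (O true) by [].
  move: (szc false) (szc true) sz ltV szV; clear.
  move: (size (c false)) (size (c true)) (size (O false)) (size (O true)).
  move: (size (N false)) (size (N true)).
  move: (size (glue _ _ _ false)) (size (glue _ _ _ true)) (size D) (size V) (size (filter _ _)).
  lia.
Qed.

Lemma perm_flatten_map (A : eqType) (g h : A -> seq T) (l : seq A) :
  {in l, forall p, perm_eq (g p) (h p)} -> perm_eq (flatten (map g l)) (flatten (map h l)).
Proof.
elim: l => //= p l IH H; apply: perm_cat; first by apply: H; rewrite mem_head.
by apply: IH => q ql; apply: H; rewrite inE ql orbT.
Qed.

(** Renumbering along [f] turns a model of [s] into one of [s'] with the same certificate up to
    order, in which listed parts outside the image count as unlisted pairs. *)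
Lemma check_cite_sound s s' f xs rest V : models s xs rest V -> check_cite s s' f ->
  (forall xs' rest', models s' xs' rest' V -> improvable e (level s') V) ->
  improvable e (level s) V.
Proof.
move=> M /and5P[lv /eqP szf uf lf /and3P[wfs' fF fP]] ref.
apply: (improvable_le lv).
have {}fF b : all (fun ij => knows s b (nth 0 f ij.1) (nth 0 f ij.2)) (facts s' b).
  by case/and3P: fF; case: b.
pose I b := image_parts f (parts s' b).
pose O b := [seq p <- parts s b | p \notin I b].
have {fP} [uI uP sI O2] : [/\ forall b, uniq (I b), forall b, uniq (parts s b),
    forall b, {subset I b <= parts s b} & forall b p, p \in O b -> size p = 2].
  case/and3P: fP => /and4P[a1 /= a2 /allP a3 /allP a4] /and4P[b1 b2 /allP b3 /allP b4] _.
  split=> [[]|[]|[]|b p] //; rewrite mem_filter => /andP[pI pin]; apply/eqP.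
  by case: b pI pin => pI pin; [move: (b4 _ pin)|move: (a4 _ pin)]; rewrite (negbTE pI).
have [[uxs sxs] xsV fs r2 [uV pV hV ltV]] := M.
pose X := nth x0 xs; pose ys := map X f.
have ysE i : i < verts s' -> nth x0 ys i = X (nth 0 f i).
  by move=> li; rewrite (nth_map 0) // szf.
have partE b p : p \in parts s' b ->
    perm_eq (map (nth x0 ys) p) (map X (sort leq (map (nth 0 f) p))).
  move=> pin; rewrite (_ : map _ p = map X (map (nth 0 f) p)).
    by rewrite perm_map // perm_sym perm_sort.
  rewrite -map_comp; apply/eq_in_map => i ip /=; apply: ysE.
  by apply: (wfP (b := b) wfs'); apply/flattenP; exists p.
have permP b : perm_eq (I b ++ O b) (parts s b).
  have p1 : perm_eq (filter (mem (I b)) (parts s b) ++ O b) (parts s b).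
    by apply/permPl/perm_filterC.
  rewrite -(permPr p1) perm_cat2r; apply: uniq_perm => [||p]; rewrite ?filter_uniq //.
  by rewrite mem_filter /=; case: (boolP (p \in I b)) => // /sI.
apply: (ref ys (fun b => map (map X) (O b) ++ rest b)); split.
- split; last by rewrite size_map.
  rewrite map_inj_in_uniq // => i j /(allP lf) li /(allP lf) lj /eqP.
  by rewrite nth_uniq ?sxs // => /eqP.
- by move=> _ /mapP[i /(allP lf) li ->]; apply/xsV/mem_nth; rewrite sxs.
- move=> b i j ij; have [li lj] := wf_facts wfs' ij.
  by rewrite !ysE //; apply: (knowsP M); apply: (allP (fF b) _ ij).
- move=> b p; rewrite mem_cat => /orP[/mapP[q /O2 q2 ->]|/r2 //].
  by rewrite size_map.
have glueE b : perm_eq (flatten (glue ys s' (fun b => map (map X) (O b) ++ rest b) b))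
                       (flatten (glue xs s rest b)).
  rewrite /glue !flatten_cat catA perm_cat2r.
  apply: (perm_trans (y := flatten (map (map X) (I b)) ++ flatten (map (map X) (O b)))).
    by rewrite perm_cat2r /I /image_parts -map_comp; apply: perm_flatten_map => p /partE.
  by rewrite -flatten_cat -map_cat; apply: perm_flatten; apply: perm_map.
have szE b : size (glue ys s' (fun b => map (map X) (O b) ++ rest b) b)
             = size (glue xs s rest b).
  rewrite /glue !size_cat !size_map addnA -(perm_size (permP b)) size_cat.
  by rewrite /I /image_parts size_map.
split=> //.
- by move=> b; rewrite (permPl (glueE b)).
- move=> b p; rewrite mem_cat => /orP[/mapP[q qin ->]|].
    apply: (@homog_sub _ _ _ (map X (sort leq (map (nth 0 f) q)))).
      by move=> x; rewrite (perm_mem (partE b q qin)).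
    apply: hV; rewrite mem_cat; apply/orP; left; apply: map_f; apply: sI.
    exact: (map_f (fun p => sort leq (map (nth 0 f) p))).
  rewrite mem_cat => /orP[/mapP[q]|prest]; last by apply: hV; rewrite mem_cat prest orbT.
  by rewrite mem_filter => /andP[_ qin] ->; apply: hV; rewrite mem_cat map_f.
- by rewrite !szE.
Qed.

Lemma learn_models s xs rest V b i j : e (nth x0 xs i) (nth x0 xs j) = b ->
  models s xs rest V -> models (learn s b i j) xs rest V.
Proof.
case: s => l m ne ed st cl eij [uxs xsV fs r2 c]; split=> //; first by case: b {eij}.
  case: b eij => eij [] i' j' //=; try exact: (fs true); try exact: (fs false).
    by rewrite inE => /predU1P[[-> ->]|/(fs true)].
  by rewrite inE => /predU1P[[-> ->]|/(fs false)].
by case: b eij c => _ [c1 c2 c3 c4]; split.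
Qed.

Lemma extend_models s xs rest V y : wf s -> y \in V -> y \notin xs ->
  models s xs rest V -> models (extend s) (rcons xs y) rest V.
Proof.
move=> wfs yV yxs [[uxs sxs] xsV fs r2 c].
have nthE i : i < verts s -> nth x0 (rcons xs y) i = nth x0 xs i.
  by move=> li; rewrite nth_rcons sxs li.
split=> //.
- by rewrite rcons_uniq yxs size_rcons sxs.
- by move=> x; rewrite mem_rcons inE => /predU1P[->|/xsV].
- by move=> b i j ij; have [li lj] := wf_facts wfs ij; rewrite !nthE //; apply: fs.
have glueE b : glue (rcons xs y) (extend s) rest b = glue xs s rest b.
  rewrite /glue; congr (_ ++ _); apply/eq_in_map => p pin; apply/eq_in_map => i ip.
  by apply: nthE; apply: (wfP (b := b) wfs); apply/flattenP; exists p.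
by case: c => c1 c2 c3 c4; split=> // [b|b p|]; rewrite !glueE //; apply: c3.
Qed.

(** The certificate remains the same up to order: a pair moves from the unlisted to the listed
    parts, and its kind determines the adjacency learnt. *)
Lemma pair_up_models s xs rest V b v u p : p \in rest b -> v < verts s -> u < verts s ->
    perm_eq p [:: nth x0 xs v; nth x0 xs u] -> nth x0 xs v != nth x0 xs u ->
  models s xs rest V ->
  models (pair_up s b v u) xs (fun b' => if b' == b then rem p (rest b) else rest b') V.
Proof.
move=> pr lv lu pp neq M; have [_ _ _ _ [_ _ hV _]] := M.
have evu : e (nth x0 xs v) (nth x0 xs u) = b.
  apply: (hV b p); rewrite ?(perm_mem pp) ?inE ?eqxx ?orbT //.
  by rewrite /glue mem_cat pr orbT.
have -> : pair_up s b v u = learn (let: State l m ne ed st cl := s in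
    let p := [:: minn v u; maxn v u] in
    if b then State l m ne ed st (p :: cl) else State l m ne ed (p :: st) cl) b v u.
  by case: s {M hV lv lu}.
apply: learn_models => //.
case: M => [uxs xsV fs r2 [uV pV _ ltV]].
set s1 := (X in models X _ _ _); set rest1 := (X in models _ _ X _).
have partsE b' : parts s1 b' = if b' == b then [:: minn v u; maxn v u] :: parts s b' else parts s b'.
  by rewrite /s1; case: (s) => *; case: (b); case: b'.
have factsE : facts s1 = facts s by rewrite /s1; case: (s) => *; case: (b).
have vertsE : verts s1 = verts s by rewrite /s1; case: (s) => *; case: (b).
have pX : perm_eq (map (nth x0 xs) [:: minn v u; maxn v u]) p.
  rewrite (permPr pp) -/(map (nth x0 xs) [:: v; u]); apply: perm_map.
  rewrite /minn /maxn; case: ltnP => // _.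
  by rewrite (perm_catC [:: u] [:: v]).
have glueE b' : perm_eq (flatten (glue xs s1 rest1 b')) (flatten (glue xs s rest b')).
  rewrite /glue partsE /rest1; case: eqP => [->|//] /=.
  rewrite !flatten_cat /=; have := perm_flatten (perm_to_rem pr); rewrite /= => pr'.
  rewrite (permPr (perm_cat (perm_refl _) pr')).
  rewrite -[X in perm_eq X _]/(map (nth x0 xs) [:: minn v u; maxn v u] ++ _).
  by rewrite perm_catCA perm_cat2l perm_cat2r.
split=> //.
- by rewrite vertsE.
- by move=> b'; rewrite factsE; apply: fs.
- move=> b' r; rewrite /rest1; case: eqP => _; last exact: r2.
  by move=> /mem_rem; apply: r2.
split=> //.
- by move=> b'; rewrite (permPl (glueE b')).
- move=> b' r; rewrite /glue partsE /rest1 mem_cat; case: eqP => [->|_] /=.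
    rewrite inE -orbA => /or3P[/eqP->|rin|/mem_rem rin].
    + apply: (@homog_sub _ _ _ p); first by move=> x; rewrite (perm_mem pX).
      by apply: hV; rewrite mem_cat pr orbT.
    + by apply: hV; rewrite mem_cat rin.
    + by apply: hV; rewrite mem_cat rin orbT.
  by move=> rin; apply: hV; rewrite mem_cat.
- suff szE b' : size (glue xs s1 rest1 b') = size (glue xs s rest b') by rewrite !szE.
  rewrite /glue partsE /rest1; case: eqP => [->|//]; rewrite !size_cat !size_map /= size_rem //.
  by case: (rest b) pr => //= *; rewrite addnS.
Qed.

Definition refuted s := forall (xs : seq T) rest V, models s xs rest V -> improvable e (level s) V.

Lemma level_learn s b i j : level (learn s b i j) = level s.
Proof. by case: s b => ? ? ? ? ? ? []. Qed.

Lemma level_reveal s b v u : level (reveal s b v u) = level s.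
Proof. by rewrite /reveal; case: eqP => _; case: s b => ? ? ? ? ? ? []. Qed.

Lemma find_child (P : tree -> Prop) (q : pred (nat * tree)) ts u :
    foldr (fun ut => and (P ut.2)) True ts -> all q ts -> u \in [seq ut.1 | ut <- ts] ->
  exists2 t, P t & q (u, t).
Proof.
elim: ts => //= -[u' t] ts IH [Pt Pts] /andP[qt qts]; rewrite inE /=.
by case/predU1P=> [->|/(IH Pts qts)//]; exists t.
Qed.

Lemma flatten_part_uniq (p : seq T) ss : uniq (flatten ss) -> p \in ss -> uniq p.
Proof.
move=> uss pss; have /perm_flatten/perm_uniq := perm_to_rem pss.
by rewrite uss cat_uniq => /esym/andP[].
Qed.

Lemma size2_perm (p : seq T) x : size p = 2 -> uniq p -> x \in p ->
  exists2 y, perm_eq p [:: x; y] & x != y.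
Proof.
case: p => [|a [|c []]] //= _; rewrite inE andbT => ac; rewrite !inE.
case/orP=> /eqP->; first by exists c.
by exists a; [rewrite (perm_catC [:: a] [:: c])|rewrite eq_sym].
Qed.

(** For [Partner], the part of kind [b] that contains [v] is unlisted, hence a pair. Its other
    vertex cannot lie in a listed part of kind [b], nor have the wrong adjacency to [v], so the
    branches cover all possibilities. *)
Lemma check_sound db t s : (forall d k, k < size db -> refuted (nth d db k)) ->
  check db t s -> refuted s.
Proof.
move=> dbP; elim/tree_nested_ind: t s => [A B|D A B|i j t1 t2 IH1 IH2|b v ts IH|k f] s /=.
- by move=> ck xs rest V M; apply: check_small_sound M ck.
- by move=> ck xs rest V M; apply: check_swap_sound M ck.
- case/and5P=> _ _ _ ck1 ck2 xs rest V M.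
  case eij : (e (nth x0 xs i) (nth x0 xs j)).
    by rewrite -(level_learn s true i j); apply: (IH1 _ ck1 xs rest); apply: learn_models.
  by rewrite -(level_learn s false i j); apply: (IH2 _ ck2 xs rest); apply: learn_models.
- case/and5P=> wfs lv vparts /andP[coverm /allP cover] ck xs rest V M.
  have [[uxs sxs] xsV fs r2 [uV pV hV ltV]] := M.
  pose xv := nth x0 xs v.
  have uG : uniq (flatten (glue xs s rest b)) by rewrite (perm_uniq (pV b)).
  have [p pr xp] : exists2 p, p \in rest b & xv \in p.
    have: xv \in V by apply/xsV/mem_nth; rewrite sxs.
    rewrite -(perm_mem (pV b)) => /flattenP[p].
    rewrite mem_cat => /orP[/mapP[q qin ->]|]; last by exists p.
    case/mapP=> i iq xvi; case/negP: vparts; suff -> : v = i by apply/flattenP; exists q.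
    apply/eqP; rewrite -(nth_uniq x0 _ _ uxs) ?sxs //; first exact/eqP.
    by apply: (wfP (b := b) wfs); apply/flattenP; exists q.
  have pG : p \in glue xs s rest b by rewrite mem_cat pr orbT.
  have [y py xy] := size2_perm (r2 _ _ pr) (flatten_part_uniq uG pG) xp.
  have yp : y \in p by rewrite (perm_mem py) !inE eqxx orbT.
  have yV : y \in V by rewrite -(perm_mem (pV b)); apply/flattenP; exists p.
  have exy : e xv y = b by apply: (hV b p).
  have goal u : u \in [seq ut.1 | ut <- ts] ->
      (forall s', level s' = level s -> s' = reveal s b v u ->
        exists xs' rest', models s' xs' rest' V) ->
      improvable e (level s) V.
    move=> /(find_child (P := fun t => forall s, check db t s -> refuted s) IH ck)[t IHt ckt] H.
    have [|xs' [rest' M']] := H _ _ erefl; first exact: level_reveal.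
    by rewrite -(level_reveal s b v u); apply: IHt M'.
  case: (boolP (y \in xs)) => yxs.
    pose u := index y xs; have lu : u < verts s by rewrite -sxs index_mem.
    have yE : nth x0 xs u = y by apply: nth_index.
    have uin : u \in iota 0 (verts s) by rewrite mem_iota.
    case/or4P: (cover u uin) => [/eqP uv|uparts|kn|].
    + by rewrite /xv -uv yE eqxx in xy.
    + move: uG; rewrite flatten_cat cat_uniq => /and3P[_ /hasP[]].
      exists y; first by apply/flattenP; exists p.
      by rewrite /= -map_flatten -yE map_f.
    + by have := knowsP M kn; rewrite yE e_sym exy; case: (b).
    + move/goal; apply=> s' _ ->.
      exists xs, (fun b' => if b' == b then rem p (rest b) else rest b').
      by rewrite /reveal ltn_eqF //; apply: pair_up_models; rewrite ?yE.
  (* A partner outside [xs] gets the number [verts s], which a well-formed state does not mention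
     yet; so none of the reasons for omitting it applies. *)
  pose u := verts s.
  case/or4P: coverm => [/eqP uv|uparts|kn|].
  + by rewrite uv ltnn in lv.
  + by have := wfP wfs uparts; rewrite ltnn.
  + by case/orP: kn => /(wf_facts wfs)[]; rewrite /u ltnn.
  + move/goal; apply=> s' _ ->.
    exists (rcons xs y), (fun b' => if b' == b then rem p (rest b) else rest b').
    have nv : nth x0 (rcons xs y) v = xv by rewrite nth_rcons sxs lv.
    have nu : nth x0 (rcons xs y) u = y by rewrite nth_rcons sxs ltnn eqxx.
    rewrite /reveal eqxx; apply: pair_up_models; rewrite ?nv ?nu //=; first exact: ltnW.
    exact: extend_models.
- by case/andP=> kdb ck xs rest V M; apply: check_cite_sound M ck _ => xs' rest'; apply: dbP.
Qed.

Lemma check_all_sound db l : (forall d k, k < size db -> refuted (nth d db k)) ->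
  check_all db l -> forall d k, k < size l -> refuted (nth d (map fst l) k).
Proof.
elim: l db => //= -[s t] l IH db dbP /andP[ck ckl] d [_|k kl] /=.
  exact: check_sound ck.
apply: (IH _ _ ckl) => // d' k'; rewrite size_rcons nth_rcons ltnS => lk'.
case: ltnP => [/dbP//|dbk]; rewrite (eqP (_ : k' == size db)) ?eqxx ?eqn_leq ?lk' //.
exact: check_sound ck.
Qed.

End Soundness.

(** Counted from 0, the entries 2, 6, 13 and 24 are the starting positions, each at the end of its
    level: a clique on four vertices, a stable triple and a clique triple with a common vertex, such
    triples without a common vertex, and two clique triples. Every other entry is an intermediate
    situation, placed before the trees that cite it up to renumbering. *)
Definition refutations : seq (state * tree) := [::
 (State 0 8
   [:: (3, 4); (4, 7); (5, 6)]
   [:: (0, 1); (0, 2); (0, 3); (1, 2); (1, 3); (2, 3); (3, 6); (4, 5); (6, 7)]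
   [:: [:: 3; 4]; [:: 5; 6]]
   [:: [:: 0; 1; 2; 3]; [:: 6; 7]],
  Partner false 7 [:: (8, Branch 5 8
    (Branch 4 8
      (Branch 3 7
        (Small [:: [:: 3; 4]; [:: 5; 6]; [:: 7; 8]] [:: [:: 3; 6; 7]; [:: 4; 5; 8]])
        (Swap [:: 8] [:: [:: 3; 4; 7]] [:: [:: 0; 1; 2; 3]]))
      (Swap [:: 3] [:: [:: 4; 7; 8]] [:: [:: 0; 1; 2]]))
    (Swap [:: 6; 7] [:: [:: 5; 8]] [:: [:: 0; 1; 2; 3]]));
   (0, Branch 3 7
    (Branch 0 5
      (Branch 0 4
        (Small [:: [:: 0; 7]; [:: 3; 4]; [:: 5; 6]] [:: [:: 0; 4; 5]; [:: 3; 6; 7]])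
        (Swap [:: 3] [:: [:: 0; 4; 7]] [:: [:: 0; 1; 2]]))
      (Swap [:: 6; 7] [:: [:: 0; 5]] [:: [:: 0; 1; 2; 3]]))
    (Swap [:: 0] [:: [:: 3; 4; 7]] [:: [:: 1; 2; 3]]));
   (1, Branch 3 7
    (Branch 1 5
      (Branch 1 4
        (Small [:: [:: 1; 7]; [:: 3; 4]; [:: 5; 6]] [:: [:: 1; 4; 5]; [:: 3; 6; 7]])
        (Swap [:: 3] [:: [:: 1; 4; 7]] [:: [:: 0; 1; 2]]))
      (Swap [:: 6; 7] [:: [:: 1; 5]] [:: [:: 0; 1; 2; 3]]))
    (Swap [:: 1] [:: [:: 3; 4; 7]] [:: [:: 0; 2; 3]]));
   (2, Branch 3 7
    (Branch 2 5
      (Branch 2 4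
        (Small [:: [:: 2; 7]; [:: 3; 4]; [:: 5; 6]] [:: [:: 2; 4; 5]; [:: 3; 6; 7]])
        (Swap [:: 3] [:: [:: 2; 4; 7]] [:: [:: 0; 1; 2]]))
      (Swap [:: 6; 7] [:: [:: 2; 5]] [:: [:: 0; 1; 2; 3]]))
    (Swap [:: 2] [:: [:: 3; 4; 7]] [:: [:: 0; 1; 3]]))]);
 (State 0 8
   [:: (0, 5); (2, 6); (3, 4)]
   [:: (0, 1); (0, 2); (0, 3); (1, 2); (1, 3); (1, 7); (2, 3); (4, 5); (6, 7)]
   [:: [:: 3; 4]; [:: 0; 5]; [:: 2; 6]]
   [:: [:: 0; 1; 2; 3]; [:: 4; 5]; [:: 6; 7]],
  Partner false 7 [:: (8, Branch 2 8
    (Partner true 8 [:: (9, Branch 6 9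
       (Swap [:: 7; 8] [::] [:: [:: 0; 1; 2; 3]; [:: 6; 9]])
       (Cite 0 [:: 0; 1; 3; 2; 6; 7; 8; 9]))])
    (Swap [:: 6; 7] [:: [:: 2; 8]] [:: [:: 0; 1; 2; 3]]))]);
 (State 0 4 [::] [:: (0, 1); (0, 2); (0, 3); (1, 2); (1, 3); (2, 3)] [::] [:: [:: 0; 1; 2; 3]],
  Partner false 3 [:: (4, Partner true 4 [:: (5, Partner false 5 [:: (6, Branch 3 6
      (Partner true 6 [:: (7, Branch 4 7
         (Swap [:: 5; 6] [::] [:: [:: 0; 1; 2; 3]; [:: 4; 7]])
         (Cite 0 [:: 0; 1; 2; 3; 4; 5; 6; 7]))])
      (* The usual shortcut: the stable pairs {3, 4} and {5, 6} merge into {3, 6}, and the clique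
         {4, 5} disappears with its two vertices. *)
      (Swap [:: 4; 5] [:: [:: 3; 6]] [:: [:: 0; 1; 2; 3]]));
     (0, Partner false 2 [:: (6, Partner true 6 [:: (7, Branch 1 7
        (Cite 1 [:: 0; 1; 2; 3; 4; 5; 6; 7])
        (Small [:: [:: 0; 5]; [:: 1; 7]; [:: 2; 6]; [:: 3; 4]]
          [:: [:: 0; 1; 2; 3]; [:: 4; 5]; [:: 6; 7]]))])]);
     (1, Partner false 2 [:: (6, Partner true 6 [:: (7, Branch 0 7
        (Cite 1 [:: 1; 0; 2; 3; 4; 5; 6; 7])
        (Small [:: [:: 0; 7]; [:: 1; 5]; [:: 2; 6]; [:: 3; 4]]
          [:: [:: 0; 1; 2; 3]; [:: 4; 5]; [:: 6; 7]]))])]);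
     (2, Partner false 1 [:: (6, Partner true 6 [:: (7, Branch 0 7
        (Cite 1 [:: 2; 0; 1; 3; 4; 5; 6; 7])
        (Small [:: [:: 0; 7]; [:: 1; 6]; [:: 2; 5]; [:: 3; 4]]
          [:: [:: 0; 1; 2; 3]; [:: 4; 5]; [:: 6; 7]]))])])])])]);
 (State 1 9
   [:: (0, 3); (0, 4); (0, 7); (3, 4); (4, 7); (5, 6); (7, 8)]
   [:: (0, 1); (0, 2); (0, 5); (1, 2); (1, 7); (3, 7); (4, 5); (5, 8); (6, 7)]
   [:: [:: 0; 3; 4]; [:: 5; 6]; [:: 7; 8]]
   [:: [:: 0; 1; 2]; [:: 4; 5]; [:: 6; 7]],
  Branch 2 7
   (Branch 2 5
     (Branch 1 6
       (* One vertex goes, and what remains of the three cliques {0, 1, 2}, {4, 5} and {6, 7} is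
          regrouped into two. *)
       (Swap [:: 4] [:: [:: 0; 3]] [:: [:: 0; 2; 5]; [:: 1; 6; 7]])
       (Branch 1 5
         (Swap [:: 4] [:: [:: 0; 3]] [:: [:: 0; 1; 2; 5]])
         (Small [:: [:: 0; 4; 7]; [:: 1; 5; 6]] [:: [:: 0; 1]; [:: 4; 5]; [:: 6; 7]])))
     (Branch 2 6
       (Branch 1 6
         (Swap [:: 0] [:: [:: 3; 4]] [:: [:: 1; 2; 6; 7]])
         (Small [:: [:: 0; 4; 7]; [:: 1; 6]; [:: 2; 5]] [:: [:: 0; 1; 2]; [:: 4; 5]; [:: 6; 7]]))
       (Small [:: [:: 0; 4; 7]; [:: 2; 5; 6]] [:: [:: 0; 2]; [:: 4; 5]; [:: 6; 7]])))
   (Branch 3 6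
     (Small [:: [:: 0; 3; 4]; [:: 2; 7]; [:: 5; 6]] [:: [:: 0; 2]; [:: 3; 6; 7]; [:: 4; 5]])
     (Branch 3 5
       (Branch 1 5
         (Branch 2 5
           (Swap [:: 4] [:: [:: 0; 3]] [:: [:: 0; 1; 2; 5]])
           (Branch 5 7
             (Branch 4 8
               (Small [:: [:: 0; 3; 4]; [:: 2; 5]; [:: 7; 8]]
                 [:: [:: 0; 2]; [:: 3; 7]; [:: 4; 5; 8]])
               (Branch 2 6
                 (Branch 1 6
                   (Branch 3 8
                     (Branch 2 8
                       (Branch 0 8
                         (Small [:: [:: 0; 3]; [:: 2; 5]; [:: 7; 8]]
                           [:: [:: 0; 2; 8]; [:: 3; 5; 7]])
                         (Small [:: [:: 0; 7; 8]; [:: 2; 5]; [:: 3; 6]]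
                           [:: [:: 0; 2]; [:: 3; 5; 8]; [:: 6; 7]]))
                       (Small [:: [:: 0; 3]; [:: 2; 7; 8]; [:: 5; 6]]
                         [:: [:: 0; 2]; [:: 3; 5; 8]; [:: 6; 7]]))
                     (Swap [:: 0; 7] [:: [:: 3; 4; 8]] [:: [:: 1; 2; 6]]))
                   (Small [:: [:: 0; 4; 7]; [:: 1; 6]; [:: 2; 5]]
                     [:: [:: 0; 1; 2]; [:: 4; 5]; [:: 6; 7]]))
                 (Small [:: [:: 0; 4; 7]; [:: 2; 5; 6]] [:: [:: 0; 2]; [:: 4; 5]; [:: 6; 7]])))
             (Small [:: [:: 0; 3; 4]; [:: 2; 5; 7]] [:: [:: 0; 2]; [:: 3; 7]; [:: 4; 5]])))
         (Small [:: [:: 0; 3; 4]; [:: 1; 5]; [:: 2; 7]] [:: [:: 0; 1; 2]; [:: 3; 7]; [:: 4; 5]]))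
       (Swap [:: 8] [:: [:: 0; 4; 7]; [:: 3; 5; 6]] [:: [:: 0; 1; 2]]))));
 (State 1 9
   [:: (0, 3); (0, 4); (1, 7); (3, 4); (4, 7); (5, 6)]
   [:: (0, 1); (0, 2); (1, 2); (1, 5); (3, 8); (4, 5); (6, 7)]
   [:: [:: 0; 3; 4]; [:: 5; 6]; [:: 1; 7]]
   [:: [:: 0; 1; 2]; [:: 4; 5]; [:: 6; 7]; [:: 3; 8]],
  Branch 0 5
   (Branch 2 5
     (Swap [:: 4] [:: [:: 0; 3]] [:: [:: 0; 1; 2; 5]])
     (Branch 3 7
       (Small [:: [:: 0; 3; 4]; [:: 1; 7]; [:: 2; 5]] [:: [:: 0; 1; 2]; [:: 3; 7]; [:: 4; 5]])
       (Branch 2 6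
         (Branch 2 7
           (Swap [:: 0; 1] [:: [:: 3; 4; 7]] [:: [:: 2; 6; 7]])
           (Branch 0 7
             (Branch 0 6
               (Swap [:: 1; 7] [:: [:: 0; 3; 4]] [:: [:: 0; 2; 6]])
               (Branch 4 6
                 (Branch 3 6
                   (Branch 6 8
                     (Swap [:: 7] [:: [:: 0; 3; 4]; [:: 1]] [:: [:: 0; 1; 2]; [:: 3; 6; 8]])
                     (Branch 5 8
                       (Branch 5 7
                         (Branch 7 8
                           (Small [:: [:: 0; 4]; [:: 1; 7]; [:: 2; 5]; [:: 6; 8]]
                             [:: [:: 0; 1; 2]; [:: 4; 6]; [:: 5; 7; 8]])
                           (Small [:: [:: 0; 3; 4]; [:: 5; 6]; [:: 7; 8]]
                             [:: [:: 0; 5; 7]; [:: 3; 8]; [:: 4; 6]]))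
                         (Small [:: [:: 0; 3; 4]; [:: 2; 5; 7]; [:: 6; 8]]
                           [:: [:: 0; 7]; [:: 2; 6]; [:: 3; 8]; [:: 4; 5]]))
                       (Small [:: [:: 3; 4; 7]; [:: 5; 6; 8]] [:: [:: 3; 8]; [:: 4; 5]; [:: 6; 7]])))
                   (Swap [:: 4; 5] [:: [:: 0; 3; 6]] [:: [:: 0; 1; 2]]))
                 (Small [:: [:: 0; 4; 6]; [:: 1; 7]; [:: 2; 5]]
                   [:: [:: 0; 1; 2]; [:: 4; 5]; [:: 6; 7]])))
             (Swap [:: 1] [:: [:: 0; 3; 4; 7]] [:: [:: 0; 2]])))
         (Small [:: [:: 0; 4]; [:: 1; 7]; [:: 2; 5; 6]] [:: [:: 0; 1; 2]; [:: 4; 5]; [:: 6; 7]]))))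
   (Branch 2 5
     (Branch 3 5
       (Branch 5 8
         (Swap [:: 4] [:: [:: 0; 3]] [:: [:: 0; 1; 2]; [:: 3; 5; 8]])
         (Branch 6 8
           (Branch 7 8
             (Swap [:: 3] [:: [:: 0; 4]] [:: [:: 0; 1; 2]; [:: 6; 7; 8]])
             (Branch 3 6
               (Swap [:: 7] [:: [:: 0; 3; 4]; [:: 1]] [:: [:: 0; 1; 2]; [:: 3; 6; 8]])
               (Branch 1 8
                 (Branch 0 6
                   (Branch 2 6
                     (Swap [:: 1; 7] [:: [:: 0; 3; 4]] [:: [:: 0; 2; 6]])
                     (Branch 5 7
                       (Branch 3 7
                         (Small [:: [:: 0; 3]; [:: 1; 7]; [:: 2; 6]; [:: 5; 8]]
                           [:: [:: 0; 1; 2]; [:: 3; 5; 7]; [:: 6; 8]])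
                         (Branch 2 4
                           (Small [:: [:: 2; 6]; [:: 3; 4; 7]; [:: 5; 8]]
                             [:: [:: 2; 4; 5]; [:: 3; 8]; [:: 6; 7]])
                           (Branch 4 6
                             (Branch 4 8
                               (Small [:: [:: 0; 3; 4]; [:: 2; 6]; [:: 5; 8]]
                                 [:: [:: 0; 2]; [:: 3; 5]; [:: 4; 6; 8]])
                               (Branch 2 7
                                 (Small [:: [:: 2; 6]; [:: 3; 4; 7]; [:: 5; 8]]
                                   [:: [:: 2; 5; 7]; [:: 3; 8]; [:: 4; 6]])
                                 (Branch 2 8
                                   (Branch 2 3
                                     (Small [:: [:: 2; 6]; [:: 3; 4; 7]; [:: 5; 8]]
                                       [:: [:: 2; 3; 8]; [:: 4; 6]; [:: 5; 7]])
                                     (Small [:: [:: 1; 7]; [:: 2; 3; 6]; [:: 5; 8]]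
                                       [:: [:: 1; 2; 8]; [:: 3; 5]; [:: 6; 7]]))
                                   (Small [:: [:: 0; 5]; [:: 2; 4; 7; 8]; [:: 3; 6]]
                                     [:: [:: 0; 2]; [:: 3; 8]; [:: 4; 6]; [:: 5; 7]]))))
                             (Small [:: [:: 0; 5]; [:: 1; 7]; [:: 2; 4; 6]]
                               [:: [:: 0; 1; 2]; [:: 4; 5]; [:: 6; 7]]))))
                       (Small [:: [:: 0; 3; 4]; [:: 2; 6]; [:: 5; 7; 8]]
                         [:: [:: 0; 2]; [:: 3; 8]; [:: 4; 5]; [:: 6; 7]])))
                   (Swap [:: 4; 5] [:: [:: 0; 3; 6]] [:: [:: 0; 1; 2]]))
                 (Small [:: [:: 0; 3; 4]; [:: 1; 7; 8]; [:: 5; 6]]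
                   [:: [:: 0; 1]; [:: 3; 8]; [:: 4; 5]; [:: 6; 7]]))))
           (Small [:: [:: 0; 3; 4]; [:: 1; 7]; [:: 5; 6; 8]]
             [:: [:: 0; 1]; [:: 3; 8]; [:: 4; 5]; [:: 6; 7]])))
       (Branch 5 7
         (Swap [:: 4; 6] [:: [:: 0; 3; 5]] [:: [:: 0; 1; 2]; [:: 5; 7]])
         (Branch 3 6
           (Branch 6 8
             (Swap [:: 7] [:: [:: 0; 3; 4]; [:: 1]] [:: [:: 0; 1; 2]; [:: 3; 6; 8]])
             (Branch 5 8
               (Branch 4 8
                 (Swap [:: 3] [:: [:: 0; 4]] [:: [:: 0; 1; 2]; [:: 4; 5; 8]])
                 (Branch 3 7
                   (Small [:: [:: 0; 3; 5]; [:: 1; 7]; [:: 6; 8]]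
                     [:: [:: 0; 1]; [:: 3; 6; 7]; [:: 5; 8]])
                   (Branch 2 4
                     (Swap [:: 0; 1] [:: [:: 3; 4; 7]] [:: [:: 2; 4; 5]])
                     (Branch 2 8
                       (Branch 2 7
                         (Branch 7 8
                           (Small [:: [:: 2; 4]; [:: 3; 5; 7]; [:: 6; 8]]
                             [:: [:: 2; 7; 8]; [:: 3; 6]; [:: 4; 5]])
                           (Branch 2 6
                             (Small [:: [:: 2; 4]; [:: 3; 5; 7]; [:: 6; 8]]
                               [:: [:: 2; 6; 7]; [:: 3; 8]; [:: 4; 5]])
                             (Small [:: [:: 0; 3; 5]; [:: 2; 6]; [:: 4; 7; 8]]
                               [:: [:: 0; 2]; [:: 3; 8]; [:: 4; 5]; [:: 6; 7]])))
                         (Small [:: [:: 0; 3; 5]; [:: 2; 4; 7]; [:: 6; 8]]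
                           [:: [:: 0; 2]; [:: 3; 8]; [:: 4; 5]; [:: 6; 7]]))
                       (Small [:: [:: 0; 3; 5]; [:: 2; 4; 8]] [:: [:: 0; 2]; [:: 3; 8]; [:: 4; 5]])))))
               (Small [:: [:: 0; 3; 4]; [:: 1; 7]; [:: 5; 6; 8]]
                 [:: [:: 0; 1]; [:: 3; 8]; [:: 4; 5]; [:: 6; 7]])))
           (Swap [:: 0; 4] [:: [:: 3; 5; 6]] [:: [:: 1; 2; 5]]))))
     (Branch 3 7
       (Small [:: [:: 0; 3; 4]; [:: 1; 7]; [:: 2; 5]] [:: [:: 0; 1; 2]; [:: 3; 7]; [:: 4; 5]])
       (Branch 2 6
         (Branch 0 6
           (Swap [:: 1; 7] [:: [:: 0; 3; 4]] [:: [:: 0; 2; 6]])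
           (Swap [:: 1] [:: [:: 0; 5; 6]; [:: 3; 4; 7]] [:: [:: 0; 2]]))
         (Small [:: [:: 0; 4]; [:: 1; 7]; [:: 2; 5; 6]] [:: [:: 0; 1; 2]; [:: 4; 5]; [:: 6; 7]])))));
 (State 1 7
   [:: (0, 3); (0, 4); (3, 4); (5, 6)]
   [:: (0, 1); (0, 2); (1, 2); (4, 5)]
   [:: [:: 0; 3; 4]; [:: 5; 6]]
   [:: [:: 0; 1; 2]; [:: 4; 5]],
  Partner true 6 [:: (7, Branch 4 7
    (Swap [:: 5; 6] [:: [:: 0; 3; 4]] [:: [:: 0; 1; 2]; [:: 4; 7]])
    (Partner false 7 [:: (8, Branch 5 8
       (Branch 0 7
         (Branch 0 5
           (Branch 0 6
             (Branch 4 8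
               (Small [:: [:: 0; 4]; [:: 5; 6]; [:: 7; 8]] [:: [:: 0; 6; 7]; [:: 4; 5; 8]])
               (Branch 3 8
                 (Small [:: [:: 0; 3; 4]; [:: 5; 6]; [:: 7; 8]]
                   [:: [:: 0; 6; 7]; [:: 3; 8]; [:: 4; 5]])
                 (Partner true 8 [:: (9, Branch 6 9
                    (Swap [:: 7; 8] [:: [:: 0; 3; 4]] [:: [:: 0; 1; 2]; [:: 6; 9]])
                    (Branch 5 9
                      (Swap [:: 4] [:: [:: 0; 3]] [:: [:: 0; 1; 2]; [:: 5; 8; 9]])
                      (Small [:: [:: 4; 7; 8]; [:: 5; 6; 9]] [:: [:: 4; 5]; [:: 6; 7]; [:: 8; 9]])))])))
             (Branch 3 6
               (Branch 4 8
                 (Small [:: [:: 0; 3; 4]; [:: 5; 6]; [:: 7; 8]]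
                   [:: [:: 0; 7]; [:: 3; 6]; [:: 4; 5; 8]])
                 (Branch 4 6
                   (Branch 6 8
                     (Branch 3 8
                       (Small [:: [:: 0; 3; 4]; [:: 5; 6]; [:: 7; 8]]
                         [:: [:: 0; 7]; [:: 3; 6; 8]; [:: 4; 5]])
                       (Swap [:: 5; 7] [:: [:: 0; 6]; [:: 3; 4; 8]] [:: [:: 0; 1; 2]; [:: 4; 6]]))
                     (Swap [:: 5; 7] [:: [:: 0; 3; 4]; [:: 6; 8]] [:: [:: 0; 1; 2]; [:: 4; 6]]))
                   (Branch 6 8
                     (Branch 3 8
                       (Small [:: [:: 0; 3; 4]; [:: 5; 6]; [:: 7; 8]]
                         [:: [:: 0; 7]; [:: 3; 6; 8]; [:: 4; 5]])
                       (Branch 3 7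
                         (Branch 2 7
                           (Branch 1 7
                             (Swap [:: 6] [:: [:: 0; 3; 4]; [:: 5]] [:: [:: 0; 1; 2; 7]])
                             (Small [:: [:: 0; 3; 4]; [:: 1; 7]; [:: 5; 6]]
                               [:: [:: 0; 1]; [:: 3; 6; 7]; [:: 4; 5]]))
                           (Small [:: [:: 0; 3; 4]; [:: 2; 7]; [:: 5; 6]]
                             [:: [:: 0; 2]; [:: 3; 6; 7]; [:: 4; 5]]))
                         (Swap [:: 0] [:: [:: 3; 4; 7; 8]] [:: [:: 1; 2]])))
                     (Branch 1 6
                       (Branch 0 8
                         (Branch 3 7
                           (Small [:: [:: 0; 3]; [:: 5; 6]; [:: 7; 8]]
                             [:: [:: 0; 5; 8]; [:: 3; 6; 7]])
                           (Branch 3 8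
                             (Branch 2 4
                               (Branch 2 5
                                 (Branch 3 5
                                   (Branch 2 7
                                     (Branch 5 7
                                       (Swap [:: 4] [:: [:: 0; 3]] [:: [:: 0; 2; 5; 7]; [:: 1; 6]])
                                       (Branch 2 6
                                         (Branch 1 7
                                           (Swap [:: 0] [:: [:: 3; 4]] [:: [:: 1; 2; 6; 7]])
                                           (Branch 1 8
                                             (Branch 1 5
                                               (Swap [:: 4] [:: [:: 0; 3]] [:: [:: 0; 1; 2; 5]])
                                               (Small [:: [:: 1; 5; 7]; [:: 4; 6; 8]]
                                                 [:: [:: 1; 8]; [:: 4; 5]; [:: 6; 7]]))
                                             (Small [:: [:: 0; 3]; [:: 1; 7; 8]; [:: 5; 6]]
                                               [:: [:: 0; 7]; [:: 1; 6]; [:: 3; 5; 8]])))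
                                         (Small [:: [:: 0; 3; 4]; [:: 2; 6]; [:: 5; 7]]
                                           [:: [:: 0; 7]; [:: 2; 4; 5]; [:: 3; 6]])))
                                     (Small [:: [:: 0; 3; 4]; [:: 2; 7]; [:: 5; 6]]
                                       [:: [:: 0; 7]; [:: 2; 4; 5]; [:: 3; 6]]))
                                   (Swap [:: 0; 7]
                                     [:: [:: 3; 5]; [:: 4; 6; 8]]
                                     [:: [:: 1; 6]; [:: 2; 4; 5]]))
                                 (Small [:: [:: 0; 6]; [:: 2; 5]; [:: 4; 7; 8]]
                                   [:: [:: 0; 5; 8]; [:: 2; 4]; [:: 6; 7]]))
                               (Branch 2 3
                                 (Branch 2 6
                                   (Branch 5 7
                                     (Swap [:: 4] [:: [:: 0; 3]] [:: [:: 0; 5; 7]; [:: 1; 2; 6]])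
                                     (Branch 3 5
                                       (Branch 2 7
                                         (Branch 2 5
                                           (Branch 1 7
                                             (Swap [:: 0] [:: [:: 3; 4]] [:: [:: 1; 2; 6; 7]])
                                             (Branch 1 8
                                               (Branch 1 5
                                                 (Swap [:: 4] [:: [:: 0; 3]] [:: [:: 0; 1; 2; 5]])
                                                 (Small [:: [:: 1; 5; 7]; [:: 4; 6; 8]]
                                                   [:: [:: 1; 8]; [:: 4; 5]; [:: 6; 7]]))
                                               (Small [:: [:: 0; 3]; [:: 1; 7; 8]; [:: 5; 6]]
                                                 [:: [:: 0; 7]; [:: 1; 6]; [:: 3; 5; 8]])))
                                           (Small [:: [:: 2; 5]; [:: 3; 7]; [:: 6; 8]]
                                             [:: [:: 2; 6; 7]; [:: 3; 5; 8]]))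
                                         (Small [:: [:: 0; 3; 4]; [:: 2; 7]; [:: 5; 6]]
                                           [:: [:: 0; 7]; [:: 2; 3; 6]; [:: 4; 5]]))
                                       (Small [:: [:: 3; 5; 7]; [:: 4; 6; 8]]
                                         [:: [:: 3; 8]; [:: 4; 5]; [:: 6; 7]])))
                                   (Branch 2 5
                                     (Branch 1 7
                                       (Swap [:: 4] [:: [:: 0; 3]] [:: [:: 0; 2; 5]; [:: 1; 6; 7]])
                                       (Branch 2 8
                                         (Branch 3 5
                                           (Branch 1 8
                                             (Branch 1 5
                                               (Swap [:: 4] [:: [:: 0; 3]] [:: [:: 0; 1; 2; 5]])
                                               (Small [:: [:: 1; 5]; [:: 2; 6]; [:: 4; 7; 8]]
                                                 [:: [:: 1; 2; 8]; [:: 4; 5]; [:: 6; 7]]))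
                                             (Small [:: [:: 0; 3]; [:: 1; 7; 8]; [:: 5; 6]]
                                               [:: [:: 0; 7]; [:: 1; 6]; [:: 3; 5; 8]]))
                                           (Small [:: [:: 2; 6]; [:: 3; 5]; [:: 4; 7; 8]]
                                             [:: [:: 2; 3; 8]; [:: 4; 5]; [:: 6; 7]]))
                                         (Small [:: [:: 0; 3]; [:: 1; 7]; [:: 2; 6; 8]]
                                           [:: [:: 0; 1; 2]; [:: 3; 8]; [:: 6; 7]])))
                                     (Small [:: [:: 2; 5; 6]; [:: 3; 4; 7]]
                                       [:: [:: 2; 3]; [:: 4; 5]; [:: 6; 7]])))
                                 (Branch 1 5
                                   (Branch 2 5
                                     (Swap [:: 4] [:: [:: 0; 3]] [:: [:: 0; 1; 2; 5]])
                                     (Branch 3 5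
                                       (Branch 2 8
                                         (Small [:: [:: 0; 6]; [:: 2; 5]; [:: 4; 7; 8]]
                                           [:: [:: 0; 2; 8]; [:: 4; 5]; [:: 6; 7]])
                                         (Branch 2 7
                                           (Small [:: [:: 0; 3]; [:: 2; 5]; [:: 7; 8]]
                                             [:: [:: 0; 2; 7]; [:: 3; 5; 8]])
                                           (Small [:: [:: 0; 3]; [:: 2; 7; 8]; [:: 5; 6]]
                                             [:: [:: 0; 2]; [:: 3; 5; 8]; [:: 6; 7]])))
                                       (Small [:: [:: 0; 4; 6]; [:: 2; 3; 5]]
                                         [:: [:: 0; 2]; [:: 3; 6]; [:: 4; 5]])))
                                   (Small [:: [:: 0; 6]; [:: 1; 5]; [:: 2; 3; 4]]
                                     [:: [:: 0; 1; 2]; [:: 3; 6]; [:: 4; 5]]))))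
                             (Swap [:: 0] [:: [:: 3; 4; 7; 8]] [:: [:: 1; 2]])))
                         (Branch 5 7
                           (Branch 3 8
                             (Branch 3 7
                               (Branch 3 5
                                 (Branch 2 7
                                   (Branch 2 5
                                     (Swap [:: 4] [:: [:: 0; 3]] [:: [:: 0; 2; 5; 7]; [:: 1; 6]])
                                     (Small [:: [:: 0; 3]; [:: 2; 5]; [:: 7; 8]]
                                       [:: [:: 0; 2; 7]; [:: 3; 5; 8]]))
                                   (Small [:: [:: 0; 3; 4]; [:: 2; 7]; [:: 5; 6]]
                                     [:: [:: 0; 2]; [:: 3; 6; 7]; [:: 4; 5]]))
                                 (Swap [:: 7]
                                   [:: [:: 0; 4; 6; 8]; [:: 3; 5]]
                                   [:: [:: 0; 1; 2]; [:: 6]]))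
                               (Swap [:: 5]
                                 [:: [:: 0; 6; 8]; [:: 3; 4; 7]]
                                 [:: [:: 0; 1; 2]; [:: 4]]))
                             (Swap [:: 7] [:: [:: 0; 3; 4; 8]] [:: [:: 0; 1; 2]; [:: 6]]))
                           (Swap [:: 3] [:: [:: 0; 4; 6; 8]; [:: 5; 7]] [:: [:: 0; 1; 2]])))
                       (Branch 2 5
                         (Branch 1 5
                           (Swap [:: 4] [:: [:: 0; 3]] [:: [:: 0; 1; 2; 5]])
                           (Small [:: [:: 0; 3; 4]; [:: 1; 5; 6]]
                             [:: [:: 0; 1]; [:: 3; 6]; [:: 4; 5]]))
                         (Small [:: [:: 0; 3; 4]; [:: 1; 6]; [:: 2; 5]]
                           [:: [:: 0; 1; 2]; [:: 3; 6]; [:: 4; 5]]))))))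
               (Swap [:: 4; 5] [:: [:: 0; 3; 6]] [:: [:: 0; 1; 2]])))
           (Branch 0 8
             (Branch 4 8
               (Branch 3 6
                 (Small [:: [:: 0; 3; 4]; [:: 5; 6]; [:: 7; 8]]
                   [:: [:: 0; 7]; [:: 3; 6]; [:: 4; 5; 8]])
                 (Branch 0 6
                   (Small [:: [:: 0; 4]; [:: 5; 6]; [:: 7; 8]] [:: [:: 0; 6; 7]; [:: 4; 5; 8]])
                   (Swap [:: 4; 5] [:: [:: 0; 3; 6]] [:: [:: 0; 1; 2]])))
               (Branch 3 8
                 (Branch 3 5
                   (Branch 0 6
                     (Small [:: [:: 0; 3]; [:: 5; 6]; [:: 7; 8]] [:: [:: 0; 6; 7]; [:: 3; 5; 8]])
                     (Small [:: [:: 0; 5; 6]; [:: 4; 7; 8]] [:: [:: 0; 8]; [:: 4; 5]; [:: 6; 7]]))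
                   (Small [:: [:: 0; 3; 5]; [:: 4; 7; 8]] [:: [:: 0; 7]; [:: 3; 8]; [:: 4; 5]]))
                 (Swap [:: 6; 7] [:: [:: 0; 5]; [:: 3; 4; 8]] [:: [:: 0; 1; 2]])))
             (Branch 3 8
               (Branch 0 6
                 (Small [:: [:: 0; 3; 4]; [:: 5; 6]; [:: 7; 8]]
                   [:: [:: 0; 6; 7]; [:: 3; 8]; [:: 4; 5]])
                 (Branch 4 8
                   (Branch 3 7
                     (Branch 3 6
                       (Small [:: [:: 3; 4]; [:: 5; 6]; [:: 7; 8]] [:: [:: 3; 6; 7]; [:: 4; 5; 8]])
                       (Swap [:: 4; 5] [:: [:: 0; 3; 6]] [:: [:: 0; 1; 2]]))
                     (Swap [:: 8] [:: [:: 0; 5; 6]; [:: 3; 4; 7]] [:: [:: 0; 1; 2]]))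
                   (Swap [:: 3] [:: [:: 0; 5; 6]; [:: 4; 7; 8]] [:: [:: 0; 1; 2]])))
               (Swap [:: 4; 5; 6; 7] [:: [:: 0; 3; 8]] [:: [:: 0; 1; 2]]))))
         (Branch 3 7
           (Branch 1 7
             (Branch 2 4
               (Branch 0 5
                 (Cite 3 [:: 0; 1; 2; 3; 4; 5; 6; 7; 8])
                 (Branch 0 6
                   (Branch 4 8
                     (Small [:: [:: 0; 3; 4]; [:: 5; 6]; [:: 7; 8]]
                       [:: [:: 0; 6]; [:: 3; 7]; [:: 4; 5; 8]])
                     (Branch 3 8
                       (Branch 3 5
                         (Branch 2 8
                           (Branch 0 8
                             (Branch 6 8
                               (Small [:: [:: 0; 3; 4]; [:: 5; 6]; [:: 7; 8]]
                                 [:: [:: 0; 6; 8]; [:: 3; 7]; [:: 4; 5]])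
                               (Branch 4 6
                                 (Swap [:: 5; 7]
                                   [:: [:: 0; 3; 4]; [:: 6; 8]]
                                   [:: [:: 0; 1; 2]; [:: 4; 6]])
                                 (Branch 5 7
                                   (Branch 3 6
                                     (Small [:: [:: 0; 3; 4]; [:: 5; 6]; [:: 7; 8]]
                                       [:: [:: 0; 8]; [:: 3; 6; 7]; [:: 4; 5]])
                                     (Branch 2 7
                                       (Branch 2 6
                                         (Branch 2 5
                                           (Branch 1 6
                                             (Swap [:: 0] [:: [:: 3; 4]] [:: [:: 1; 2; 6; 7]])
                                             (Branch 1 5
                                               (Swap [:: 4]
                                                 [:: [:: 0; 3]]
                                                 [:: [:: 0; 6]; [:: 1; 2; 5; 7]])
                                               (Small [:: [:: 0; 4; 7]; [:: 1; 5; 6]]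
                                                 [:: [:: 0; 6]; [:: 1; 7]; [:: 4; 5]])))
                                           (Small [:: [:: 2; 5]; [:: 3; 6]; [:: 7; 8]]
                                             [:: [:: 2; 6; 7]; [:: 3; 5; 8]]))
                                         (Small [:: [:: 0; 5]; [:: 2; 6]; [:: 4; 7; 8]]
                                           [:: [:: 0; 2; 8]; [:: 4; 5]; [:: 6; 7]]))
                                       (Small [:: [:: 0; 5]; [:: 2; 7]; [:: 4; 6; 8]]
                                         [:: [:: 0; 2; 8]; [:: 4; 5]; [:: 6; 7]])))
                                   (Small [:: [:: 0; 5; 7]; [:: 4; 6; 8]]
                                     [:: [:: 0; 8]; [:: 4; 5]; [:: 6; 7]]))))
                             (Swap [:: 3] [:: [:: 0; 4; 7; 8]] [:: [:: 0; 1; 2]]))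
                           (Small [:: [:: 0; 3; 4]; [:: 2; 8]; [:: 5; 6]]
                             [:: [:: 0; 6]; [:: 2; 4]; [:: 3; 5; 8]]))
                         (Swap [:: 6] [:: [:: 0; 3; 5]; [:: 4; 7; 8]] [:: [:: 0; 1; 2]; [:: 7]]))
                       (Swap [:: 6; 7] [:: [:: 0; 5]; [:: 3; 4; 8]] [:: [:: 0; 1; 2]])))
                   (Branch 4 8
                     (Branch 3 6
                       (Small [:: [:: 3; 4]; [:: 5; 6]; [:: 7; 8]] [:: [:: 3; 6; 7]; [:: 4; 5; 8]])
                       (Swap [:: 4; 5] [:: [:: 0; 3; 6]] [:: [:: 0; 1; 2]]))
                     (Swap [:: 3] [:: [:: 0; 5; 6]; [:: 4; 7; 8]] [:: [:: 0; 1; 2]]))))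
               (Branch 0 5
                 (Cite 3 [:: 0; 1; 2; 3; 4; 5; 6; 7; 8])
                 (Branch 5 7
                   (Branch 3 5
                     (Branch 1 5
                       (Branch 2 5
                         (Branch 2 3
                           (Branch 2 7
                             (Branch 0 6
                               (Swap [:: 4] [:: [:: 0; 3]] [:: [:: 0; 6]; [:: 1; 2; 5; 7]])
                               (Branch 4 8
                                 (Small [:: [:: 0; 5; 6]; [:: 2; 4]; [:: 7; 8]]
                                   [:: [:: 0; 2]; [:: 4; 5; 8]; [:: 6; 7]])
                                 (Swap [:: 3] [:: [:: 0; 5; 6]; [:: 4; 7; 8]] [:: [:: 0; 1; 2]])))
                             (Branch 4 6
                               (Small [:: [:: 0; 3; 4]; [:: 2; 7]; [:: 5; 6]]
                                 [:: [:: 0; 2]; [:: 3; 5; 7]; [:: 4; 6]])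
                               (Branch 3 6
                                 (Small [:: [:: 0; 3; 4]; [:: 2; 7]; [:: 5; 6]]
                                   [:: [:: 0; 2]; [:: 3; 6; 7]; [:: 4; 5]])
                                 (Branch 0 8
                                   (Branch 2 8
                                     (Branch 6 8
                                       (Branch 0 6
                                         (Small [:: [:: 0; 5]; [:: 3; 6]; [:: 7; 8]]
                                           [:: [:: 0; 6; 8]; [:: 3; 5; 7]])
                                         (Small [:: [:: 0; 5; 6]; [:: 2; 4; 7]]
                                           [:: [:: 0; 2]; [:: 4; 5]; [:: 6; 7]]))
                                       (Small [:: [:: 0; 5]; [:: 2; 4; 7]; [:: 6; 8]]
                                         [:: [:: 0; 2; 8]; [:: 4; 5]; [:: 6; 7]]))
                                     (Small [:: [:: 0; 5]; [:: 2; 7; 8]; [:: 3; 6]]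
                                       [:: [:: 0; 8]; [:: 2; 3; 5]; [:: 6; 7]]))
                                   (Swap [:: 5]
                                     [:: [:: 0; 7; 8]; [:: 3; 4; 6]]
                                     [:: [:: 0; 1; 2]; [:: 4]])))))
                           (Branch 4 8
                             (Small [:: [:: 0; 5]; [:: 2; 3; 4]; [:: 7; 8]]
                               [:: [:: 0; 2]; [:: 3; 7]; [:: 4; 5; 8]])
                             (Branch 3 8
                               (Branch 3 6
                                 (Small [:: [:: 0; 7]; [:: 2; 3; 4]; [:: 5; 6]]
                                   [:: [:: 0; 2]; [:: 3; 6; 7]; [:: 4; 5]])
                                 (Branch 2 6
                                   (Branch 2 7
                                     (Small [:: [:: 2; 3]; [:: 5; 6]; [:: 7; 8]]
                                       [:: [:: 2; 6; 7]; [:: 3; 5; 8]])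
                                     (Branch 2 8
                                       (Branch 0 8
                                         (Small [:: [:: 0; 5]; [:: 2; 3]; [:: 7; 8]]
                                           [:: [:: 0; 2; 8]; [:: 3; 5; 7]])
                                         (Small [:: [:: 0; 7; 8]; [:: 2; 3]; [:: 5; 6]]
                                           [:: [:: 0; 2]; [:: 3; 5; 8]; [:: 6; 7]]))
                                       (Small [:: [:: 0; 5]; [:: 2; 7; 8]; [:: 3; 6]]
                                         [:: [:: 0; 2]; [:: 3; 5; 8]; [:: 6; 7]])))
                                   (Small [:: [:: 0; 5]; [:: 2; 3; 6]; [:: 7; 8]]
                                     [:: [:: 0; 2]; [:: 3; 5; 8]; [:: 6; 7]])))
                               (Swap [:: 6; 7] [:: [:: 0; 5]; [:: 3; 4; 8]] [:: [:: 0; 1; 2]]))))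
                         (Branch 4 8
                           (Small [:: [:: 0; 3; 4]; [:: 2; 5]; [:: 7; 8]]
                             [:: [:: 0; 2]; [:: 3; 7]; [:: 4; 5; 8]])
                           (Branch 3 8
                             (Branch 2 6
                               (Branch 1 6
                                 (Branch 2 7
                                   (Swap [:: 0] [:: [:: 3; 4]] [:: [:: 1; 2; 6; 7]])
                                   (Branch 3 6
                                     (Small [:: [:: 0; 3; 4]; [:: 2; 7]; [:: 5; 6]]
                                       [:: [:: 0; 2]; [:: 3; 6; 7]; [:: 4; 5]])
                                     (Branch 2 8
                                       (Branch 2 3
                                         (Small [:: [:: 2; 5]; [:: 3; 6]; [:: 4; 7; 8]]
                                           [:: [:: 2; 3; 8]; [:: 4; 5]; [:: 6; 7]])
                                         (Branch 0 8
                                           (Small [:: [:: 0; 5]; [:: 2; 3]; [:: 7; 8]]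
                                             [:: [:: 0; 2; 8]; [:: 3; 5; 7]])
                                           (Small [:: [:: 0; 7; 8]; [:: 2; 5]; [:: 3; 6]]
                                             [:: [:: 0; 2]; [:: 3; 5; 8]; [:: 6; 7]])))
                                       (Small [:: [:: 0; 5]; [:: 2; 7; 8]; [:: 3; 6]]
                                         [:: [:: 0; 2]; [:: 3; 5; 8]; [:: 6; 7]]))))
                                 (Small [:: [:: 0; 4; 7]; [:: 1; 6]; [:: 2; 5]]
                                   [:: [:: 0; 1; 2]; [:: 4; 5]; [:: 6; 7]]))
                               (Small [:: [:: 0; 4; 7]; [:: 2; 5; 6]]
                                 [:: [:: 0; 2]; [:: 4; 5]; [:: 6; 7]]))
                             (Swap [:: 6; 7] [:: [:: 0; 5]; [:: 3; 4; 8]] [:: [:: 0; 1; 2]]))))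
                       (Branch 2 7
                         (Branch 2 6
                           (Branch 1 6
                             (Swap [:: 0] [:: [:: 3; 4]] [:: [:: 1; 2; 6; 7]])
                             (Small [:: [:: 0; 4; 7]; [:: 1; 5; 6]]
                               [:: [:: 0; 1]; [:: 4; 5]; [:: 6; 7]]))
                           (Small [:: [:: 0; 4; 7]; [:: 1; 5]; [:: 2; 6]]
                             [:: [:: 0; 1; 2]; [:: 4; 5]; [:: 6; 7]]))
                         (Small [:: [:: 0; 3]; [:: 1; 5]; [:: 2; 7]]
                           [:: [:: 0; 1; 2]; [:: 3; 5; 7]])))
                     (Swap [:: 4; 6] [:: [:: 0; 3; 5]] [:: [:: 0; 1; 2]; [:: 5; 7]]))
                   (Branch 2 3
                     (Branch 1 6
                       (Branch 2 7
                         (Branch 2 6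
                           (Swap [:: 0] [:: [:: 3; 4]] [:: [:: 1; 2; 6; 7]])
                           (Branch 4 6
                             (Branch 6 8
                               (Branch 4 8
                                 (Small [:: [:: 2; 6]; [:: 3; 4]; [:: 7; 8]]
                                   [:: [:: 2; 3; 7]; [:: 4; 6; 8]])
                                 (Branch 3 6
                                   (Small [:: [:: 0; 5; 7]; [:: 2; 6]; [:: 3; 4]]
                                     [:: [:: 0; 2]; [:: 3; 6; 7]; [:: 4; 5]])
                                   (Swap [:: 0; 5]
                                     [:: [:: 3; 6]; [:: 4; 7; 8]]
                                     [:: [:: 1; 2; 7]; [:: 4; 6]])))
                               (Swap [:: 5; 7]
                                 [:: [:: 0; 3; 4]; [:: 6; 8]]
                                 [:: [:: 0; 1; 2]; [:: 4; 6]]))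
                             (Small [:: [:: 0; 5; 7]; [:: 2; 4; 6]]
                               [:: [:: 0; 2]; [:: 4; 5]; [:: 6; 7]])))
                         (Branch 3 6
                           (Small [:: [:: 0; 3; 4]; [:: 2; 7]; [:: 5; 6]]
                             [:: [:: 0; 2]; [:: 3; 6; 7]; [:: 4; 5]])
                           (Branch 4 6
                             (Branch 6 8
                               (Branch 0 8
                                 (Branch 0 6
                                   (Small [:: [:: 0; 3; 4]; [:: 5; 6]; [:: 7; 8]]
                                     [:: [:: 0; 6; 8]; [:: 3; 7]; [:: 4; 5]])
                                   (Small [:: [:: 0; 5; 6]; [:: 2; 4; 7]]
                                     [:: [:: 0; 2]; [:: 4; 5]; [:: 6; 7]]))
                                 (Swap [:: 4; 5] [:: [:: 0; 7; 8]; [:: 3; 6]] [:: [:: 0; 1; 2]]))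
                               (Swap [:: 5; 7]
                                 [:: [:: 0; 3; 4]; [:: 6; 8]]
                                 [:: [:: 0; 1; 2]; [:: 4; 6]]))
                             (Swap [:: 8] [:: [:: 0; 5; 7]; [:: 3; 4; 6]] [:: [:: 0; 1; 2]]))))
                       (Small [:: [:: 0; 5; 7]; [:: 1; 6]; [:: 2; 4]]
                         [:: [:: 0; 1; 2]; [:: 4; 5]; [:: 6; 7]]))
                     (Small [:: [:: 0; 5; 7]; [:: 2; 3; 4]] [:: [:: 0; 2]; [:: 3; 7]; [:: 4; 5]])))))
             (Branch 3 6
               (Small [:: [:: 0; 3; 4]; [:: 1; 7]; [:: 5; 6]]
                 [:: [:: 0; 1]; [:: 3; 6; 7]; [:: 4; 5]])
               (Branch 3 5
                 (Branch 2 5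
                   (Branch 0 8
                     (Branch 0 6
                       (Branch 6 8
                         (Small [:: [:: 0; 3; 4]; [:: 5; 6]; [:: 7; 8]]
                           [:: [:: 0; 6; 8]; [:: 3; 7]; [:: 4; 5]])
                         (Branch 4 8
                           (Small [:: [:: 0; 3; 4]; [:: 5; 6]; [:: 7; 8]]
                             [:: [:: 0; 6]; [:: 3; 7]; [:: 4; 5; 8]])
                           (Branch 4 6
                             (Swap [:: 5; 7]
                               [:: [:: 0; 3; 4]; [:: 6; 8]]
                               [:: [:: 0; 1; 2]; [:: 4; 6]])
                             (Branch 3 8
                               (Branch 1 8
                                 (Branch 1 6
                                   (Small [:: [:: 0; 3; 4]; [:: 1; 7]; [:: 5; 6]]
                                     [:: [:: 0; 1; 6]; [:: 3; 7]; [:: 4; 5]])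
                                   (Branch 1 5
                                     (Branch 0 5
                                       (Swap [:: 4] [:: [:: 0; 3]] [:: [:: 0; 1; 2; 5]])
                                       (Small [:: [:: 0; 5]; [:: 1; 7]; [:: 4; 6; 8]]
                                         [:: [:: 0; 1; 8]; [:: 4; 5]; [:: 6; 7]]))
                                     (Small [:: [:: 1; 5; 6]; [:: 4; 7; 8]]
                                       [:: [:: 1; 8]; [:: 4; 5]; [:: 6; 7]])))
                                 (Small [:: [:: 0; 3]; [:: 1; 7; 8]; [:: 5; 6]]
                                   [:: [:: 0; 1]; [:: 3; 5; 8]; [:: 6; 7]]))
                               (Swap [:: 5]
                                 [:: [:: 0; 7]; [:: 3; 4; 6; 8]]
                                 [:: [:: 0; 1; 2]; [:: 4]])))))
                       (Swap [:: 4; 5] [:: [:: 0; 3; 6]] [:: [:: 0; 1; 2]]))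
                     (Swap [:: 4; 5] [:: [:: 0; 7; 8]; [:: 3; 6]] [:: [:: 0; 1; 2]]))
                   (Small [:: [:: 0; 3; 4]; [:: 1; 7]; [:: 2; 5]]
                     [:: [:: 0; 1; 2]; [:: 3; 7]; [:: 4; 5]]))
                 (Swap [:: 8] [:: [:: 0; 4; 7]; [:: 3; 5; 6]] [:: [:: 0; 1; 2]]))))
           (Swap [:: 8] [:: [:: 0; 3; 4; 7]] [:: [:: 0; 1; 2]])))
       (Swap [:: 6; 7] [:: [:: 0; 3; 4]; [:: 5; 8]] [:: [:: 0; 1; 2]]));
      (1, Branch 1 5
       (Partner true 3 [:: (8, Cite 4 [:: 0; 1; 2; 3; 4; 5; 6; 7; 8])])
       (Swap [:: 6; 7] [:: [:: 0; 3; 4]; [:: 1; 5]] [:: [:: 0; 1; 2]]));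
      (2, Branch 2 5
       (Partner true 3 [:: (8, Cite 4 [:: 0; 2; 1; 3; 4; 5; 6; 7; 8])])
       (Swap [:: 6; 7] [:: [:: 0; 3; 4]; [:: 2; 5]] [:: [:: 0; 1; 2]]))]));
   (3, Partner false 2 [:: (7, Partner true 7 [:: (8, Branch 3 7
      (Branch 6 7
        (Small [:: [:: 0; 3; 4]; [:: 2; 7]; [:: 5; 6]] [:: [:: 0; 2]; [:: 3; 6; 7]; [:: 4; 5]])
        (Branch 5 7
          (Branch 5 8
            (Swap [:: 4] [:: [:: 0; 3]] [:: [:: 0; 1; 2]; [:: 5; 7; 8]])
            (Branch 6 8
              (Branch 4 8
                (Swap [:: 5; 6] [:: [:: 0; 3; 4]] [:: [:: 0; 1; 2]; [:: 3; 7]; [:: 4; 8]])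
                (Branch 4 7
                  (Small [:: [:: 0; 3; 4]; [:: 2; 7]; [:: 5; 6]]
                    [:: [:: 0; 2]; [:: 3; 6]; [:: 4; 5; 7]])
                  (Branch 3 8
                    (Small [:: [:: 0; 3; 4]; [:: 2; 7]; [:: 5; 8]]
                      [:: [:: 0; 2]; [:: 3; 7; 8]; [:: 4; 5]])
                    (Branch 3 5
                      (Swap [:: 4] [:: [:: 0; 3]] [:: [:: 0; 1; 2]; [:: 3; 5; 7]; [:: 6; 8]])
                      (Branch 4 6
                        (Branch 2 6
                          (Branch 2 8
                            (Small [:: [:: 2; 7]; [:: 3; 4; 8]; [:: 5; 6]]
                              [:: [:: 2; 6; 8]; [:: 3; 7]; [:: 4; 5]])
                            (Branch 2 5
                              (Branch 2 4
                                (Small [:: [:: 2; 7]; [:: 3; 4; 8]; [:: 5; 6]]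
                                  [:: [:: 2; 4; 5]; [:: 3; 7]; [:: 6; 8]])
                                (Branch 2 3
                                  (Small [:: [:: 2; 4; 7]; [:: 3; 5; 8]]
                                    [:: [:: 2; 3]; [:: 4; 5]; [:: 7; 8]])
                                  (Branch 1 7
                                    (Branch 1 8
                                      (Swap [:: 0; 3]
                                        [:: [:: 2; 4; 7]]
                                        [:: [:: 1; 7; 8]; [:: 2; 6]])
                                      (Branch 1 6
                                        (Small [:: [:: 1; 8]; [:: 2; 4; 7]; [:: 5; 6]]
                                          [:: [:: 1; 2; 6]; [:: 4; 5]; [:: 7; 8]])
                                        (Small [:: [:: 0; 3; 4]; [:: 1; 6]; [:: 2; 7]]
                                          [:: [:: 0; 1; 2]; [:: 3; 7]; [:: 4; 6]])))
                                    (Small [:: [:: 1; 7]; [:: 2; 3; 4; 8]; [:: 5; 6]]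
                                      [:: [:: 1; 2]; [:: 3; 7]; [:: 4; 5]; [:: 6; 8]]))))
                              (Small [:: [:: 0; 3; 4]; [:: 2; 5; 8]; [:: 6; 7]]
                                [:: [:: 0; 2]; [:: 3; 7]; [:: 4; 5]; [:: 6; 8]])))
                          (Small [:: [:: 0; 3; 4]; [:: 2; 6; 7]]
                            [:: [:: 0; 2]; [:: 3; 7]; [:: 4; 6]]))
                        (Small [:: [:: 3; 5; 8]; [:: 4; 6; 7]] [:: [:: 3; 7]; [:: 4; 5]; [:: 6; 8]]))))))
              (Small [:: [:: 0; 3; 4]; [:: 2; 7]; [:: 5; 6; 8]]
                [:: [:: 0; 2]; [:: 3; 6]; [:: 4; 5]; [:: 7; 8]])))
          (Swap [:: 2] [:: [:: 0; 3; 4]; [:: 5; 6; 7]] [:: [:: 0; 1]])))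
      (Branch 2 6
        (Branch 0 6
          (Branch 1 6
            (Swap [:: 3] [:: [:: 0; 4]] [:: [:: 0; 1; 2; 6]])
            (Branch 4 7
              (Small [:: [:: 0; 3; 4]; [:: 1; 6]; [:: 2; 7]]
                [:: [:: 0; 1; 2]; [:: 3; 6]; [:: 4; 7]])
              (Branch 2 5
                (Branch 1 5
                  (Branch 2 3
                    (Branch 0 7
                      (Small [:: [:: 0; 3; 4]; [:: 2; 7]; [:: 5; 6]]
                        [:: [:: 0; 7]; [:: 2; 3; 6]; [:: 4; 5]])
                      (Swap [:: 2] [:: [:: 0; 3; 4; 7]] [:: [:: 0; 1]]))
                    (Swap [:: 0; 4] [:: [:: 2; 3; 7]] [:: [:: 1; 2; 5]]))
                  (Small [:: [:: 0; 3; 4]; [:: 1; 5; 6]] [:: [:: 0; 1]; [:: 3; 6]; [:: 4; 5]]))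
                (Small [:: [:: 0; 3; 4]; [:: 1; 6]; [:: 2; 5]]
                  [:: [:: 0; 1; 2]; [:: 3; 6]; [:: 4; 5]]))))
          (Branch 2 3
            (Branch 0 7
              (Small [:: [:: 0; 3; 4]; [:: 2; 7]; [:: 5; 6]]
                [:: [:: 0; 7]; [:: 2; 3; 6]; [:: 4; 5]])
              (Branch 4 7
                (Branch 5 7
                  (Small [:: [:: 2; 7]; [:: 3; 4]; [:: 5; 6]] [:: [:: 2; 3; 6]; [:: 4; 5; 7]])
                  (Branch 6 7
                    (Branch 6 8
                      (Swap [:: 3] [:: [:: 0; 4]] [:: [:: 0; 1; 2]; [:: 6; 7; 8]])
                      (Branch 5 8
                        (Branch 4 8
                          (Small [:: [:: 2; 7]; [:: 3; 4]; [:: 6; 8]]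
                            [:: [:: 2; 3; 6]; [:: 4; 7; 8]])
                          (Branch 3 8
                            (Swap [:: 5; 6]
                              [:: [:: 0; 3; 4]]
                              [:: [:: 0; 1; 2]; [:: 3; 8]; [:: 4; 7]])
                            (Small [:: [:: 2; 7]; [:: 3; 4; 8]; [:: 5; 6]]
                              [:: [:: 2; 3; 6]; [:: 4; 7]; [:: 5; 8]])))
                        (Small [:: [:: 2; 7]; [:: 3; 4]; [:: 5; 6; 8]]
                          [:: [:: 2; 3; 6]; [:: 4; 5]; [:: 7; 8]])))
                    (Swap [:: 2] [:: [:: 0; 3; 4]; [:: 5; 6; 7]] [:: [:: 0; 1]])))
                (Swap [:: 2] [:: [:: 0; 3; 4; 7]] [:: [:: 0; 1]])))
            (Swap [:: 4; 5] [:: [:: 0; 6]; [:: 2; 3; 7]] [:: [:: 0; 1; 2]])))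
        (Branch 6 7
          (Branch 6 8
            (Swap [:: 3] [:: [:: 0; 4]] [:: [:: 0; 1; 2]; [:: 6; 7; 8]])
            (Branch 5 8
              (Branch 5 7
                (Swap [:: 4] [:: [:: 0; 3]] [:: [:: 0; 1; 2]; [:: 5; 7; 8]])
                (Branch 4 8
                  (Swap [:: 3] [:: [:: 0; 4]] [:: [:: 0; 1; 2]; [:: 4; 5; 8]; [:: 6; 7]])
                  (Branch 2 8
                    (Branch 2 5
                      (Branch 1 5
                        (Branch 3 5
                          (Branch 3 8
                            (Swap [:: 4] [:: [:: 0; 3]] [:: [:: 0; 1; 2]; [:: 3; 5; 8]; [:: 6; 7]])
                            (Branch 4 7
                              (Small [:: [:: 2; 7]; [:: 3; 4; 8]; [:: 5; 6]]
                                [:: [:: 2; 5; 8]; [:: 3; 6]; [:: 4; 7]])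
                              (Branch 2 4
                                (Small [:: [:: 2; 7]; [:: 3; 4; 8]; [:: 5; 6]]
                                  [:: [:: 2; 4; 5]; [:: 3; 6]; [:: 7; 8]])
                                (Branch 2 3
                                  (Branch 1 8
                                    (Swap [:: 0; 3] [:: [:: 2; 4; 7]] [:: [:: 1; 2; 8]; [:: 6; 7]])
                                    (Branch 1 6
                                      (Branch 1 3
                                        (Small [:: [:: 1; 8]; [:: 3; 4; 7]; [:: 5; 6]]
                                          [:: [:: 1; 3; 6]; [:: 4; 5]; [:: 7; 8]])
                                        (Small [:: [:: 1; 3; 8]; [:: 2; 7]; [:: 5; 6]]
                                          [:: [:: 1; 6]; [:: 2; 3; 5]; [:: 7; 8]]))
                                      (Small [:: [:: 0; 3]; [:: 1; 6; 8]; [:: 2; 7]]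
                                        [:: [:: 0; 1; 2]; [:: 3; 6]; [:: 7; 8]])))
                                  (Swap [:: 0] [:: [:: 2; 3; 4; 7]] [:: [:: 1; 2]])))))
                          (Swap [:: 0; 4] [:: [:: 2; 6]; [:: 3; 5; 7]] [:: [:: 1; 2; 5]]))
                        (Small [:: [:: 0; 3; 4]; [:: 1; 5]; [:: 2; 6]]
                          [:: [:: 0; 1; 2]; [:: 3; 6]; [:: 4; 5]]))
                      (Small [:: [:: 0; 3; 4]; [:: 2; 5; 6]] [:: [:: 0; 2]; [:: 3; 6]; [:: 4; 5]]))
                    (Small [:: [:: 0; 3; 4]; [:: 2; 6; 8]; [:: 5; 7]]
                      [:: [:: 0; 2]; [:: 3; 6]; [:: 4; 5]; [:: 7; 8]]))))
              (Small [:: [:: 0; 3; 4]; [:: 2; 7]; [:: 5; 6; 8]]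
                [:: [:: 0; 2]; [:: 3; 6]; [:: 4; 5]; [:: 7; 8]])))
          (Swap [:: 5] [:: [:: 0; 3; 4]; [:: 2; 6; 7]] [:: [:: 0; 1; 2]; [:: 4]]))))])])]);
 (State 1 5
   [:: (0, 3); (0, 4); (3, 4)]
   [:: (0, 1); (0, 2); (1, 2)]
   [:: [:: 0; 3; 4]]
   [:: [:: 0; 1; 2]],
  Partner true 4 [:: (5, Partner false 5 [:: (6, Cite 5 [:: 0; 1; 2; 3; 4; 5; 6]);
    (1, Partner true 3 [:: (6, Branch 2 6
      (Partner false 6 [:: (7, Cite 5 [:: 0; 1; 2; 4; 3; 6; 7])])
      (Small [:: [:: 0; 3; 4]; [:: 1; 5]; [:: 2; 6]] [:: [:: 0; 1; 2]; [:: 3; 6]; [:: 4; 5]]))]);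
    (2, Partner true 3 [:: (6, Branch 1 6
      (Partner false 6 [:: (7, Cite 5 [:: 0; 1; 2; 4; 3; 6; 7])])
      (Small [:: [:: 0; 3; 4]; [:: 1; 6]; [:: 2; 5]] [:: [:: 0; 1; 2]; [:: 3; 6]; [:: 4; 5]]))])])]);
 (State 2 9
   [:: (3, 4); (3, 5); (4, 5); (5, 8); (6, 7)]
   [:: (0, 1); (0, 2); (1, 2); (5, 6); (7, 8)]
   [:: [:: 3; 4; 5]; [:: 6; 7]]
   [:: [:: 0; 1; 2]; [:: 5; 6]; [:: 7; 8]],
  Partner false 8 [:: (9, Branch 6 9
    (Partner true 9 [:: (10, Branch 7 10
       (Swap [:: 8; 9] [:: [:: 3; 4; 5]] [:: [:: 0; 1; 2]; [:: 7; 10]])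
       (Branch 6 10
         (Swap [:: 5] [:: [:: 3; 4]] [:: [:: 0; 1; 2]; [:: 6; 9; 10]])
         (Branch 5 9
           (Swap [:: 10] [:: [:: 3; 4; 5]] [:: [:: 0; 1; 2]; [:: 5; 6; 9]])
           (Small [:: [:: 5; 8; 9]; [:: 6; 7; 10]] [:: [:: 5; 6]; [:: 7; 8]; [:: 9; 10]]))));
      (3, Branch 5 9
       (Swap [:: 3] [:: [:: 4; 5]] [:: [:: 0; 1; 2]; [:: 5; 6; 9]])
       (Branch 4 8
         (Branch 4 7
           (Small [:: [:: 3; 4; 5]; [:: 6; 7]; [:: 8; 9]] [:: [:: 3; 9]; [:: 4; 7; 8]; [:: 5; 6]])
           (Branch 3 7
             (Swap [:: 8; 9] [:: [:: 3; 4; 5]] [:: [:: 0; 1; 2]; [:: 3; 7]])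
             (Swap [:: 6] [:: [:: 3; 4; 7]; [:: 5; 8; 9]] [:: [:: 0; 1; 2]; [:: 5]])))
         (Swap [:: 3; 9] [:: [:: 4; 5; 8]] [:: [:: 0; 1; 2]])));
      (4, Branch 5 9
       (Swap [:: 4] [:: [:: 3; 5]] [:: [:: 0; 1; 2]; [:: 5; 6; 9]])
       (Branch 4 7
         (Swap [:: 8; 9] [:: [:: 3; 4; 5]] [:: [:: 0; 1; 2]; [:: 4; 7]])
         (Branch 4 6
           (Swap [:: 5] [:: [:: 3; 4]] [:: [:: 0; 1; 2]; [:: 4; 6; 9]])
           (Small [:: [:: 4; 6; 7]; [:: 5; 8; 9]] [:: [:: 4; 9]; [:: 5; 6]; [:: 7; 8]]))))])
    (Swap [:: 7; 8] [:: [:: 3; 4; 5]; [:: 6; 9]] [:: [:: 0; 1; 2]]));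
   (0, Branch 0 6
    (Branch 0 5
      (* No vertex is deleted: the clique triple moves from {0, 1, 2} to {0, 5, 6} and now shares 5
         with the stable triple, a position excluded at level 1. *)
      (Swap [::] [:: [:: 3; 4; 5]] [:: [:: 0; 5; 6]; [:: 1; 2]])
      (Swap [::] [:: [:: 0; 5; 8]; [:: 3; 4]] [:: [:: 0; 1; 2]]))
    (Swap [:: 7; 8] [:: [:: 3; 4; 5]; [:: 0; 6]] [:: [:: 0; 1; 2]]));
   (1, Branch 1 6
    (Branch 1 5
      (Swap [::] [:: [:: 3; 4; 5]] [:: [:: 1; 5; 6]; [:: 0; 2]])
      (Swap [::] [:: [:: 1; 5; 8]; [:: 3; 4]] [:: [:: 0; 1; 2]]))
    (Swap [:: 7; 8] [:: [:: 3; 4; 5]; [:: 1; 6]] [:: [:: 0; 1; 2]]));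
   (2, Branch 2 6
    (Branch 2 5
      (Swap [::] [:: [:: 3; 4; 5]] [:: [:: 2; 5; 6]; [:: 0; 1]])
      (Swap [::] [:: [:: 2; 5; 8]; [:: 3; 4]] [:: [:: 0; 1; 2]]))
    (Swap [:: 7; 8] [:: [:: 3; 4; 5]; [:: 2; 6]] [:: [:: 0; 1; 2]]))]);
 (State 2 11
   [:: (2, 9); (3, 4); (3, 5); (4, 5); (6, 7)]
   [:: (0, 1); (0, 2); (1, 2); (3, 7); (4, 8); (5, 6); (9, 10)]
   [:: [:: 3; 4; 5]; [:: 6; 7]; [:: 2; 9]]
   [:: [:: 0; 1; 2]; [:: 5; 6]; [:: 3; 7]; [:: 4; 8]; [:: 9; 10]],
  Branch 2 5
   (Branch 2 6
     (Swap [::] [:: [:: 3; 4; 5]] [:: [:: 2; 5; 6]; [:: 0; 1]])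
     (Branch 6 9
       (Branch 6 10
         (Swap [:: 5] [:: [:: 3; 4]] [:: [:: 0; 1; 2]; [:: 6; 9; 10]])
         (Branch 5 9
           (Swap [:: 10] [:: [:: 3; 4; 5]] [:: [:: 0; 1; 2]; [:: 5; 6; 9]])
           (Branch 4 9
             (Branch 8 9
               (Swap [:: 10] [:: [:: 3; 4; 5]] [:: [:: 0; 1; 2]; [:: 4; 8; 9]])
               (Branch 7 10
                 (Branch 7 9
                   (Swap [:: 3] [:: [:: 4; 5]] [:: [:: 0; 1; 2]; [:: 7; 9; 10]])
                   (Branch 7 8
                     (Branch 8 10
                       (Swap [:: 3] [:: [:: 4; 5]] [:: [:: 0; 1; 2]; [:: 4; 9]; [:: 7; 8; 10]])
                       (Branch 6 8
                         (Branch 5 8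
                           (Small [:: [:: 3; 4; 5]; [:: 6; 7]; [:: 8; 9]]
                             [:: [:: 3; 7]; [:: 4; 9]; [:: 5; 6; 8]])
                           (Branch 5 7
                             (Branch 4 10
                               (Small [:: [:: 3; 4; 5]; [:: 6; 10]; [:: 7; 9]]
                                 [:: [:: 3; 7]; [:: 4; 9; 10]; [:: 5; 6]])
                               (Branch 4 6
                                 (Small [:: [:: 4; 10]; [:: 5; 8; 9]; [:: 6; 7]]
                                   [:: [:: 4; 6; 8]; [:: 5; 7]; [:: 9; 10]])
                                 (Small [:: [:: 4; 6; 10]; [:: 5; 8; 9]]
                                   [:: [:: 4; 8]; [:: 5; 6]; [:: 9; 10]])))
                             (Swap [:: 3; 4]
                               [:: [:: 2; 6]; [:: 5; 7; 9]]
                               [:: [:: 0; 1; 2]; [:: 7; 8]])))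
                         (Small [:: [:: 3; 4; 5]; [:: 6; 8; 10]; [:: 7; 9]]
                           [:: [:: 3; 7]; [:: 4; 8]; [:: 5; 6]; [:: 9; 10]])))
                     (Small [:: [:: 3; 4; 5]; [:: 6; 10]; [:: 7; 8; 9]]
                       [:: [:: 3; 7]; [:: 4; 8]; [:: 5; 6]; [:: 9; 10]])))
                 (Small [:: [:: 3; 4; 5]; [:: 6; 7; 10]; [:: 8; 9]]
                   [:: [:: 3; 7]; [:: 4; 8]; [:: 5; 6]; [:: 9; 10]])))
             (Swap [:: 3; 7] [:: [:: 2; 6]; [:: 4; 5; 9]] [:: [:: 0; 1; 2]]))))
       (Swap [:: 7] [:: [:: 3; 4; 5]; [:: 2; 6; 9]] [:: [:: 0; 1; 2]; [:: 3]])))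
   (Branch 5 9
     (Branch 6 9
       (Swap [:: 10] [:: [:: 3; 4; 5]] [:: [:: 0; 1; 2]; [:: 5; 6; 9]])
       (Branch 7 9
         (Branch 7 10
           (Swap [:: 3] [:: [:: 4; 5]] [:: [:: 0; 1; 2]; [:: 7; 9; 10]])
           (Branch 5 10
             (Swap [:: 6] [:: [:: 3; 4; 5]; [:: 7]] [:: [:: 0; 1; 2]; [:: 5; 9; 10]])
             (Branch 3 10
               (Swap [:: 6; 7] [:: [:: 3; 4; 5]] [:: [:: 0; 1; 2]; [:: 3; 10]; [:: 5; 9]])
               (Branch 3 9
                 (Swap [:: 10] [:: [:: 3; 4; 5]] [:: [:: 0; 1; 2]; [:: 3; 7; 9]])
                 (Branch 2 4
                   (Branch 6 10
                     (Branch 5 7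
                       (Swap [:: 3] [:: [:: 4; 5]] [:: [:: 0; 1; 2]; [:: 5; 7; 9]; [:: 6; 10]])
                       (Branch 4 10
                         (Branch 4 9
                           (Small [:: [:: 3; 4; 5]; [:: 6; 9]; [:: 7; 10]]
                             [:: [:: 3; 7]; [:: 4; 9; 10]; [:: 5; 6]])
                           (Small [:: [:: 3; 4; 9]; [:: 5; 7; 10]]
                             [:: [:: 3; 7]; [:: 4; 10]; [:: 5; 9]]))
                         (Small [:: [:: 2; 9]; [:: 3; 4; 5; 10]; [:: 6; 7]]
                           [:: [:: 2; 4]; [:: 3; 7]; [:: 5; 9]; [:: 6; 10]])))
                     (Small [:: [:: 2; 9]; [:: 3; 4; 5]; [:: 6; 7; 10]]
                       [:: [:: 2; 4]; [:: 3; 7]; [:: 5; 6]; [:: 9; 10]]))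
                   (Swap [:: 3; 7] [:: [:: 2; 4; 5]; [:: 6; 9]] [:: [:: 0; 1; 2]]))))))
         (Swap [:: 2] [:: [:: 3; 4; 5]; [:: 6; 7; 9]] [:: [:: 0; 1]])))
     (Swap [::] [:: [:: 2; 5; 9]; [:: 3; 4]] [:: [:: 0; 1; 2]])));
 (State 2 9
   [:: (3, 4); (3, 5); (4, 5); (6, 7)]
   [:: (0, 1); (0, 2); (1, 2); (3, 7); (4, 8); (5, 6)]
   [:: [:: 3; 4; 5]; [:: 6; 7]]
   [:: [:: 0; 1; 2]; [:: 5; 6]; [:: 3; 7]; [:: 4; 8]],
  Partner false 8 [:: (9, Partner true 9 [:: (10, Branch 4 10
     (Swap [:: 8; 9] [:: [:: 3; 4; 5]] [:: [:: 0; 1; 2]; [:: 4; 10]])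
     (Cite 7 [:: 0; 1; 2; 3; 5; 4; 8; 9; 10]))]);
   (0, Partner false 2 [:: (9, Partner true 9 [:: (10, Cite 8 [:: 0; 1; 2; 3; 4; 5; 6; 7; 8; 9; 10])])]);
   (1, Partner false 2 [:: (9, Partner true 9 [:: (10, Cite 8 [:: 0; 1; 2; 3; 4; 5; 6; 7; 8; 9; 10])])]);
   (2, Partner false 1 [:: (9, Partner true 9 [:: (10, Cite 8 [:: 0; 2; 1; 3; 4; 5; 6; 7; 8; 9; 10])])])]);
 (State 2 8
   [:: (3, 4); (3, 5); (4, 5); (6, 7)]
   [:: (0, 1); (0, 2); (1, 2); (5, 6)]
   [:: [:: 3; 4; 5]; [:: 6; 7]]
   [:: [:: 0; 1; 2]; [:: 5; 6]],
  Partner true 7 [:: (8, Branch 5 8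
    (Swap [:: 6; 7] [:: [:: 3; 4; 5]] [:: [:: 0; 1; 2]; [:: 5; 8]])
    (Cite 7 [:: 0; 1; 2; 3; 4; 5; 6; 7; 8]));
   (3, Partner true 4 [:: (8, Cite 9 [:: 0; 1; 2; 3; 4; 5; 6; 7; 8])]);
   (4, Partner true 3 [:: (8, Cite 9 [:: 0; 1; 2; 4; 3; 5; 6; 7; 8])])]);
 (State 2 9
   [:: (0, 6); (1, 7); (2, 8); (3, 4); (3, 5); (4, 5)]
   [:: (0, 1); (0, 2); (1, 2); (3, 8); (4, 7); (5, 6)]
   [:: [:: 3; 4; 5]; [:: 1; 7]; [:: 2; 8]]
   [:: [:: 0; 1; 2]; [:: 5; 6]; [:: 4; 7]],
  Branch 2 5
   (Branch 2 6
     (Swap [::] [:: [:: 3; 4; 5]] [:: [:: 2; 5; 6]; [:: 0; 1]])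
     (Branch 6 8
       (Branch 5 8
         (Small [:: [:: 0; 6]; [:: 1; 7]; [:: 2; 8]; [:: 4; 5]]
           [:: [:: 0; 1; 2]; [:: 4; 7]; [:: 5; 6; 8]])
         (Branch 3 6
           (Small [:: [:: 0; 6]; [:: 1; 7]; [:: 2; 8]; [:: 3; 4]]
             [:: [:: 0; 1; 2]; [:: 3; 6; 8]; [:: 4; 7]])
           (Branch 1 5
             (Small [:: [:: 1; 7]; [:: 2; 8]; [:: 3; 4; 5]] [:: [:: 1; 2; 5]; [:: 3; 8]; [:: 4; 7]])
             (Branch 5 7
               (Branch 6 7
                 (Small [:: [:: 0; 6]; [:: 1; 7]; [:: 2; 8]; [:: 3; 5]]
                   [:: [:: 0; 1; 2]; [:: 3; 8]; [:: 5; 6; 7]])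
                 (Branch 1 6
                   (Branch 1 3
                     (Branch 2 3
                       (Small [:: [:: 1; 7]; [:: 2; 6]; [:: 3; 4; 5]]
                         [:: [:: 1; 2; 3]; [:: 4; 7]; [:: 5; 6]])
                       (Branch 4 8
                         (Branch 7 8
                           (Small [:: [:: 1; 7]; [:: 2; 8]; [:: 3; 4; 5]]
                             [:: [:: 1; 3]; [:: 2; 5]; [:: 4; 7; 8]])
                           (Branch 2 7
                             (Small [:: [:: 1; 7]; [:: 2; 3; 6]; [:: 5; 8]]
                               [:: [:: 1; 6]; [:: 2; 5; 7]; [:: 3; 8]])
                             (Small [:: [:: 2; 7; 8]; [:: 3; 4; 5]]
                               [:: [:: 2; 5]; [:: 3; 8]; [:: 4; 7]])))
                         (Small [:: [:: 1; 7]; [:: 2; 3; 6]; [:: 4; 5; 8]]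
                           [:: [:: 1; 6]; [:: 2; 5]; [:: 3; 8]; [:: 4; 7]])))
                     (Small [:: [:: 0; 6]; [:: 1; 3; 5]; [:: 2; 8]]
                       [:: [:: 0; 1; 2]; [:: 3; 8]; [:: 5; 6]]))
                   (Small [:: [:: 1; 6; 7]; [:: 2; 8]; [:: 3; 4; 5]]
                     [:: [:: 1; 2]; [:: 3; 8]; [:: 4; 7]; [:: 5; 6]])))
               (Swap [::] [:: [:: 1; 5; 7]; [:: 3; 4]] [:: [:: 0; 1; 2]])))))
       (Small [:: [:: 1; 7]; [:: 2; 6; 8]; [:: 3; 4; 5]]
         [:: [:: 1; 2]; [:: 3; 8]; [:: 4; 7]; [:: 5; 6]])))
   (Branch 5 8
     (Branch 6 8
       (Small [:: [:: 0; 6]; [:: 1; 7]; [:: 2; 8]; [:: 4; 5]]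
         [:: [:: 0; 1; 2]; [:: 4; 7]; [:: 5; 6; 8]])
       (Branch 2 4
         (Branch 2 7
           (Swap [::] [:: [:: 3; 4; 5]] [:: [:: 2; 4; 7]; [:: 0; 1]])
           (Branch 7 8
             (Branch 4 8
               (Small [:: [:: 0; 6]; [:: 1; 7]; [:: 2; 8]; [:: 4; 5]]
                 [:: [:: 0; 1; 2]; [:: 4; 7; 8]; [:: 5; 6]])
               (Branch 3 7
                 (Small [:: [:: 2; 7]; [:: 3; 4; 5]; [:: 6; 8]]
                   [:: [:: 2; 4]; [:: 3; 7; 8]; [:: 5; 6]])
                 (Branch 2 3
                   (Branch 1 3
                     (Small [:: [:: 1; 7]; [:: 2; 8]; [:: 3; 4; 5]]
                       [:: [:: 1; 2; 3]; [:: 4; 7]; [:: 5; 8]])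
                     (Swap [::] [:: [:: 1; 3; 7]; [:: 4; 5]] [:: [:: 0; 1; 2]]))
                   (Swap [::] [:: [:: 2; 3; 5]; [:: 4; 8]] [:: [:: 0; 1; 2]]))))
             (Small [:: [:: 0; 6]; [:: 2; 7; 8]; [:: 3; 4; 5]]
               [:: [:: 0; 2]; [:: 3; 8]; [:: 4; 7]; [:: 5; 6]])))
         (Small [:: [:: 0; 6]; [:: 1; 7]; [:: 2; 4; 5]] [:: [:: 0; 1; 2]; [:: 4; 7]; [:: 5; 6]])))
     (Swap [::] [:: [:: 2; 5; 8]; [:: 3; 4]] [:: [:: 0; 1; 2]])));
 (State 2 8
   [:: (0, 6); (3, 4); (3, 5); (4, 5)]
   [:: (0, 1); (0, 2); (1, 2); (4, 7); (5, 6)]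
   [:: [:: 3; 4; 5]; [:: 0; 6]]
   [:: [:: 0; 1; 2]; [:: 5; 6]; [:: 4; 7]],
  Partner false 7 [:: (8, Cite 10 [:: 0; 1; 2; 3; 5; 4; 7; 8]);
   (1, Partner true 3 [:: (8, Partner false 8 [::
    (9, Cite 10 [:: 0; 1; 2; 4; 5; 3; 8; 9]);
    (2, Cite 11 [:: 0; 1; 2; 3; 4; 5; 6; 7; 8])])]);
   (2, Partner true 3 [:: (8, Partner false 8 [::
    (9, Cite 10 [:: 0; 1; 2; 4; 5; 3; 8; 9]);
    (1, Cite 11 [:: 0; 2; 1; 3; 4; 5; 6; 7; 8])])])]);
 (State 2 6
   [:: (3, 4); (3, 5); (4, 5)]
   [:: (0, 1); (0, 2); (1, 2)]
   [:: [:: 3; 4; 5]]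
   [:: [:: 0; 1; 2]],
  Partner true 5 [:: (6, Partner false 6 [:: (7, Cite 10 [:: 0; 1; 2; 3; 4; 5; 6; 7]);
    (0, Partner true 4 [:: (7, Cite 12 [:: 0; 1; 2; 3; 4; 5; 6; 7])]);
    (1, Partner true 4 [:: (7, Cite 12 [:: 1; 0; 2; 3; 4; 5; 6; 7])]);
    (2, Partner true 4 [:: (7, Cite 12 [:: 2; 0; 1; 3; 4; 5; 6; 7])])])]);
 (State 3 10
   [:: (5, 6); (6, 9); (7, 8)]
   [:: (0, 1); (0, 2); (1, 2); (3, 4); (3, 5); (4, 5); (5, 8); (6, 7); (8, 9)]
   [:: [:: 5; 6]; [:: 7; 8]]
   [:: [:: 0; 1; 2]; [:: 3; 4; 5]; [:: 6; 7]; [:: 8; 9]],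
  Partner false 9 [:: (10, Branch 7 10
    (Branch 6 10
      (Branch 5 9
        (Small [:: [:: 5; 6]; [:: 7; 8]; [:: 9; 10]] [:: [:: 5; 8; 9]; [:: 6; 7; 10]])
        (Swap [:: 10] [:: [:: 5; 6; 9]] [:: [:: 0; 1; 2]; [:: 3; 4; 5]]))
      (Swap [:: 5] [:: [:: 6; 9; 10]] [:: [:: 0; 1; 2]; [:: 3; 4]]))
    (Swap [:: 8; 9] [:: [:: 7; 10]] [:: [:: 0; 1; 2]; [:: 3; 4; 5]]));
   (0, Branch 5 9
    (Branch 0 7
      (Branch 0 6
        (Small [:: [:: 0; 9]; [:: 5; 6]; [:: 7; 8]] [:: [:: 0; 6; 7]; [:: 5; 8; 9]])
        (Swap [:: 5] [:: [:: 0; 6; 9]] [:: [:: 0; 1; 2]; [:: 3; 4]]))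
      (Swap [:: 8; 9] [:: [:: 0; 7]] [:: [:: 0; 1; 2]; [:: 3; 4; 5]]))
    (Swap [:: 0] [:: [:: 5; 6; 9]] [:: [:: 3; 4; 5]; [:: 1; 2]]));
   (1, Branch 5 9
    (Branch 1 7
      (Branch 1 6
        (Small [:: [:: 1; 9]; [:: 5; 6]; [:: 7; 8]] [:: [:: 1; 6; 7]; [:: 5; 8; 9]])
        (Swap [:: 5] [:: [:: 1; 6; 9]] [:: [:: 0; 1; 2]; [:: 3; 4]]))
      (Swap [:: 8; 9] [:: [:: 1; 7]] [:: [:: 0; 1; 2]; [:: 3; 4; 5]]))
    (Swap [:: 1] [:: [:: 5; 6; 9]] [:: [:: 3; 4; 5]; [:: 0; 2]]));
   (2, Branch 5 9
    (Branch 2 7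
      (Branch 2 6
        (Small [:: [:: 2; 9]; [:: 5; 6]; [:: 7; 8]] [:: [:: 2; 6; 7]; [:: 5; 8; 9]])
        (Swap [:: 5] [:: [:: 2; 6; 9]] [:: [:: 0; 1; 2]; [:: 3; 4]]))
      (Swap [:: 8; 9] [:: [:: 2; 7]] [:: [:: 0; 1; 2]; [:: 3; 4; 5]]))
    (Swap [:: 2] [:: [:: 5; 6; 9]] [:: [:: 3; 4; 5]; [:: 0; 1]]));
   (3, Branch 5 9
    (Branch 4 8
      (Swap [:: 3; 9] [::] [:: [:: 0; 1; 2]; [:: 4; 5; 8]])
      (Branch 4 7
        (Branch 3 7
          (Swap [:: 6] [:: [:: 5]] [:: [:: 0; 1; 2]; [:: 3; 4; 7]; [:: 5; 8; 9]])
          (Swap [:: 8; 9] [:: [:: 3; 7]] [:: [:: 0; 1; 2]; [:: 3; 4; 5]]))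
        (Small [:: [:: 3; 9]; [:: 4; 7; 8]; [:: 5; 6]] [:: [:: 3; 4; 5]; [:: 6; 7]; [:: 8; 9]])))
    (Swap [:: 3] [:: [:: 5; 6; 9]] [:: [:: 0; 1; 2]; [:: 4; 5]]));
   (4, Branch 5 9
    (Branch 4 7
      (Branch 4 6
        (Small [:: [:: 4; 9]; [:: 5; 6]; [:: 7; 8]] [:: [:: 4; 6; 7]; [:: 5; 8; 9]])
        (Swap [:: 5] [:: [:: 4; 6; 9]] [:: [:: 0; 1; 2]; [:: 3; 4]]))
      (Swap [:: 8; 9] [:: [:: 4; 7]] [:: [:: 0; 1; 2]; [:: 3; 4; 5]]))
    (Swap [:: 4] [:: [:: 5; 6; 9]] [:: [:: 0; 1; 2]; [:: 3; 5]]))]);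
 (State 3 12
   [:: (0, 7); (1, 9); (3, 10); (4, 8); (5, 6)]
   [:: (0, 1); (0, 2); (0, 5); (1, 2); (1, 4); (3, 4); (3, 5); (4, 5); (6, 7); (8, 9); (10, 11)]
   [:: [:: 5; 6]; [:: 0; 7]; [:: 4; 8]; [:: 1; 9]; [:: 3; 10]]
   [:: [:: 0; 1; 2]; [:: 3; 4; 5]; [:: 6; 7]; [:: 8; 9]; [:: 10; 11]],
  Branch 1 5
   (Branch 2 5
     (* The two clique triples turn into a clique on four vertices and a pair, the position excluded
        at level 0. *)
     (Swap [::] [::] [:: [:: 0; 1; 2; 5]; [:: 3; 4]])
     (Branch 1 3
       (Swap [::] [::] [:: [:: 1; 3; 4; 5]; [:: 0; 2]])
       (Branch 7 8
         (Small [:: [:: 0; 7]; [:: 1; 3]; [:: 2; 5]; [:: 4; 8]]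
           [:: [:: 0; 1; 2]; [:: 3; 4; 5]; [:: 7; 8]])
         (Branch 4 7
           (Branch 4 6
             (Small [:: [:: 0; 7]; [:: 1; 9]; [:: 4; 8]; [:: 5; 6]]
               [:: [:: 0; 1; 5]; [:: 4; 6; 7]; [:: 8; 9]])
             (Small [:: [:: 0; 7]; [:: 1; 3]; [:: 2; 5]; [:: 4; 6]]
               [:: [:: 0; 1; 2]; [:: 3; 4; 5]; [:: 6; 7]]))
           (Small [:: [:: 1; 9]; [:: 4; 7; 8]; [:: 5; 6]] [:: [:: 1; 4; 5]; [:: 6; 7]; [:: 8; 9]])))))
   (Branch 7 8
     (Swap [:: 6; 9] [:: [:: 1; 5]] [:: [:: 0; 1; 2]; [:: 3; 4; 5]; [:: 7; 8]])
     (Branch 4 7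
       (Branch 4 6
         (Branch 6 10
           (Branch 7 10
             (Swap [:: 11] [::] [:: [:: 0; 1; 2]; [:: 3; 4; 5]; [:: 6; 7; 10]])
             (Branch 6 11
               (Swap [:: 7] [:: [:: 0]] [:: [:: 0; 1; 2]; [:: 3; 4; 5]; [:: 6; 10; 11]])
               (Branch 5 11
                 (Swap [:: 3; 10] [::] [:: [:: 0; 1; 2]; [:: 4; 6; 7]; [:: 5; 11]])
                 (Branch 6 8
                   (Small [:: [:: 3; 10]; [:: 4; 8]; [:: 5; 6; 11]]
                     [:: [:: 3; 4; 5]; [:: 6; 8]; [:: 10; 11]])
                   (Branch 5 8
                     (Small [:: [:: 4; 8]; [:: 5; 6; 11]; [:: 7; 10]]
                       [:: [:: 4; 6; 7]; [:: 5; 8]; [:: 10; 11]])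
                     (Swap [:: 4] [:: [:: 5; 6; 8]] [:: [:: 0; 1; 2]; [:: 3; 5]]))))))
           (Swap [:: 3; 5] [:: [:: 6; 10]] [:: [:: 0; 1; 2]; [:: 4; 6; 7]]))
         (Swap [:: 8; 9] [:: [:: 1; 5]; [:: 4; 6]] [:: [:: 0; 1; 2]; [:: 3; 4; 5]]))
       (Swap [:: 0] [:: [:: 4; 7; 8]] [:: [:: 3; 4; 5]; [:: 1; 2]]))));
 (State 3 10
   [:: (0, 7); (1, 9); (2, 3); (4, 8); (5, 6)]
   [:: (0, 1); (0, 2); (0, 5); (1, 2); (1, 4); (3, 4); (3, 5); (4, 5); (6, 7); (8, 9)]
   [:: [:: 2; 3]; [:: 5; 6]; [:: 4; 8]; [:: 1; 9]]
   [:: [:: 0; 1; 2]; [:: 3; 4; 5]],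
  Branch 0 4
   (Branch 2 4
     (Swap [::] [::] [:: [:: 0; 1; 2; 4]; [:: 3; 5]])
     (Branch 2 8
       (Branch 1 5
         (Small [:: [:: 0; 7]; [:: 1; 9]; [:: 4; 8]; [:: 5; 6]]
           [:: [:: 0; 1; 4; 5]; [:: 6; 7]; [:: 8; 9]])
         (Branch 7 8
           (Small [:: [:: 0; 7]; [:: 1; 5]; [:: 2; 3]; [:: 4; 8]]
             [:: [:: 0; 1; 2]; [:: 3; 4; 5]; [:: 7; 8]])
           (Branch 5 9
             (Branch 5 8
               (Small [:: [:: 0; 7]; [:: 1; 9]; [:: 4; 8]; [:: 5; 6]]
                 [:: [:: 0; 1; 4]; [:: 5; 8; 9]; [:: 6; 7]])
               (Branch 6 8
                 (Branch 6 9
                   (Small [:: [:: 1; 9]; [:: 2; 3]; [:: 4; 8]; [:: 5; 6]]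
                     [:: [:: 1; 2]; [:: 3; 4; 5]; [:: 6; 8; 9]])
                   (Branch 4 9
                     (Small [:: [:: 0; 7]; [:: 1; 9]; [:: 2; 4]; [:: 5; 6]]
                       [:: [:: 0; 1; 2]; [:: 4; 5; 9]; [:: 6; 7]])
                     (Branch 4 7
                       (Branch 5 7
                         (Small [:: [:: 0; 7]; [:: 1; 5]; [:: 2; 4]]
                           [:: [:: 0; 1; 2]; [:: 4; 5; 7]])
                         (Branch 4 6
                           (Small [:: [:: 2; 4]; [:: 5; 7; 8]; [:: 6; 9]]
                             [:: [:: 2; 8]; [:: 4; 6; 7]; [:: 5; 9]])
                           (Small [:: [:: 4; 6; 9]; [:: 5; 7; 8]]
                             [:: [:: 4; 7]; [:: 5; 9]; [:: 6; 8]])))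
                       (Small [:: [:: 2; 3]; [:: 4; 7; 8]; [:: 5; 6]]
                         [:: [:: 2; 8]; [:: 3; 4; 5]; [:: 6; 7]]))))
                 (Small [:: [:: 0; 7]; [:: 2; 4]; [:: 5; 6; 8]]
                   [:: [:: 0; 4; 5]; [:: 2; 8]; [:: 6; 7]])))
             (Small [:: [:: 1; 5; 9]; [:: 2; 3]; [:: 4; 8]] [:: [:: 1; 2]; [:: 3; 4; 5]; [:: 8; 9]]))))
       (Swap [:: 3] [:: [:: 2; 4; 8]] [:: [:: 0; 1; 2]; [:: 4; 5]])))
   (Branch 6 9
     (Small [:: [:: 0; 4]; [:: 1; 9]; [:: 2; 3]; [:: 5; 6]]
       [:: [:: 0; 1; 2]; [:: 3; 4; 5]; [:: 6; 9]])
     (Branch 5 9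
       (Branch 5 8
         (Branch 4 7
           (Branch 4 6
             (Small [:: [:: 0; 7]; [:: 1; 9]; [:: 4; 8]; [:: 5; 6]]
               [:: [:: 0; 1]; [:: 4; 6; 7]; [:: 5; 8; 9]])
             (Branch 6 8
               (Branch 7 8
                 (Small [:: [:: 0; 7]; [:: 2; 3]; [:: 4; 8]; [:: 5; 6]]
                   [:: [:: 0; 2]; [:: 3; 4; 5]; [:: 6; 7; 8]])
                 (Branch 3 9
                   (Small [:: [:: 0; 7]; [:: 1; 9]; [:: 2; 3]; [:: 5; 6]]
                     [:: [:: 0; 1; 2]; [:: 3; 5; 9]; [:: 6; 7]])
                   (Branch 3 7
                     (Small [:: [:: 0; 7]; [:: 1; 9]; [:: 2; 3]; [:: 4; 8]]
                       [:: [:: 0; 1; 2]; [:: 3; 4; 7]; [:: 8; 9]])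
                     (Branch 7 9
                       (Branch 5 7
                         (Branch 4 9
                           (Small [:: [:: 0; 7]; [:: 1; 9]; [:: 4; 8]; [:: 5; 6]]
                             [:: [:: 0; 1]; [:: 4; 5; 7; 9]; [:: 6; 8]])
                           (Branch 2 9
                             (Branch 2 8
                               (Small [:: [:: 2; 3]; [:: 4; 6; 9]; [:: 7; 8]]
                                 [:: [:: 2; 8; 9]; [:: 3; 4]; [:: 6; 7]])
                               (Small [:: [:: 0; 7]; [:: 1; 9]; [:: 2; 8]; [:: 5; 6]]
                                 [:: [:: 0; 1; 2]; [:: 5; 8; 9]; [:: 6; 7]]))
                             (Swap [:: 1] [:: [:: 2; 3; 9]] [:: [:: 3; 4; 5]; [:: 0; 2]])))
                         (Small [:: [:: 0; 4]; [:: 1; 9]; [:: 2; 3]; [:: 5; 7]]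
                           [:: [:: 0; 1; 2]; [:: 3; 4; 5]; [:: 7; 9]]))
                       (Small [:: [:: 3; 7; 9]; [:: 4; 8]; [:: 5; 6]]
                         [:: [:: 3; 4; 5]; [:: 6; 7]; [:: 8; 9]])))))
               (Swap [:: 5] [:: [:: 4; 6; 8]] [:: [:: 0; 1; 2]; [:: 3; 4]])))
           (Small [:: [:: 0; 4; 7]; [:: 2; 3]; [:: 5; 6]] [:: [:: 0; 2]; [:: 3; 4; 5]; [:: 6; 7]]))
         (Small [:: [:: 0; 4]; [:: 1; 9]; [:: 2; 3]; [:: 5; 8]]
           [:: [:: 0; 1; 2]; [:: 3; 4; 5]; [:: 8; 9]]))
       (Swap [:: 1] [:: [:: 5; 6; 9]] [:: [:: 3; 4; 5]; [:: 0; 2]]))));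
 (State 3 10
   [:: (0, 7); (3, 9); (4, 8); (5, 6)]
   [:: (0, 1); (0, 2); (0, 5); (1, 2); (3, 4); (3, 5); (4, 5); (6, 7); (8, 9)]
   [:: [:: 5; 6]; [:: 0; 7]; [:: 4; 8]; [:: 3; 9]]
   [:: [:: 0; 1; 2]; [:: 3; 4; 5]; [:: 6; 7]; [:: 8; 9]],
  Branch 0 4
   (Branch 0 3
     (Small [:: [:: 0; 7]; [:: 3; 9]; [:: 4; 8]; [:: 5; 6]]
       [:: [:: 0; 3; 4; 5]; [:: 6; 7]; [:: 8; 9]])
     (Branch 6 8
       (Swap [:: 7; 9] [:: [:: 0; 3]] [:: [:: 0; 1; 2]; [:: 3; 4; 5]; [:: 6; 8]])
       (Branch 5 9
         (Branch 5 8
           (Branch 4 7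
             (Branch 4 6
               (Swap [:: 3] [:: [:: 9]] [:: [:: 0; 1; 2]; [:: 4; 6; 7]; [:: 5; 8; 9]])
               (Swap [:: 5] [:: [:: 4; 6; 8]] [:: [:: 0; 1; 2]; [:: 3; 4]]))
             (Swap [:: 8; 9] [:: [:: 0; 3]; [:: 4; 7]] [:: [:: 0; 1; 2]; [:: 3; 4; 5]]))
           (Swap [:: 4] [:: [:: 5; 6; 8]] [:: [:: 0; 1; 2]; [:: 3; 5]]))
         (Swap [:: 6; 7] [:: [:: 0; 3]; [:: 5; 9]] [:: [:: 0; 1; 2]; [:: 3; 4; 5]]))))
   (Branch 6 9
     (Swap [:: 7; 8] [:: [:: 0; 4]] [:: [:: 0; 1; 2]; [:: 3; 4; 5]; [:: 6; 9]])
     (Branch 5 9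
       (Branch 5 8
         (Branch 4 7
           (Branch 4 6
             (Swap [:: 3] [:: [:: 9]] [:: [:: 0; 1; 2]; [:: 4; 6; 7]; [:: 5; 8; 9]])
             (Branch 6 8
               (Branch 5 7
                 (Swap [:: 3; 9] [::] [:: [:: 0; 1; 2]; [:: 4; 5; 7]; [:: 6; 8]])
                 (Branch 7 9
                   (Swap [:: 6; 8]
                     [:: [:: 0; 4]; [:: 5; 7]]
                     [:: [:: 0; 1; 2]; [:: 3; 4; 5]; [:: 7; 9]])
                   (Branch 3 7
                     (Small [:: [:: 3; 9]; [:: 4; 8]; [:: 5; 7]] [:: [:: 3; 4; 7]; [:: 5; 8; 9]])
                     (Small [:: [:: 3; 7; 9]; [:: 4; 8]; [:: 5; 6]]
                       [:: [:: 3; 4; 5]; [:: 6; 7]; [:: 8; 9]]))))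
               (Swap [:: 5] [:: [:: 4; 6; 8]] [:: [:: 0; 1; 2]; [:: 3; 4]])))
           (Swap [:: 8] [:: [:: 0; 4; 7]] [:: [:: 0; 1; 2]; [:: 3; 4; 5]; [:: 9]]))
         (Swap [:: 6; 7] [:: [:: 0; 4]; [:: 5; 8]] [:: [:: 0; 1; 2]; [:: 3; 4; 5]]))
       (Swap [:: 3] [:: [:: 5; 6; 9]] [:: [:: 0; 1; 2]; [:: 4; 5]]))));
 (State 3 10
   [:: (0, 7); (4, 8); (5, 6)]
   [:: (0, 1); (0, 2); (0, 5); (1, 2); (3, 4); (3, 5); (4, 5); (6, 7); (8, 9)]
   [:: [:: 5; 6]; [:: 0; 7]; [:: 4; 8]]
   [:: [:: 0; 1; 2]; [:: 3; 4; 5]; [:: 6; 7]; [:: 8; 9]],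
  Partner false 9 [:: (10, Branch 4 10
    (Partner true 10 [:: (11, Branch 8 11
       (Swap [:: 9; 10] [::] [:: [:: 0; 1; 2]; [:: 3; 4; 5]; [:: 8; 11]])
       (Cite 14 [:: 0; 1; 2; 3; 5; 4; 8; 9; 10; 11]))])
    (Swap [:: 8; 9] [:: [:: 4; 10]] [:: [:: 0; 1; 2]; [:: 3; 4; 5]]));
   (1, Branch 1 4
    (Partner false 3 [:: (10, Partner true 10 [:: (11, Cite 15 [:: 0; 1; 2; 3; 4; 5; 6; 7; 8; 9; 10; 11])]);
      (2, Cite 16 [:: 0; 1; 2; 3; 4; 5; 6; 7; 8; 9])])
    (Swap [:: 8; 9] [:: [:: 1; 4]] [:: [:: 0; 1; 2]; [:: 3; 4; 5]]));
   (2, Branch 2 4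
    (Partner false 3 [:: (10, Partner true 10 [:: (11, Cite 15 [:: 0; 2; 1; 3; 4; 5; 6; 7; 8; 9; 10; 11])]);
      (1, Cite 16 [:: 0; 2; 1; 3; 4; 5; 6; 7; 8; 9])])
    (Swap [:: 8; 9] [:: [:: 2; 4]] [:: [:: 0; 1; 2]; [:: 3; 4; 5]]));
   (3, Cite 17 [:: 0; 1; 2; 3; 4; 5; 6; 7; 8; 9])]);
 (State 3 8
   [:: (0, 7); (5, 6)]
   [:: (0, 1); (0, 2); (0, 5); (1, 2); (3, 4); (3, 5); (4, 5); (6, 7)]
   [:: [:: 5; 6]; [:: 0; 7]]
   [:: [:: 0; 1; 2]; [:: 3; 4; 5]; [:: 6; 7]],
  Partner false 4 [:: (8, Partner true 8 [:: (9, Cite 18 [:: 0; 1; 2; 3; 4; 5; 6; 7; 8; 9])]);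
   (1, Branch 2 3
    (Partner false 3 [:: (8, Partner true 8 [:: (9, Cite 18 [:: 0; 1; 2; 4; 3; 5; 6; 7; 8; 9])])])
    (Small [:: [:: 0; 7]; [:: 1; 4]; [:: 2; 3]; [:: 5; 6]]
      [:: [:: 0; 1; 2]; [:: 3; 4; 5]; [:: 6; 7]]));
   (2, Branch 1 3
    (Partner false 3 [:: (8, Partner true 8 [:: (9, Cite 18 [:: 0; 1; 2; 4; 3; 5; 6; 7; 8; 9])])])
    (Small [:: [:: 0; 7]; [:: 1; 3]; [:: 2; 4]; [:: 5; 6]]
      [:: [:: 0; 1; 2]; [:: 3; 4; 5]; [:: 6; 7]]))]);
 (State 3 10
   [:: (0, 4); (2, 8); (3, 7); (5, 6)]
   [:: (0, 1); (0, 2); (1, 2); (3, 4); (3, 5); (4, 5); (6, 7); (8, 9)]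
   [:: [:: 0; 4]; [:: 5; 6]; [:: 3; 7]; [:: 2; 8]]
   [:: [:: 0; 1; 2]; [:: 3; 4; 5]; [:: 6; 7]; [:: 8; 9]],
  Partner false 9 [:: (10, Branch 2 10
    (Partner true 10 [:: (11, Branch 8 11
       (Swap [:: 9; 10] [::] [:: [:: 0; 1; 2]; [:: 3; 4; 5]; [:: 8; 11]])
       (Cite 14 [:: 3; 4; 5; 0; 1; 2; 8; 9; 10; 11]))])
    (Swap [:: 8; 9] [:: [:: 2; 10]] [:: [:: 0; 1; 2]; [:: 3; 4; 5]]));
   (1, Branch 1 5
    (Branch 1 4
      (Branch 1 3
        (Swap [::] [::] [:: [:: 1; 3; 4; 5]; [:: 0; 2]])
        (Branch 6 8
          (Small [:: [:: 0; 4]; [:: 1; 3]; [:: 2; 8]; [:: 5; 6]]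
            [:: [:: 0; 1; 2]; [:: 3; 4; 5]; [:: 6; 8]])
          (Branch 5 9
            (Branch 5 8
              (Branch 3 9
                (Branch 4 9
                  (Small [:: [:: 0; 4]; [:: 1; 9]; [:: 3; 7]; [:: 5; 6]]
                    [:: [:: 0; 1]; [:: 3; 4; 5; 9]; [:: 6; 7]])
                  (Branch 3 8
                    (Small [:: [:: 1; 9]; [:: 2; 8]; [:: 3; 7]; [:: 5; 6]]
                      [:: [:: 1; 2]; [:: 3; 5; 8; 9]; [:: 6; 7]])
                    (Branch 7 8
                      (Branch 7 9
                        (Small [:: [:: 0; 4]; [:: 1; 9]; [:: 2; 8]; [:: 3; 7]]
                          [:: [:: 0; 1; 2]; [:: 3; 4]; [:: 7; 8; 9]])
                        (Branch 2 7
                          (Branch 2 6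
                            (Small [:: [:: 2; 8]; [:: 5; 6]; [:: 7; 9]]
                              [:: [:: 2; 6; 7]; [:: 5; 8; 9]])
                            (Swap [:: 5] [:: [:: 2; 6; 8]] [:: [:: 0; 1; 2]; [:: 3; 4]]))
                          (Small [:: [:: 0; 4]; [:: 1; 3]; [:: 2; 7]; [:: 5; 6]]
                            [:: [:: 0; 1; 2]; [:: 3; 4; 5]; [:: 6; 7]])))
                      (Small [:: [:: 3; 7; 8]; [:: 4; 9]; [:: 5; 6]]
                        [:: [:: 3; 4; 5]; [:: 6; 7]; [:: 8; 9]]))))
                (Small [:: [:: 0; 4]; [:: 1; 3; 9]; [:: 2; 8]]
                  [:: [:: 0; 1; 2]; [:: 3; 4]; [:: 8; 9]]))
              (Swap [:: 2] [:: [:: 5; 6; 8]] [:: [:: 3; 4; 5]; [:: 0; 1]]))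
            (Small [:: [:: 0; 4]; [:: 1; 3]; [:: 2; 8]; [:: 5; 9]]
              [:: [:: 0; 1; 2]; [:: 3; 4; 5]; [:: 8; 9]]))))
      (Branch 4 9
        (Branch 4 8
          (Small [:: [:: 0; 4]; [:: 1; 9]; [:: 2; 8]] [:: [:: 0; 1; 2]; [:: 4; 8; 9]])
          (Branch 2 4
            (Branch 0 8
              (Branch 4 7
                (Branch 4 6
                  (Branch 1 3
                    (Small [:: [:: 1; 4]; [:: 3; 7]; [:: 5; 6]] [:: [:: 1; 3; 5]; [:: 4; 6; 7]])
                    (Branch 6 8
                      (Small [:: [:: 0; 4]; [:: 1; 3]; [:: 2; 8]; [:: 5; 6]]
                        [:: [:: 0; 1; 2]; [:: 3; 4; 5]; [:: 6; 8]])
                      (Branch 5 9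
                        (Branch 5 8
                          (Small [:: [:: 0; 4]; [:: 1; 9]; [:: 2; 8]; [:: 5; 6]]
                            [:: [:: 0; 1; 2]; [:: 4; 6]; [:: 5; 8; 9]])
                          (Small [:: [:: 0; 4]; [:: 3; 7]; [:: 5; 6; 8]]
                            [:: [:: 0; 8]; [:: 3; 5]; [:: 4; 6; 7]]))
                        (Small [:: [:: 0; 4]; [:: 1; 3]; [:: 2; 8]; [:: 5; 9]]
                          [:: [:: 0; 1; 2]; [:: 3; 4; 5]; [:: 8; 9]]))))
                  (Branch 0 6
                    (Branch 0 7
                      (Small [:: [:: 0; 4]; [:: 3; 7]; [:: 5; 6]] [:: [:: 0; 6; 7]; [:: 3; 4; 5]])
                      (Branch 2 3
                        (Branch 2 5
                          (Small [:: [:: 0; 4]; [:: 2; 8]; [:: 3; 7]; [:: 5; 6]]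
                            [:: [:: 0; 8]; [:: 2; 3; 4; 5]; [:: 6; 7]])
                          (Branch 6 8
                            (Branch 6 9
                              (Small [:: [:: 0; 7]; [:: 1; 9]; [:: 2; 8]; [:: 4; 6]]
                                [:: [:: 0; 1; 2]; [:: 4; 7]; [:: 6; 8; 9]])
                              (Branch 5 9
                                (Small [:: [:: 0; 4]; [:: 1; 9]; [:: 2; 5]]
                                  [:: [:: 0; 1; 2]; [:: 4; 5; 9]])
                                (Small [:: [:: 3; 7]; [:: 4; 8]; [:: 5; 6; 9]]
                                  [:: [:: 3; 4; 5]; [:: 6; 7]; [:: 8; 9]])))
                            (Swap [:: 0] [:: [:: 2; 5]; [:: 4; 6; 8]] [:: [:: 3; 4; 5]; [:: 1; 2]])))
                        (Small [:: [:: 0; 7]; [:: 1; 4]; [:: 2; 3]; [:: 5; 6]]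
                          [:: [:: 0; 1; 2]; [:: 3; 4; 5]; [:: 6; 7]])))
                    (Swap [:: 5] [:: [:: 0; 4; 6]] [:: [:: 0; 1; 2]; [:: 3; 4]])))
                (Branch 0 7
                  (Branch 0 6
                    (Small [:: [:: 0; 4]; [:: 3; 7]; [:: 5; 6]] [:: [:: 0; 6; 7]; [:: 3; 4; 5]])
                    (Branch 4 6
                      (Branch 2 5
                        (Branch 6 9
                          (Small [:: [:: 0; 4]; [:: 1; 9]; [:: 2; 8]; [:: 5; 6]]
                            [:: [:: 0; 8]; [:: 1; 2; 5]; [:: 4; 6; 9]])
                          (Branch 5 9
                            (Branch 6 8
                              (Small [:: [:: 0; 4]; [:: 1; 9]; [:: 2; 8]; [:: 5; 6]]
                                [:: [:: 0; 1; 2]; [:: 4; 5; 9]; [:: 6; 8]])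
                              (Branch 5 8
                                (Small [:: [:: 0; 4]; [:: 1; 9]; [:: 2; 8]; [:: 5; 6]]
                                  [:: [:: 0; 1; 2]; [:: 4; 6]; [:: 5; 8; 9]])
                                (Small [:: [:: 0; 4]; [:: 3; 7]; [:: 5; 6; 8]]
                                  [:: [:: 0; 8]; [:: 3; 4; 5]; [:: 6; 7]])))
                            (Small [:: [:: 3; 7]; [:: 4; 8]; [:: 5; 6; 9]]
                              [:: [:: 3; 4; 5]; [:: 6; 7]; [:: 8; 9]])))
                        (Small [:: [:: 0; 6]; [:: 1; 4]; [:: 2; 5]; [:: 3; 7]]
                          [:: [:: 0; 1; 2]; [:: 3; 4; 5]; [:: 6; 7]]))
                      (Swap [:: 5] [:: [:: 0; 4; 6]] [:: [:: 0; 1; 2]; [:: 3; 4]])))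
                  (Swap [:: 3] [:: [:: 0; 4; 7]] [:: [:: 0; 1; 2]; [:: 4; 5]])))
              (Swap [:: 2] [:: [:: 0; 4; 8]] [:: [:: 3; 4; 5]; [:: 0; 1]]))
            (Swap [:: 0] [:: [:: 2; 4; 8]] [:: [:: 3; 4; 5]; [:: 1; 2]])))
        (Swap [:: 0] [:: [:: 1; 4; 9]] [:: [:: 3; 4; 5]; [:: 1; 2]])))
    (Branch 7 8
      (Small [:: [:: 0; 4]; [:: 1; 5]; [:: 2; 8]; [:: 3; 7]]
        [:: [:: 0; 1; 2]; [:: 3; 4; 5]; [:: 7; 8]])
      (Branch 5 9
        (Branch 3 9
          (Branch 4 9
            (Small [:: [:: 0; 4]; [:: 1; 9]; [:: 3; 7]; [:: 5; 6]]
              [:: [:: 0; 1]; [:: 3; 4; 5; 9]; [:: 6; 7]])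
            (Branch 3 8
              (Branch 5 8
                (Small [:: [:: 1; 9]; [:: 2; 8]; [:: 3; 7]; [:: 5; 6]]
                  [:: [:: 1; 2]; [:: 3; 5; 8; 9]; [:: 6; 7]])
                (Branch 6 8
                  (Branch 6 9
                    (Small [:: [:: 0; 4]; [:: 1; 9]; [:: 2; 8]; [:: 5; 6]]
                      [:: [:: 0; 1; 2]; [:: 4; 5]; [:: 6; 8; 9]])
                    (Branch 2 7
                      (Branch 2 6
                        (Small [:: [:: 2; 8]; [:: 3; 7]; [:: 6; 9]] [:: [:: 2; 6; 7]; [:: 3; 8; 9]])
                        (Small [:: [:: 0; 4]; [:: 1; 5]; [:: 2; 6]; [:: 3; 7]]
                          [:: [:: 0; 1; 2]; [:: 3; 4; 5]; [:: 6; 7]]))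
                      (Swap [:: 3] [:: [:: 2; 7; 8]] [:: [:: 0; 1; 2]; [:: 4; 5]])))
                  (Small [:: [:: 3; 7]; [:: 4; 9]; [:: 5; 6; 8]]
                    [:: [:: 3; 8; 9]; [:: 4; 5]; [:: 6; 7]])))
              (Small [:: [:: 3; 7; 8]; [:: 4; 9]; [:: 5; 6]]
                [:: [:: 3; 4; 5]; [:: 6; 7]; [:: 8; 9]])))
          (Small [:: [:: 0; 4]; [:: 1; 5]; [:: 2; 8]; [:: 3; 9]]
            [:: [:: 0; 1; 2]; [:: 3; 4; 5]; [:: 8; 9]]))
        (Small [:: [:: 0; 4]; [:: 1; 5; 9]; [:: 2; 8]] [:: [:: 0; 1; 2]; [:: 4; 5]; [:: 8; 9]]))))]);
 (State 3 8
   [:: (3, 7); (5, 6)]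
   [:: (0, 1); (0, 2); (1, 2); (3, 4); (3, 5); (4, 5); (6, 7)]
   [:: [:: 5; 6]; [:: 3; 7]]
   [:: [:: 0; 1; 2]; [:: 3; 4; 5]; [:: 6; 7]],
  Partner false 4 [:: (8, Partner true 8 [:: (9, Partner false 9 [:: (10, Branch 4 10
      (Partner true 10 [:: (11, Branch 8 11
         (Swap [:: 9; 10] [::] [:: [:: 0; 1; 2]; [:: 3; 4; 5]; [:: 8; 11]])
         (Cite 14 [:: 0; 1; 2; 3; 5; 4; 8; 9; 10; 11]))])
      (Swap [:: 8; 9] [:: [:: 4; 10]] [:: [:: 0; 1; 2]; [:: 3; 4; 5]]));
     (0, Branch 0 4
      (Cite 17 [:: 0; 1; 2; 3; 5; 4; 8; 9; 6; 7])
      (Swap [:: 8; 9] [:: [:: 0; 4]] [:: [:: 0; 1; 2]; [:: 3; 4; 5]]));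
     (1, Branch 1 4
      (Cite 17 [:: 1; 0; 2; 3; 5; 4; 8; 9; 6; 7])
      (Swap [:: 8; 9] [:: [:: 1; 4]] [:: [:: 0; 1; 2]; [:: 3; 4; 5]]));
     (2, Branch 2 4
      (Cite 17 [:: 2; 0; 1; 3; 5; 4; 8; 9; 6; 7])
      (Swap [:: 8; 9] [:: [:: 2; 4]] [:: [:: 0; 1; 2]; [:: 3; 4; 5]]))])]);
   (0, Partner false 2 [:: (8, Partner true 8 [:: (9, Cite 20 [:: 0; 1; 2; 3; 4; 5; 6; 7; 8; 9])])]);
   (1, Partner false 2 [:: (8, Partner true 8 [:: (9, Cite 20 [:: 1; 0; 2; 3; 4; 5; 6; 7; 8; 9])])]);
   (2, Partner false 1 [:: (8, Partner true 8 [:: (9, Cite 20 [:: 2; 0; 1; 3; 4; 5; 6; 7; 8; 9])])])]);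
 (State 3 8
   [:: (5, 6)]
   [:: (0, 1); (0, 2); (1, 2); (3, 4); (3, 5); (4, 5); (6, 7)]
   [:: [:: 5; 6]]
   [:: [:: 0; 1; 2]; [:: 3; 4; 5]; [:: 6; 7]],
  Partner false 7 [:: (8, Branch 5 8
    (Partner true 8 [:: (9, Branch 6 9
       (Swap [:: 7; 8] [::] [:: [:: 0; 1; 2]; [:: 3; 4; 5]; [:: 6; 9]])
       (Cite 14 [:: 0; 1; 2; 3; 4; 5; 6; 7; 8; 9]))])
    (Swap [:: 6; 7] [:: [:: 5; 8]] [:: [:: 0; 1; 2]; [:: 3; 4; 5]]));
   (0, Branch 0 5
    (Cite 19 [:: 0; 1; 2; 3; 4; 5; 6; 7])
    (Swap [:: 6; 7] [:: [:: 0; 5]] [:: [:: 0; 1; 2]; [:: 3; 4; 5]]));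
   (1, Branch 1 5
    (Cite 19 [:: 1; 0; 2; 3; 4; 5; 6; 7])
    (Swap [:: 6; 7] [:: [:: 1; 5]] [:: [:: 0; 1; 2]; [:: 3; 4; 5]]));
   (2, Branch 2 5
    (Cite 19 [:: 2; 0; 1; 3; 4; 5; 6; 7])
    (Swap [:: 6; 7] [:: [:: 2; 5]] [:: [:: 0; 1; 2]; [:: 3; 4; 5]]));
   (3, Cite 21 [:: 0; 1; 2; 3; 4; 5; 6; 7]);
   (4, Cite 21 [:: 0; 1; 2; 4; 3; 5; 6; 7])]);
 (State 3 6
   [:: (0, 5)]
   [:: (0, 1); (0, 2); (1, 2); (3, 4); (3, 5); (4, 5)]
   [:: [:: 0; 5]]
   [:: [:: 0; 1; 2]; [:: 3; 4; 5]],
  Partner false 4 [:: (6, Partner true 6 [:: (7, Cite 22 [:: 0; 1; 2; 3; 5; 4; 6; 7])]);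
   (1, Branch 2 3
    (Partner false 3 [:: (6, Partner true 6 [:: (7, Cite 22 [:: 0; 1; 2; 4; 5; 3; 6; 7])])])
    (Small [:: [:: 0; 5]; [:: 1; 4]; [:: 2; 3]] [:: [:: 0; 1; 2]; [:: 3; 4; 5]]));
   (2, Branch 1 3
    (Partner false 3 [:: (6, Partner true 6 [:: (7, Cite 22 [:: 0; 1; 2; 4; 5; 3; 6; 7])])])
    (Small [:: [:: 0; 5]; [:: 1; 3]; [:: 2; 4]] [:: [:: 0; 1; 2]; [:: 3; 4; 5]]))]);
 (State 3 6
   [::]
   [:: (0, 1); (0, 2); (1, 2); (3, 4); (3, 5); (4, 5)]
   [::]
   [:: [:: 0; 1; 2]; [:: 3; 4; 5]],
  Partner false 5 [:: (6, Partner true 6 [:: (7, Cite 22 [:: 0; 1; 2; 3; 4; 5; 6; 7])]);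
   (0, Cite 23 [:: 0; 1; 2; 3; 4; 5]);
   (1, Cite 23 [:: 1; 0; 2; 3; 4; 5]);
   (2, Cite 23 [:: 2; 0; 1; 3; 4; 5])])].

Lemma check_refutations : check_all [::] refutations.
Proof. by vm_compute. Qed.

(** * Certificates with the fewest vertices *)

Definition pairs_in (P : seq (seq nat)) :=
  flatten [seq [seq ij <- [seq (i, j) | i <- p, j <- p] | ij.1 < ij.2] | p <- P].

(** [pairs_in] lists the pairs of a part in lexicographic order, as the starting entries of
    [refutations] do; a starting position is therefore recognized there by computation alone. *)
Definition root l m A B := State l m (pairs_in A) (pairs_in B) A B.

Section Minimal.
Variables (T : eqType) (x0 : T).
Implicit Types (e : rel T) (V : seq T) (c : bool -> seq (seq T)).

(** Only a lower bound, which becomes the minimum in the company of a certificate on exactly [n]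
    vertices; [8 < n] excludes the small certificates of [improvable]. *)
Definition minimal e n := 8 < n /\ forall V c, cert e V c -> n <= size V.

(** It exchanges stable sets and cliques, so that positions differing by this exchange are excluded
    together. Its values on the diagonal do no harm because [homog] looks at distinct elements
    only. *)
Definition flip e : rel T := fun x y => ~~ e x y.

Lemma flip_cert e V c : cert e V c -> cert (flip e) V (fun b => c (~~ b)).
Proof.
case=> uV pV hV ltV; split=> // [b p pin x y xp yp xy|]; last by rewrite addnC.
by rewrite /flip (hV _ _ pin) // negbK.
Qed.

Lemma flip_minimal e n : minimal e n -> minimal (flip e) n.
Proof.
case=> n8 H; split=> // V c /flip_cert cc; apply: (H V (fun b => c (~~ b))).
by case: cc => uV pV hV ltV; split=> // b p pin x y xp yp xy; rewrite -(hV _ _ pin x y) // /flip negbK.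
Qed.

Lemma cert_eqv e V c c' : cert e V c -> (forall b, size (c' b) = size (c b)) ->
  (forall b, perm_eq (flatten (c' b)) (flatten (c b))) ->
  (forall b p, p \in c' b -> homog e b p) -> cert e V c'.
Proof.
case=> uV pV hV ltV szE pE hE; split=> //; last by rewrite !szE.
by move=> b; rewrite (permPl (pE b)).
Qed.

Lemma improvable_minimal e n l V : minimal e n -> size V = n -> improvable e l V ->
  exists V' c', [/\ cert e V' c', size V' = n & special l c'].
Proof.
move=> [n8 nmin] sV [V' [c' [cc' H]]]; have := nmin _ _ cc'; exists V', c'.
by case: H => [H|H|[H sp]]; rewrite ?H; split=> //; lia.
Qed.

Lemma root_models e l m A B xs rest V :
    uniq xs -> size xs = m -> {subset xs <= V} ->
    (forall b p, p \in rest b -> size p = 2) ->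
    all (all (ltn^~ m)) (A ++ B) -> cert e V (glue x0 xs (root l m A B) rest) ->
  models x0 e (root l m A B) xs rest V.
Proof.
move=> uxs sxs xsV r2 lt c; split=> // b i j ij; case: c => _ _ hV _.
have [p pin [ip jp ltij]] : exists2 p, p \in bpick A B b & [/\ i \in p, j \in p & i < j].
  have: (i, j) \in pairs_in (bpick A B b) by case: b ij.
  case/flattenP=> _ /mapP[p pin ->]; rewrite mem_filter /= => /andP[ltij].
  move=> /allpairsP[[i' j'] /= [ip jp [ei ej]]].
  by exists p; [|split; [rewrite ei|rewrite ej|]].
have /allP ltp : all (ltn^~ m) p.
  by apply: (allP lt); rewrite mem_cat; case: (b) pin => /= ->; rewrite ?orbT.
apply: (hV b (map (nth x0 xs) p)); rewrite ?map_f //.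
  by rewrite mem_cat map_f //; case: (b) pin.
have -> : (nth x0 xs i == nth x0 xs j) = (i == j) by apply: nth_uniq; rewrite ?sxs //; apply: ltp.
by rewrite neq_ltn ltij.
Qed.

(** The subtraction truncates, so [excess] measures the deviation from pairs only if no part is
    smaller than a pair. *)
Definition excess (P : seq (seq T)) := sumn [seq size p - 2 | p <- P].

Lemma excess_rem p P : p \in P -> excess P = size p - 2 + excess (rem p P).
Proof. by move=> pP; rewrite /excess (perm_sumn (perm_map _ (perm_to_rem pP))). Qed.

Lemma excess0 P : {in P, forall p, 1 < size p} -> excess P = 0 -> {in P, forall p, size p = 2}.
Proof. by move=> P2 ex0 p pP; have := P2 p pP; have := excess_rem pP; rewrite ex0; lia. Qed.

Lemma excess_gt0 P : 0 < excess P -> exists2 p, p \in P & 2 < size p.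
Proof.
move=> ex; case: (boolP (has (fun p => 2 < size p) P)) => [/hasP[p]|/hasPn H]; first by exists p.
suff : excess P = 0 by lia.
elim: P H {ex} => //= p P IH H; rewrite /excess /= -/(excess P) IH; last first.
  by move=> q qP; apply: H; rewrite inE qP orbT.
by have := H p (mem_head _ _); lia.
Qed.

Lemma size_flatten_excess P : {in P, forall p, 1 < size p} ->
  size (flatten P) = 2 * size P + excess P.
Proof.
elim: P => //= p P IH H; rewrite size_cat IH => [|q qP]; last by apply: H; rewrite inE qP orbT.
by have := H p (mem_head _ _); rewrite /excess /= -/(excess P); lia.
Qed.

(** Without [x] there are [n - 1] vertices, too few for a certificate; the reduced parts would form
    one unless there are at least [n - 1] of them. *)
Lemma delete_vertex e n V c x c' : minimal e n -> cert e V c -> size V = n -> x \in V ->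
    (forall b, perm_eq (flatten (c' b)) (filter (predC1 x) V)) ->
    (forall b p, p \in c' b -> exists2 q, q \in c b & {subset p <= q}) ->
  n <= (size (c' false) + size (c' true)).+1.
Proof.
move=> [_ nmin] [uV pV hV ltV] sV xV pc' sub; rewrite leqNgt; apply/negP=> lt.
have sz : size V = (size (filter (predC1 x) V)).+1.
  by rewrite -rem_filter // size_rem // prednK //; case: (V) xV.
have : n <= size (filter (predC1 x) V); last by lia.
apply: (nmin _ c'); split=> //; first exact: filter_uniq.
  by move=> b p /sub[q qin pq]; apply: homog_sub pq _; apply: hV.
by lia.
Qed.

(** Restricting all parts to the vertices other than a given one shows that there are exactly
    [n - 1] parts. A part with at most one vertex could be dropped altogether along with a vertex,
    leaving only [n - 2]. Finally each kind covers the [n] vertices, so [2 * n] is [2 * (n - 1)]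
    plus the total excess. *)
Lemma minimal_parts e n V c : minimal e n -> cert e V c -> size V = n ->
  (forall b, {in c b, forall p, 1 < size p}) /\ excess (c false) + excess (c true) = 2.
Proof.
move=> Mn cc sV; have [uV pV hV ltV] := cc.
have sz : n = (size (c false) + size (c true)).+1.
  apply/eqP; rewrite eqn_leq -{2}sV ltV andbT.
  have [x xV] : exists x, x \in V by case: (V) ltV => [//|x ? _]; exists x; rewrite mem_head.
  have := delete_vertex (c' := fun b => map (filter (predC1 x)) (c b)) Mn cc sV xV.
  rewrite !size_map; apply=> [b|b _ /mapP[p pin ->]].
    by rewrite -filter_flatten; apply: perm_filter.
  by exists p => // y; rewrite mem_filter => /andP[].
have gt1 b : {in c b, forall p, 1 < size p}.
  move=> p pin; rewrite ltnNge; apply/negP=> p1.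
  (* If [p] is empty, any vertex serves as [x]. *)
  have [x xV px] : exists2 x, x \in V & {subset p <= [:: x]}.
    case: p p1 pin => [|x [|//]] _ pin.
      by case: (V) ltV => [//|x ? _]; exists x; rewrite ?mem_head.
    by exists x => //; rewrite -(perm_mem (pV b)); apply/flattenP; exists [:: x]; rewrite ?mem_head.
  pose c' b' := map (filter (predC1 x)) (if b' == b then rem p (c b) else c b').
  have : n <= (size (c' false) + size (c' true)).+1.
    apply: (delete_vertex Mn cc sV xV) => b'.
      rewrite /c' -filter_flatten; case: eqP => _; last exact: perm_filter.
      have /(perm_filter (predC1 x)) := perm_trans (perm_flatten (perm_to_rem pin)) (perm_refl _).
      rewrite /= filter_cat (_ : filter _ p = [::]).
        by rewrite perm_sym => /perm_trans; apply; apply: perm_filter.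
      by apply/eqP; rewrite -(negbK (_ == _)) -has_filter; apply/hasPn=> y /px; rewrite inE /= negbK.
    move=> _ /mapP[q qin ->]; exists q.
      by case: (b' =P b) qin => [->|//]; apply: mem_rem.
    by move=> y; rewrite mem_filter => /andP[].
  have szr := size_rem pin; have : 0 < size (c b) by case: (c b) pin.
  by rewrite /c' !size_map sz; case: (b) szr => /= ->; lia.
split=> //.
have szb b : n = 2 * size (c b) + excess (c b).
  by rewrite -sV -(perm_size (pV b)) size_flatten_excess.
by have := szb false; have := szb true; lia.
Qed.

End Minimal.

Lemma refuted_nth (T : eqType) (x0 : T) (e : rel T) k s : symmetric e ->
    k < size refutations -> nth s (map fst refutations) k = s ->
  refuted x0 e s.
Proof.
move=> e_sym lk sk; rewrite -sk.
by apply: (check_all_sound (e := e) e_sym _ check_refutations).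
Qed.

(** * Exclusion of the positions of the large parts *)

Section NoMinimal.
Variables (T : eqType) (x0 : T).
Implicit Types (e : rel T) (V : seq T) (c : bool -> seq (seq T)).

Lemma flip_sym e : symmetric e -> symmetric (flip e).
Proof. by move=> es x y; rewrite /flip es. Qed.

Lemma cert_part e V c b p : cert e V c -> p \in c b -> uniq p /\ {subset p <= V}.
Proof.
case=> uV pV _ _ pin; split.
  by apply: (flatten_part_uniq (ss := c b)) => //; rewrite (perm_uniq (pV b)).
by move=> x xp; rewrite -(perm_mem (pV b)); apply/flattenP; exists p.
Qed.

Lemma cert_homog e V c b p : cert e V c -> p \in c b -> homog e b p.
Proof. by case=> _ _ hV _; apply: hV. Qed.

(** Four vertices use up the total excess 2, so that all other parts are pairs and may stay
    unlisted. At level 0 no position is special, so the refutation is a contradiction at once. *)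
Lemma no_big_clique e n V c p : symmetric e -> minimal e n -> cert e V c -> size V = n ->
  p \in c true -> 3 < size p -> False.
Proof.
move=> es Mn cc sV pin p3; have [gt1 ex] := minimal_parts Mn cc sV.
have exr := excess_rem pin.
have p4 : size p = 4 by lia.
pose rest b := if b then rem p (c true) else c false.
have r2 b q : q \in rest b -> size q = 2.
  case: b => /=; first apply: excess0; last apply: excess0; try exact: gt1; try lia.
  by move=> r /mem_rem; apply: gt1.
have [up pV] := cert_part cc pin.
have R : refuted x0 e (root 0 4 [::] [:: [:: 0; 1; 2; 3]]) by apply: (refuted_nth (k := 2)).
have pE : map (nth x0 p) [:: 0; 1; 2; 3] = p by case: (p) p4 => [|? [|? [|? [|? []]]]].
have M : models x0 e (root 0 4 [::] [:: [:: 0; 1; 2; 3]]) p rest V.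
  apply: root_models => //.
  have gE b : glue x0 p (root 0 4 [::] [:: [:: 0; 1; 2; 3]]) rest b
            = if b then p :: rem p (c true) else c false.
    by case: b => //; rewrite /glue [parts _ _]/= map_cons pE.
  apply: (cert_eqv cc) => b; rewrite gE; case: b => //.
  - by rewrite -(perm_size (perm_to_rem pin)).
  - by rewrite perm_sym; apply: perm_flatten; apply: perm_to_rem.
  - by move=> r; rewrite -(perm_mem (perm_to_rem pin)); apply: cert_homog cc.
  - by move=> r; apply: cert_homog cc.
by have [? [? [_ _ [[]|[]|[]]]]] := improvable_minimal Mn sV (R _ _ _ M).
Qed.

Lemma no_big_part e n V c b p : symmetric e -> minimal e n -> cert e V c -> size V = n ->
  p \in c b -> 3 < size p -> False.
Proof.
case: b => es Mn cc sV; first exact: (no_big_clique es Mn cc sV).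
exact: (no_big_clique (flip_sym es) (flip_minimal Mn) (flip_cert cc) sV).
Qed.

Lemma mixed_rest e n V c p q : minimal e n -> cert e V c -> size V = n ->
    p \in c false -> q \in c true -> size p = 3 -> size q = 3 ->
  forall b r, r \in (if b then rem q (c true) else rem p (c false)) -> size r = 2.
Proof.
move=> Mn cc sV pin qin p3 q3; have [gt1 ex] := minimal_parts Mn cc sV.
have exp := excess_rem pin; have exq := excess_rem qin.
by case=> r; apply: excess0; try lia; move=> r' /mem_rem; apply: gt1.
Qed.

(** The triples may be reordered to bring their vertices to the numbers that the starting position
    gives them. *)
Lemma mixed_cert e V c p q p' q' : cert e V c -> p \in c false -> q \in c true ->
    perm_eq p' p -> perm_eq q' q ->
  cert e V (fun b => if b then q' :: rem q (c true) else p' :: rem p (c false)).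
Proof.
move=> cc pin qin pp qq; apply: (cert_eqv cc) => -[] /=.
- by rewrite size_rem // prednK //; case: (c true) qin.
- by rewrite size_rem // prednK //; case: (c false) pin.
- by rewrite perm_sym (permPl (perm_flatten (perm_to_rem qin))) /= perm_cat2r perm_sym.
- by rewrite perm_sym (permPl (perm_flatten (perm_to_rem pin))) /= perm_cat2r perm_sym.
- move=> r; rewrite inE => /predU1P[->|/mem_rem]; last exact: cert_homog cc.
  by apply: homog_sub (cert_homog cc qin) => x; rewrite (perm_mem qq).
- move=> r; rewrite inE => /predU1P[->|/mem_rem]; last exact: cert_homog cc.
  by apply: homog_sub (cert_homog cc pin) => x; rewrite (perm_mem pp).
Qed.

(** A stable set and a clique have at most one common vertex, so the triples span five vertices,
    with the common one numbered 0. The only way out that the refutation leaves is a part on four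
    vertices. *)
Lemma no_sharing_triples e n V c p q : symmetric e -> minimal e n -> cert e V c -> size V = n ->
  p \in c false -> q \in c true -> size p = 3 -> size q = 3 -> has (mem p) q -> False.
Proof.
move=> es Mn cc sV pin qin p3 q3 /hasP[v vq vp].
have [up pV] := cert_part cc pin; have [uq qV] := cert_part cc qin.
have rest2 := mixed_rest Mn cc sV pin qin p3 q3.
have disj x : x \in p -> x \in q -> x = v.
  move=> xp xq; apply/eqP; apply: contraT => xv.
  by have := cert_homog cc pin xp vp xv; rewrite (cert_homog cc qin xq vq xv).
have [a [b [pE ua]]] : exists a b, perm_eq [:: v; a; b] p /\ uniq [:: v; a; b].
  have := perm_to_rem vp; have := size_rem vp; rewrite p3.
  case: (rem v p) => [|a [|b []]] // _ pE; exists a, b.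
  by rewrite perm_sym pE; split=> //; rewrite -(perm_uniq pE).
have [c1 [d [qE uc]]] : exists a b, perm_eq [:: v; a; b] q /\ uniq [:: v; a; b].
  have := perm_to_rem vq; have := size_rem vq; rewrite q3.
  case: (rem v q) => [|a' [|b' []]] // _ qE; exists a', b'.
  by rewrite perm_sym qE; split=> //; rewrite -(perm_uniq qE).
have R : refuted x0 e (root 1 5 [:: [:: 0; 3; 4]] [:: [:: 0; 1; 2]]) by apply: (refuted_nth (k := 6)).
have M : models x0 e (root 1 5 [:: [:: 0; 3; 4]] [:: [:: 0; 1; 2]]) [:: v; c1; d; a; b]
    (fun b => if b then rem q (c true) else rem p (c false)) V.
  apply: root_models => //.
  - rewrite -[[:: _; _; _; _; _]]/([:: v; c1; d] ++ [:: a; b]) cat_uniq uc.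
    move: ua; rewrite /= !inE negb_or => /and3P[/andP[va vb] ab _].
    rewrite ab /= !orbF andbT negb_or; apply/andP; split; apply/negP => H.
      by move: va; rewrite (disj a) ?eqxx // -?(perm_mem pE) -?(perm_mem qE) !inE ?eqxx ?orbT.
    by move: vb; rewrite (disj b) ?eqxx // -?(perm_mem pE) -?(perm_mem qE) !inE ?eqxx ?orbT.
  - move=> x; rewrite -[[:: _; _; _; _; _]]/([:: v; c1; d] ++ [:: a; b]) mem_cat => /orP[xq|xp].
      by apply: qV; rewrite -(perm_mem qE).
    by apply: pV; rewrite -(perm_mem pE) inE xp orbT.
  - have cM := mixed_cert cc pin qin pE qE; apply: (cert_eqv cM) => b' //=; case: b' => //.
    + by move=> r; apply: (cert_homog (b := true) cM).
    + by move=> r; apply: (cert_homog (b := false) cM).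
have [V' [c' [cc' sV' []]]] := improvable_minimal Mn sV (R _ _ _ M).
- by case=> _ [b' [r]]; apply: no_big_part cc' sV'.
- by case.
- by case.
Qed.

(** Triples with a common vertex are already excluded; for disjoint ones the refutation leads back
    to these or to a part on four vertices. *)
Lemma no_mixed_triples e n V c p q : symmetric e -> minimal e n -> cert e V c -> size V = n ->
  p \in c false -> q \in c true -> size p = 3 -> size q = 3 -> False.
Proof.
move=> es Mn cc sV pin qin p3 q3.
case: (boolP (has (mem p) q)) => [|dis]; first exact: no_sharing_triples cc sV pin qin p3 q3.
have [up pV] := cert_part cc pin; have [uq qV] := cert_part cc qin.
have rest2 := mixed_rest Mn cc sV pin qin p3 q3.
have R : refuted x0 e (root 2 6 [:: [:: 3; 4; 5]] [:: [:: 0; 1; 2]]) by apply: (refuted_nth (k := 13)).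
have M : models x0 e (root 2 6 [:: [:: 3; 4; 5]] [:: [:: 0; 1; 2]]) (q ++ p)
    (fun b => if b then rem q (c true) else rem p (c false)) V.
  apply: root_models => //.
  - by rewrite cat_uniq uq up andbT has_sym.
  - by rewrite size_cat p3 q3.
  - by move=> x; rewrite mem_cat => /orP[/qV|/pV].
  - have pE : map (nth x0 (q ++ p)) [:: 3; 4; 5] = p.
      by case: (p) (q) p3 q3 => [|? [|? [|? []]]] // [|? [|? [|? []]]].
    have qE : map (nth x0 (q ++ p)) [:: 0; 1; 2] = q.
      by case: (p) (q) p3 q3 => [|? [|? [|? []]]] // [|? [|? [|? []]]].
    have cM := mixed_cert cc pin qin (perm_refl p) (perm_refl q).
    have gE b : glue x0 (q ++ p) (root 2 6 [:: [:: 3; 4; 5]] [:: [:: 0; 1; 2]])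
        (fun b => if b then rem q (c true) else rem p (c false)) b
        = if b then q :: rem q (c true) else p :: rem p (c false).
      by case: b; rewrite /glue [parts _ _]/= map_cons ?pE ?qE.
    apply: (cert_eqv cM) => b; rewrite gE //; case: b => r.
      exact: (cert_homog (b := true) cM).
    exact: (cert_homog (b := false) cM).
have [V' [c' [cc' sV' []]]] := improvable_minimal Mn sV (R _ _ _ M).
- by case=> _ [b' [r]]; apply: no_big_part cc' sV'.
- by case=> _ [r [s [rin sin r3 s3]]]; apply: no_sharing_triples cc' sV' rin sin r3 s3.
- by case.
Qed.

(** No part has four vertices, so an excess of 2 among the cliques means two triples, disjoint
    because they are parts of one partition. *)
Lemma no_clique_triples e n V c : symmetric e -> minimal e n -> cert e V c -> size V = n ->
  excess (c true) = 2 -> False.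
Proof.
move=> es Mn cc sV ext; have [gt1 ex] := minimal_parts Mn cc sV.
have [|p pin p3] := excess_gt0 (P := c true); first by rewrite ext.
have p3' : size p = 3.
  by apply/eqP; rewrite eqn_leq p3 andbT leqNgt; apply/negP => /(no_big_part es Mn cc sV pin).
have exp := excess_rem pin.
have [|q qin q3] := excess_gt0 (P := rem p (c true)); first by lia.
have q3' : size q = 3.
  apply/eqP; rewrite eqn_leq q3 andbT leqNgt; apply/negP.
  exact: (no_big_part es Mn cc sV (mem_rem qin)).
have exq := excess_rem qin.
pose rest b := if b then rem q (rem p (c true)) else c false.
have r2 b r : r \in rest b -> size r = 2.
  case: b => /=; apply: excess0; try lia; last exact: gt1.
  by move=> r' /mem_rem/mem_rem; apply: gt1.
have [up pV] := cert_part cc pin; have [uq qV] := cert_part cc (mem_rem qin).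
have permc : perm_eq (c true) [:: p, q & rem q (rem p (c true))].
  by rewrite (permPl (perm_to_rem pin)) perm_cons perm_to_rem.
have R : refuted x0 e (root 3 6 [::] [:: [:: 0; 1; 2]; [:: 3; 4; 5]]).
  by apply: (refuted_nth (k := 24)).
have M : models x0 e (root 3 6 [::] [:: [:: 0; 1; 2]; [:: 3; 4; 5]]) (p ++ q) rest V.
  apply: root_models => //.
  - have [uV pcV _ _] := cc; have := pcV true; rewrite (permPl (perm_flatten permc)) /= catA.
    by move/perm_uniq; rewrite uV cat_uniq => /andP[].
  - by rewrite size_cat p3' q3'.
  - by move=> x; rewrite mem_cat => /orP[/pV|/qV].
  have pE : map (nth x0 (p ++ q)) [:: 0; 1; 2] = p.
    by case: (p) (q) p3' q3' => [|? [|? [|? []]]] // [|? [|? [|? []]]].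
  have qE : map (nth x0 (p ++ q)) [:: 3; 4; 5] = q.
    by case: (p) (q) p3' q3' => [|? [|? [|? []]]] // [|? [|? [|? []]]].
  have gE b : glue x0 (p ++ q) (root 3 6 [::] [:: [:: 0; 1; 2]; [:: 3; 4; 5]]) rest b
            = if b then [:: p, q & rem q (rem p (c true))] else c false.
    by case: b => //; rewrite /glue [parts _ _]/= 2!(map_cons (map _)) pE qE.
  apply: (cert_eqv cc) => b; rewrite gE; case: b => //.
  - by rewrite -(perm_size permc).
  - by rewrite perm_sym; apply: perm_flatten.
  - by move=> r; rewrite -(perm_mem permc); apply: cert_homog cc.
  - by move=> r; apply: cert_homog cc.
have [V' [c' [cc' sV' []]]] := improvable_minimal Mn sV (R _ _ _ M).
- by case=> _ [b' [r]]; apply: no_big_part cc' sV'.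
- by case=> _ [r [s [rin sin r3 s3]]]; apply: no_sharing_triples cc' sV' rin sin r3 s3.
- by case=> _ [r [s [rin sin r3 s3]]]; apply: no_mixed_triples cc' sV' rin sin r3 s3.
Qed.

(** The total excess 2 is distributed over stable sets and cliques as 0 and 2, 1 and 1, or 2 and 0;
    the last case is the first one for the complement. *)
Lemma no_minimal e n V c : symmetric e -> minimal e n -> cert e V c -> size V = n -> False.
Proof.
move=> es Mn cc sV; have [gt1 ex] := minimal_parts Mn cc sV.
have triple b : 0 < excess (c b) -> exists2 p, p \in c b & size p = 3.
  case/excess_gt0=> p pin p3; exists p => //.
  by apply/eqP; rewrite eqn_leq p3 andbT leqNgt; apply/negP => /(no_big_part es Mn cc sV pin).
case: (posnP (excess (c false))) => [exf|/triple[p pin p3]].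
  by apply: (no_clique_triples es Mn cc sV); rewrite exf in ex.
case: (posnP (excess (c true))) => [ext|/triple[q qin q3]].
  apply: (no_clique_triples (flip_sym es) (flip_minimal Mn) (flip_cert cc) sV).
  by rewrite ext addn0 in ex.
exact: no_mixed_triples cc sV pin qin p3 q3.
Qed.

End NoMinimal.

(** * Graphs and adjacency patterns *)

Section Graphs.
Variable G : sgraph.
Implicit Types (A : {set G}) (b : bool).

Definition bad A := (A != set0) && (chi (induced A) + theta (induced A) < #|A|).

Definition part_number b A := if b then theta (induced A) else chi (induced A).

(** Proper colourings for [false] and clique covers for [true]. Functions on all of [G] avoid the
    subtype underlying [induced A]. *)
Definition coloring b A k (f : G -> nat) :=
  {in A, forall x, f x < k} /\
  {in A &, forall x y, x != y -> f x = f y -> adj x y = b}.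

Lemma colorableP (H : sgraph) k : colorable H k <->
  exists f : H -> nat, (forall x, f x < k) /\ forall x y : H, adj x y -> f x <> f y.
Proof.
split=> [/existsP[f /forallP fP]|[f [fk fP]]].
  exists (fun x => val (f x)); split=> [x|x y xy]; first exact: ltn_ord.
  move=> /val_inj fxy.
  by have /forallP/(_ y) := fP x; rewrite xy fxy eqxx.
apply/existsP; exists [ffun x => Ordinal (fk x)].
apply/forallP=> x; apply/forallP=> y; apply/implyP=> xy.
by rewrite !ffunE -val_eqE /=; apply/eqP/fP.
Qed.

Lemma colorable_induced b A k :
  colorable (if b then complement (induced A) else induced A) k <-> exists f, coloring b A k f.
Proof.
(* The value 0 outside [A] is never looked at. *)
pose ext (f : {x | x \in A} -> nat) x := if insub x is Some u then f u else 0.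
have extE f x (xA : x \in A) : ext f x = f (Sub x xA) by rewrite /ext insubT.
case: b; rewrite colorableP /=; split=> -[f [fk fP]].
- exists (ext f); split=> [x xA|x y xA yA xy]; rewrite ?extE // => fxy.
  by apply: contraPT fxy => nxy; apply: fP; rewrite /co_adj -val_eqE /= xy.
- exists (fun u => f (val u)); split=> [u|u v /andP[uv nuv] fuv]; first exact/fk/valP.
  by move: nuv; rewrite /= /sub_adj (fP _ _ (valP u) (valP v) uv fuv).
- exists (ext f); split=> [x xA|x y xA yA xy]; rewrite ?extE // => fxy.
  by apply/negP => xy'; apply: fP fxy.
- exists (fun u => f (val u)); split=> [u|u v uv fuv]; first exact/fk/valP.
  have {}uv : adj (val u) (val v) by [].
  have ne : val u != val v by apply: contraTneq uv => ->; rewrite adj_irrefl.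
  by have := fP _ _ (valP u) (valP v) ne fuv; rewrite uv.
Qed.

Lemma part_number_coloring b A : exists f, coloring b A (part_number b A) f.
Proof.
apply/colorable_induced; rewrite /part_number /theta /chi.
by case: b; case: ex_minnP.
Qed.

Lemma part_number_min b A k f : coloring b A k f -> part_number b A <= k.
Proof.
move=> fP; have: colorable (if b then complement (induced A) else induced A) k.
  by apply/colorable_induced; exists f.
by rewrite /part_number /theta /chi; case: b {fP}; case: ex_minnP => m _ /(_ k).
Qed.

Lemma flatten_classes (T : eqType) (V : seq T) (f : T -> nat) k :
  perm_eq (flatten [seq [seq x <- V | f x == i] | i <- iota 0 k]) [seq x <- V | f x < k].
Proof.
elim: k => [|k IH]; first by rewrite (@eq_filter _ _ pred0) ?filter_pred0.
rewrite -addn1 iotaD map_cat flatten_cat /= cats0 add0n addn1.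
rewrite (permPl (perm_cat IH (perm_refl _))).
have p1 := perm_filterC (fun x => f x < k) [seq x <- V | f x < k.+1].
rewrite -(permPr (introT permPl p1)) -!filter_predI.
rewrite (@eq_filter _ (predI _ _) (fun x => f x < k)); last by move=> x /=; lia.
by rewrite (@eq_filter _ (predI _ _) (fun x => f x == k)) // => x /=; lia.
Qed.

(** The parts are the colour classes, empty ones included, so that their number is exactly [k b]. *)
Lemma coloring_cert (V : seq G) (k : bool -> nat) (f : bool -> G -> nat) :
    uniq V -> (forall b, coloring b [set x in V] (k b) (f b)) -> k false + k true < size V ->
  exists c, cert (@adj G) V c.
Proof.
move=> uV fP lt.
exists (fun b => [seq [seq x <- V | f b x == i] | i <- iota 0 (k b)]).
split=> // [b|b _ /mapP[i _ ->] x y|]; last by rewrite !size_map !size_iota.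
  rewrite (permPl (flatten_classes _ _ _)) (@eq_in_filter _ _ predT) ?filter_predT //.
  by move=> x xV; apply/(proj1 (fP b)); rewrite inE.
rewrite !mem_filter => /andP[/eqP xi xV] /andP[/eqP yi yV] xy.
by apply: (proj2 (fP b)); rewrite ?inE // xi yi.
Qed.

Lemma bad_cert A : bad A -> exists c, cert (@adj G) (enum A) c.
Proof.
case/andP=> _ lt; have [f0 f0P] := part_number_coloring false A.
have [f1 f1P] := part_number_coloring true A.
apply: (@coloring_cert _ (part_number ^~ A) (fun b => if b then f1 else f0)).
- exact: enum_uniq.
- have -> : [set x in enum A] = A by apply/setP=> x; rewrite inE mem_enum.
  by case.
- by rewrite -cardE.
Qed.

Lemma cert_bad V c : cert (@adj G) V c -> bad [set x in V] /\ #|[set x in V]| = size V.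
Proof.
case=> uV pV hV ltV; have sz : #|[set x in V]| = size V by rewrite cardsE; apply/card_uniqP.
split=> //; apply/andP; split; first by rewrite -card_gt0 sz; apply: leq_ltn_trans ltV.
have part_le b : part_number b [set x in V] <= size (c b).
  pose f x := find (fun p => x \in p) (c b).
  have hasf x : x \in V -> has (fun p => x \in p) (c b).
    by rewrite -(perm_mem (pV b)) => /flattenP[p pin xp]; apply/hasP; exists p.
  apply: (@part_number_min _ _ _ f); split=> [x|x y]; rewrite !inE.
    by move/hasf; rewrite has_find.
  move=> /hasf xV /hasf yV xy fxy.
  apply: (hV b (nth [::] (c b) (f x))) => //; first by rewrite mem_nth // -has_find.
    exact: (@nth_find _ [::]) xV.
  by rewrite fxy; apply: (@nth_find _ [::]) yV.
rewrite sz; apply: leq_ltn_trans ltV; exact: leq_add (part_le false) (part_le true).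
Qed.

(** Every certificate comes from a bad set of the same size. If all bad sets had more than 8
    vertices, a smallest one would thus carry a certificate with the fewest vertices, against
    [no_minimal]. *)
Lemma bad_small A : bad A -> exists2 B, bad B & #|B| <= 8.
Proof.
move=> badA; case: (boolP [exists B, bad B && (#|B| <= 8)]) => [/existsP[B /andP[]]|]; first by exists B.
rewrite negb_exists => /forallP none; exfalso.
case: (arg_minnP (fun B : {set G} => #|B|) badA) => B badB minB.
have [x0 _] : exists x, x \in B by case/andP: badB => /set0Pn.
have [c cc] := bad_cert badB.
apply: (no_minimal x0 (@adj_sym G) _ cc (esym (cardE B))); split.
  by have := none B; rewrite badB -ltnNge.
by move=> V c' /cert_bad[badV <-]; apply: minB.
Qed.

Lemma one_HNG_bad : one_HNG G <-> ~ exists A, bad A.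
Proof.
have cardE A : #|induced A| = #|A| by rewrite card_sig.
split=> [H [A /andP[/H]]|H A A0]; first by rewrite cardE leqNgt => /negP.
by rewrite leqNgt cardE; apply/negP => lt; apply: H; exists A; rewrite /bad A0.
Qed.

End Graphs.

(* A pattern records, for all pairs of positions of an 8-tuple of vertices,
   whether the two vertices are equal and whether they are adjacent. *)
Definition pattern := {ffun 'I_8 * 'I_8 -> bool * bool}.

(** [I] picks positions with pairwise distinct vertices, which leaves room for fewer than 8
    vertices; [f] colours them in both ways. All witnesses range over finite types, which makes the
    property a boolean; numbers below 8 suffice since both numbers of colours together stay below
    the size of [I]. *)
Definition bad_pattern (p : pattern) :=
  [exists I : {set 'I_8}, exists f : {ffun bool * 'I_8 -> 'I_8}, exists k : {ffun bool -> 'I_8},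
    (k false + k true < #|I|) &&
    [forall b, forall i in I, (f (b, i) < k b) &&
      [forall j in I, (i != j) ==>
         ~~ (p (i, j)).1 && ((f (b, i) == f (b, j)) ==> ((p (i, j)).2 == b))]]].

Definition tuple_pattern (G : sgraph) (x : 'I_8 -> G) : pattern :=
  [ffun ij => (x ij.1 == x ij.2, adj (x ij.1) (x ij.2))].

Lemma bad_patternP (G : sgraph) :
  (exists A : {set G}, bad A) <-> exists x : 'I_8 -> G, bad_pattern (tuple_pattern x).
Proof.
split=> [[A /bad_small[{}A badA A8]]|[x]].
  have /andP[/set0Pn[v0 _] lt] := badA.
  (* Positions from [#|A|] on hold the default [v0]; they stay outside the set of positions chosen
     next. *)
  pose x (i : 'I_8) := nth v0 (enum A) i.
  exists x; apply/existsP; exists [set i : 'I_8 | i < #|A|].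
  have [f0 f0P] := part_number_coloring false A.
  have [f1 f1P] := part_number_coloring true A.
  pose f b := if b then f1 else f0.
  have fP b : coloring b A (part_number b A) (f b) by case: b.
  have k8 b : part_number b A < 8 by apply: leq_trans A8; case: b => /=; lia.
  have xA (i : 'I_8) : i < #|A| -> x i \in A.
    by rewrite cardE => lti; rewrite -mem_enum mem_nth.
  apply/existsP; exists [ffun bi => inord (f bi.1 (x bi.2))].
  apply/existsP; exists [ffun b => Ordinal (k8 b)].
  have fE b (i : 'I_8) : i < #|A| -> (inord (f b (x i)) : 'I_8) = f b (x i) :> nat.
    by move=> /xA xi; apply/inordK/(ltn_trans (proj1 (fP b) _ xi)).
  apply/andP; split.
    rewrite !ffunE /=; apply: leq_trans lt _.
    have inj : injective (widen_ord A8).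
      by move=> i j /(congr1 val) ij; apply: val_inj.
    apply: (@leq_trans #|[set widen_ord A8 i | i in [set: 'I_#|A|]]|).
      by rewrite card_imset // cardsT card_ord.
    by apply/subset_leq_card/subsetP=> _ /imsetP[i _ ->]; rewrite inE /=.
  apply/forallP=> b; apply/forall_inP=> i; rewrite inE => li; apply/andP; split.
    by rewrite !ffunE /= fE //; apply/(proj1 (fP b))/xA.
  apply/forall_inP=> j; rewrite inE => lj; apply/implyP=> ij.
  have xij : x i != x j by rewrite /x nth_uniq -?cardE ?enum_uniq.
  rewrite !ffunE /= xij /=; apply/implyP=> /eqP/(congr1 val) /=; rewrite !fE // => fij.
  by apply/eqP; apply: (proj2 (fP b)); rewrite ?xA.
case/existsP=> I /existsP[f /existsP[k /andP[lt /forallP H]]].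
have {}H b i : i \in I -> (f (b, i) < k b) /\ forall j, j \in I -> i != j ->
    x i != x j /\ (f (b, i) = f (b, j) -> adj (x i) (x j) = b).
  move=> iI; have /forall_inP/(_ i iI)/andP[fk /forall_inP Hj] := H b; split=> // j jI ij.
  have /implyP/(_ ij) := Hj j jI; rewrite !ffunE /= => /andP[xij /implyP fij].
  by split=> // /eqP/fij/eqP.
have injx : {in I &, injective x}.
  move=> i j iI jI xij; apply/eqP; apply: contraT => ij.
  by have [_ /(_ j jI ij)[]] := H false i iI; rewrite xij eqxx.
have i0 : 'I_8 by exact: ord0.
(* Inverse of [x] on [I]; the default [i0] only serves vertices that do not occur there. *)
pose idx v := odflt i0 [pick i in I | x i == v].
have idxK i : i \in I -> idx (x i) = i.
  move=> iI; rewrite /idx; case: pickP => [j /andP[jI /eqP xji]|/(_ i)] /=; first exact: injx.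
  by rewrite iI eqxx.
pose V := [seq x i | i <- enum I].
have VP v : v \in [set v in V] -> exists2 i, i \in I & v = x i.
  by rewrite inE => /mapP[i]; rewrite mem_enum => iI ->; exists i.
have [|||c /cert_bad[badV _]] := @coloring_cert G V (fun b => k b) (fun b v => f (b, idx v)).
- by rewrite map_inj_in_uniq ?enum_uniq // => i j; rewrite !mem_enum; apply: injx.
- move=> b; split=> [_ /VP[i iI ->]|_ _ /VP[i iI ->] /VP[j jI ->] xij].
    by rewrite idxK //; case: (H b i iI).
  rewrite !idxK // => /val_inj fij; have [_ Hij] := H b i iI.
  by apply: (proj2 (Hij j jI _)) => //; apply: contraNneq xij => ->.
- by rewrite size_map -cardE.
by exists [set v in V].
Qed.

(** * Straight-line code of the word RAM *)

Definition halts_within (P : program) (s : config) (B T : nat) (b : bool) :=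
  (forall t, words_below B (run P s t)) /\
  exists2 t, t <= T & answer P (run P s t) = Some b.

Lemma halts_within_step P s B T b : words_below B s ->
  halts_within P (step P s) B T b -> halts_within P s B T.+1 b.
Proof.
move=> ws [wt [t tT ans]]; split; first by case=> [//|t']; rewrite /run iterSr; apply: wt.
by exists t.+1; rewrite ?ltnS // /run iterSr.
Qed.

Lemma halts_within_halt P s B b : words_below B s -> fetch P s = Halt b ->
  halts_within P s B 0 b.
Proof.
move=> ws fs; have run_s t : run P s t = s.
  by elim: t => //= t ->; case: s fs {ws} => l r m /= ->.
by split=> [t|]; rewrite ?run_s //; exists 0; rewrite // /answer fs.
Qed.

Section StraightLine.
Variable m : nat -> nat.
Implicit Types (r : nat -> nat) (code : seq instr).

Definition straight i := if i is (Const _ _ | Op _ _ _ _ | Read _ _) then true else false.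

Definition exec1 r i : nat -> nat :=
  match i with
  | Const d c => [eta r with d |-> c]
  | Op o d a b => [eta r with d |-> eval_binop o (r a) (r b)]
  | Read d a => [eta r with d |-> m (r a)]
  | _ => r
  end.

Definition exec code r := foldl exec1 r code.

Lemma exec_cat code1 code2 r : exec (code1 ++ code2) r = exec code2 (exec code1 r).
Proof. exact: foldl_cat. Qed.

Lemma fetch_cat pre i post r : fetch (pre ++ i :: post) (Config (size pre) r m) = i.
Proof. by rewrite /fetch /= nth_cat ltnn subnn. Qed.

(** The bound is asked for after each prefix of the code, since [words_below] must hold at all
    times. *)
Lemma halts_within_exec P pre code post r B T b :
    P = pre ++ code ++ post -> all straight code -> (forall a, m a < B) ->
    (forall k a, exec (take k code) r a < B) ->
    halts_within P (Config (size pre + size code) (exec code r) m) B T b ->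
  halts_within P (Config (size pre) r m) B (size code + T) b.
Proof.
elim: code pre r => [|i code IH] pre r; first by rewrite addn0.
move=> PE /= /andP[si scode] mB rB H.
apply: halts_within_step; first by move=> a; split; [exact: (rB 0 a)|].
have -> : step P (Config (size pre) r m) = Config (size (rcons pre i)) (exec1 r i) m.
  by rewrite /= PE fetch_cat size_rcons; case: (i) si.
apply: IH => //; first by rewrite PE cat_rcons.
  by move=> k a; have := rB k.+1 a.
by rewrite size_rcons addSnnS.
Qed.

(** Growth of the exponent under one instruction, for positive [n]: on cells below [(n + 1) ^ w] a
    product at most doubles the exponent, and a constant [c <= C] is below [(n + 1) ^ C]. *)
Definition grow C w := 2 * w + C.
Definition consts_le C := all (fun i => if i is Const _ c then c <= C else true).

Lemma exec_bound n C w code r : 0 < n -> 0 < w -> (forall a, m a < 2) ->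
    consts_le C code -> (forall a, r a < n.+1 ^ w) ->
  forall a, exec code r a < n.+1 ^ iter (size code) (grow C) w.
Proof.
move=> n0 w0 m2; have N_le u v : u <= v -> n.+1 ^ u <= n.+1 ^ v by move=> uv; rewrite leq_exp2l.
elim: code r w w0 => [|i code IH] r w w0 //= /andP[iC codeC] rB a.
rewrite -iterS iterSr; apply: IH => // [|{}a]; first by rewrite /grow; lia.
have rw d : r d < n.+1 ^ grow C w by apply: leq_trans (rB d) _; apply: N_le; rewrite /grow; lia.
have sq : n.+1 ^ w * n.+1 ^ w <= n.+1 ^ grow C w.
  by rewrite -expnD; apply: N_le; rewrite /grow; lia.
have N2 : 1 < n.+1 ^ w by rewrite -(expn0 n.+1) ltn_exp2l.
case: i iC => //= [d c cC|o d s1 s2 _|d s _]; case: eqP => // _.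
- apply: leq_ltn_trans cC _; apply: leq_trans (ltn_expl C (_ : 1 < n.+1)) _ => //.
  by apply: N_le; rewrite /grow; lia.
- have := rB s1; have := rB s2; set x := r s1; set y := r s2 => yB xB.
  case: o => /=.
  + by apply: leq_trans sq; nia.
  + exact: leq_ltn_trans (leq_subr _ _) (rw s1).
  + by apply: leq_trans sq; apply: ltn_mul.
  + exact: leq_ltn_trans (leq_div _ _) (rw s1).
  + exact: leq_ltn_trans (leq_mod _ _) (rw s1).
- apply: leq_trans (m2 _) _; rewrite -(expn0 n.+1) ltn_exp2l // /grow; lia.
Qed.

Lemma exec_take_bound n C w code r : 0 < n -> 0 < w -> (forall a, m a < 2) ->
    consts_le C code -> (forall a, r a < n.+1 ^ w) ->
  forall k a, exec (take k code) r a < n.+1 ^ iter (size code) (grow C) w.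
Proof.
move=> n0 w0 m2 codeC rB k a; have iter_le i j v : i <= j -> iter i (grow C) v <= iter j (grow C) v.
  move=> /subnKC <-; rewrite addnC iterD; elim: (j - i) => //= d IH.
  by apply: leq_trans IH _; rewrite [X in _ <= X]/grow mul2n -addnn -addnA leq_addr.
have takeC : consts_le C (take k code).
  by move: codeC; rewrite -{1}(cat_take_drop k code) /consts_le all_cat => /andP[].
apply: leq_trans (exec_bound n0 w0 m2 takeC rB a) _.
by rewrite leq_exp2l // iter_le // size_take_min geq_minr.
Qed.

Lemma exec_clear s r a : exec [seq Const d 0 | d <- s] r a = if a \in s then 0 else r a.
Proof.
elim: s r => //= d s IH r; rewrite IH inE /=.
by case: (a \in s) (a == d) => [] [].
Qed.

End StraightLine.

(** * The program *)

Fixpoint digits n k t := if k is k'.+1 then t %% n :: digits n k' (t %/ n) else [::].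

Lemma digits_lt n k t i : 0 < n -> nth 0 (digits n k t) i < n.
Proof.
by move=> n0; elim: k t i => [|k IH] t [|i] //=; apply: ltn_pmod.
Qed.

(** Needed for the completeness of the search: a counter running below [n ^ 8] passes through all
    8-tuples. *)
Lemma digits_surj n k (d : nat -> nat) : (forall i, i < k -> d i < n) ->
  exists2 t, t < n ^ k & forall i, i < k -> nth 0 (digits n k t) i = d i.
Proof.
elim: k d => [|k IH] d dn; first by exists 0.
have [t tk tP] := IH (d \o succn) (fun i ik => dn i.+1 ik).
have n0 : 0 < n by apply: leq_ltn_trans (dn 0 _).
exists (t * n + d 0) => [|[|i] ik /=].
- by rewrite expnS mulnC; have := dn 0 isT; nia.
- by rewrite modnMDl modn_small ?dn.
- by rewrite divnMDl // divn_small ?dn // addn0 tP.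
Qed.

Definition push acc e := acc + acc + e.

(** A binary number with two digits for each of the 64 pairs of positions; the length is fixed, so
    leading zeros cause no ambiguity. *)
Definition encode (p : pattern) :=
  foldl (fun acc ij => push (push acc (p ij).1) (p ij).2) 0 (enum {: 'I_8 * 'I_8}).

Lemma encode_inj : injective encode.
Proof.
move=> p q; rewrite /encode => epq; apply/ffunP=> ij.
have: ij \in enum {: 'I_8 * 'I_8} by rewrite mem_enum.
suff H s a b : foldl (fun acc ij => push (push acc (p ij).1) (p ij).2) a s
             = foldl (fun acc ij => push (push acc (q ij).1) (q ij).2) b s ->
             a = b /\ {in s, p =1 q} by have [_] := H _ _ _ epq; apply.
elim: s a b => [|kl s IH] a b //= /IH[ab pq].
have [-> pqkl] : a = b /\ p kl = q kl.
  move: ab; rewrite /push; case: (p kl) (q kl) => [[] []] [[] []] /= ?; (split; [lia|try done; lia]).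
by split=> // kl'; rewrite inE => /predU1P[->|/pq].
Qed.

(* Register 0 holds n, 1 the counter, 2 the constant 1, 3 the quotient whose
   digits go to 4-11, 12 the pattern code, 15 counts the matches found. *)
Definition digit_code d0 k := flatten [seq [:: Op OpMod d 3 0; Op OpDiv 3 3 0] | d <- iota d0 k].

(** Subtraction truncates, so [1 - ((x - y) + (y - x))] is the truth value of [x = y]: no jumps are
    needed and the code stays straight. The address read is that of the entry of the adjacency
    matrix for the two vertices. *)
Definition pair_code a b :=
  [:: Op OpSub 13 a b; Op OpSub 14 b a; Op OpAdd 13 13 14; Op OpSub 13 2 13;
      Op OpAdd 12 12 12; Op OpAdd 12 12 13;
      Op OpMul 13 a 0; Op OpAdd 13 13 b; Read 13 13;
      Op OpAdd 12 12 12; Op OpAdd 12 12 13].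

Definition test_code c :=
  [:: Const 13 c; Op OpSub 14 13 12; Op OpSub 13 12 13; Op OpAdd 13 13 14;
      Op OpSub 13 2 13; Op OpAdd 15 15 13].

Definition pairs_code (s : seq (nat * nat)) := flatten [seq pair_code ab.1 ab.2 | ab <- s].
Definition tests_code L := flatten [seq test_code c | c <- L].

Definition pair_regs := [seq (4 + ij.1, 4 + ij.2) | ij : 'I_8 * 'I_8 <- enum {: 'I_8 * 'I_8}].

(** Three squarings: the counter starts at [n ^ 8]. *)
Definition prologue := [:: Const 2 1; Op OpMul 1 0 0; Op OpMul 1 1 1; Op OpMul 1 1 1].
(** A round must not inherit the numbers computed in the one before, or the bound on the words would
    grow with the number of rounds. *)
Definition clear := [seq Const d 0 | d <- iota 3 13].
(** The counter goes down before it is used, so the tuples run from [n ^ 8 - 1] to 0. Division by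
    the constant 1 copies it into register 3, as no instruction moves a register directly. *)
Definition work (L : seq nat) :=
  [:: Op OpSub 1 1 2; Op OpDiv 3 1 2] ++ digit_code 4 8
  ++ pairs_code pair_regs ++ tests_code L.
(** The first jump goes to [Halt false] as soon as a code in [L] is matched, the second one back to
    the start of the body; with the counter at 0 the run falls through to [Halt true]. *)
Definition search_program L :=
  let body := clear ++ work L in
  prologue ++ body ++
    [:: Jump_pos 15 (size prologue + size body + 3); Jump_pos 1 (size prologue);
        Halt true; Halt false].

(** * Effect of the code on the registers *)

Section Execution.
Variable m : nat -> nat.
Implicit Types (r : nat -> nat).

Lemma exec_digits d0 k r a : 3 < d0 -> a != 3 ->
  exec m (digit_code d0 k) r a
  = if d0 <= a < d0 + k then nth 0 (digits (r 0) k (r 3)) (a - d0) else r a.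
Proof.
move=> d3 a3; elim: k d0 r d3 => [|k IH] d0 r d3.
  by case: ifP => //; lia.
rewrite /digit_code /= -/(digit_code d0.+1 k) IH; last exact: ltnW.
have [d30 d00 d03] : [/\ (3 == d0) = false, (0 == d0) = false & (d0 == 3) = false] by split; lia.
rewrite /= d30 d00 /= (negbTE a3); case: (ltngtP a d0) => [lt|gt|->].
- by [].
- by rewrite (_ : a - d0 = (a - d0.+1).+1) ?addSnnS //; lia.
- by rewrite addnS ltnS leq_addr subnn.
Qed.

Lemma sub_eq1 x y : 1 - (x - y + (y - x)) = (x == y).
Proof. by case: eqP => [->|/eqP]; lia. Qed.

Lemma exec_pair r a b : r 2 = 1 -> a \notin [:: 12; 13; 14] -> b \notin [:: 12; 13; 14] ->
  let r' := exec m (pair_code a b) r in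
  r' 12 = push (push (r 12) (r a == r b)) (m (r a * r 0 + r b))
  /\ forall d, d \notin [:: 12; 13; 14] -> r' d = r d.
Proof.
rewrite !inE !negb_or => r2 /and3P[/negbTE a12 /negbTE a13 /negbTE a14].
move=> /and3P[/negbTE b12 /negbTE b13 /negbTE b14]; split.
  by rewrite /= a12 a13 a14 b12 b13 b14 /= r2 sub_eq1.
by move=> d; rewrite !inE !negb_or => /and3P[/negbTE d12 /negbTE d13 /negbTE d14];
   rewrite /= d12 d13 d14.
Qed.

Lemma exec_pairs (s : seq (nat * nat)) r : r 2 = 1 ->
  all (fun ab => (ab.1 \notin [:: 12; 13; 14]) && (ab.2 \notin [:: 12; 13; 14])) s ->
  let r' := exec m (pairs_code s) r in
  r' 12 = foldl (fun acc ab => push (push acc (r ab.1 == r ab.2)) (m (r ab.1 * r 0 + r ab.2)))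
                (r 12) s
  /\ forall d, d \notin [:: 12; 13; 14] -> r' d = r d.
Proof.
elim: s r => [|[a b] s IH] r r2 // /andP[/andP[a3 b3] s3].
rewrite -[pairs_code _]/(pair_code a b ++ pairs_code s) exec_cat => r'; rewrite /r' {r'}.
 have [e12 ed] := exec_pair r2 a3 b3.
have [|-> ed'] := IH (exec m (pair_code a b) r) _ s3; first by rewrite ed.
split; last by move=> d d3; rewrite ed' // ed.
rewrite e12 [RHS]/= {e12 ed' IH}; move: (push (push _ _) _) (exec _ _ _) ed => acc r1 ed.
rewrite (ed 0) //; elim: s acc s3 => //= -[c d] s IHs acc /andP[/andP[c3 d3] s3].
by rewrite (ed c) // (ed d) // IHs.
Qed.

Lemma exec_tests L r : r 2 = 1 ->
  let r' := exec m (tests_code L) r in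
  r' 15 = r 15 + count_mem (r 12) L
  /\ forall d, d \notin [:: 13; 14; 15] -> r' d = r d.
Proof.
elim: L r => [|c L IH] r r2; first by rewrite addn0.
rewrite -[tests_code _]/(test_code c ++ tests_code L) exec_cat => r'; rewrite /r' {r'}.
have [|-> ed] := IH (exec m (test_code c) r); first by [].
split; last first.
  move=> d d3; rewrite ed //; move: d3.
  rewrite !inE !negb_or => /and3P[/negbTE d13 /negbTE d14 /negbTE d15].
  by rewrite /= d13 d14 d15.
by rewrite /= r2 addnC [X in 1 - X]addnC sub_eq1; lia.
Qed.

End Execution.

Definition max_const (L : seq nat) := foldr maxn 1 L.

Lemma consts_work L : consts_le (max_const L) (work L).
Proof.
have pairsC s : consts_le (max_const L) (pairs_code s) by elim: s.
have testsC l : {subset l <= L} -> consts_le (max_const L) (tests_code l).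
  elim: l => // c l IH sub; rewrite /tests_code /= IH ?andbT.
    have : c \in L by apply: sub; rewrite mem_head.
    rewrite /max_const; elim: (L) => //= d l' IHl.
    by rewrite inE leq_max => /predU1P[->|/IHl ->]; rewrite ?leqnn ?orbT.
  by move=> d dl; apply: sub; rewrite inE dl orbT.
by rewrite /work /consts_le !all_cat -!/(consts_le _ _) pairsC testsC.
Qed.

Lemma straight_body L : all straight (clear ++ work L).
Proof.
have pairsS s : all straight (pairs_code s) by elim: s.
have testsS : all straight (tests_code L) by elim: L.
by rewrite /work !all_cat pairsS testsS.
Qed.

(** * Correctness and running time of the search *)

Section Correctness.
Variables (G : sgraph) (n : nat) (v : 'I_n -> G).
Hypotheses (n_gt0 : 0 < n) (v_bij : bijective v).
Let m := store (input v).

(** The list depends neither on the graph nor on [n]: one program serves all inputs. *)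
Definition bad_codes := [seq encode p | p in bad_pattern].

Definition nth_tuple t (i : 'I_8) : G := v (Ordinal (digits_lt 8 t i n_gt0)).

Lemma store_inputE (i j : 'I_n) : m (i * n + j) = adj (v i) (v j).
Proof.
rewrite /m /=; congr nat_of_bool; apply/existsP/idP=> [[i' /existsP[j' /andP[/eqP e a]]]|a].
  have ei : i = i'.
    by apply: val_inj; have := congr1 (divn^~ n) e; rewrite !divnMDl // !divn_small // !addn0.
  by move: e a; rewrite ei => /addnI/val_inj->.
by exists i; apply/existsP; exists j; rewrite eqxx.
Qed.

Lemma store_lt2 a : m a < 2.
Proof. by rewrite /m /=; case: [exists i, _]. Qed.

Lemma exec_match L k ra rb rc rd : ra 0 = n -> ra 1 = k -> ra 2 = 1 -> ra 3 = k ->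
    ra 12 = 0 -> ra 15 = 0 ->
    rb = exec m (digit_code 4 8) ra -> rc = exec m (pairs_code pair_regs) rb ->
    rd = exec m (tests_code L) rc ->
  [/\ rd 0 = n, rd 1 = k, rd 2 = 1,
      (0 < rd 15) = (encode (tuple_pattern (nth_tuple k)) \in L)
    & forall a, 15 < a -> rd a = ra a].
Proof.
move=> ra0 ra1 ra2 ra3 ra12 ra15 rbD rcD rdD.
have rbE a : a != 3 ->
    rb a = if 4 <= a < 12 then nth 0 (digits n 8 k) (a - 4) else ra a.
  by move=> a3; rewrite rbD exec_digits // ra0 ra3.
have rb0 : rb 0 = n by rewrite rbE.
have rb2 : rb 2 = 1 by rewrite rbE.
have rbd (i : 'I_8) : rb (4 + i) = nth 0 (digits n 8 k) i.
  by rewrite rbE //; have := ltn_ord i => i8; rewrite ifT ?addKn //; lia.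
have pregs : all (fun ab => (ab.1 \notin [:: 12; 13; 14]) && (ab.2 \notin [:: 12; 13; 14])) pair_regs.
  apply/allP=> _ /mapP[[i j] _ ->] /=; rewrite !inE.
  by have := ltn_ord i; have := ltn_ord j; lia.
have [rc12 rcE] := exec_pairs m rb2 pregs; rewrite -rcD in rc12 rcE.
have rc12E : rc 12 = encode (tuple_pattern (nth_tuple k)).
  rewrite rc12 (rbE 12) // ra12 /pair_regs /encode.
  suff foldE s acc :
    foldl (fun acc ab => push (push acc (rb ab.1 == rb ab.2)) (m (rb ab.1 * rb 0 + rb ab.2))) acc
          [seq (4 + ij.1, 4 + ij.2) | ij : 'I_8 * 'I_8 <- s]
    = foldl (fun acc ij => push (push acc (tuple_pattern (nth_tuple k) ij).1)
                                (tuple_pattern (nth_tuple k) ij).2) acc s by exact: foldE.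
  elim: s acc => // -[i j] s IH acc.
  rewrite [LHS]/= [RHS]/= -IH ffunE [_.1]/= [_.2]/=.
  by rewrite !rbd rb0 /nth_tuple (inj_eq (bij_inj v_bij)) -store_inputE.
have rc2 : rc 2 = 1 by rewrite rcE.
have [rd15 rdE] := exec_tests m L rc2; rewrite -rdD in rd15 rdE.
split.
- by rewrite rdE // rcE.
- by rewrite rdE // rcE // rbE.
- by rewrite rdE.
- by rewrite rd15 rcE // (rbE 15) // ra15 rc12E add0n -has_count has_pred1.
- by move=> a a15; rewrite rdE ?rcE ?rbE ?ifF //; rewrite ?inE; lia.
Qed.

Lemma exec_work L r k : r 0 = n -> r 1 = k.+1 -> r 2 = 1 -> r 12 = 0 -> r 15 = 0 ->
  [/\ exec m (work L) r 0 = n, exec m (work L) r 1 = k, exec m (work L) r 2 = 1,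
      (0 < exec m (work L) r 15) = (encode (tuple_pattern (nth_tuple k)) \in L)
    & forall a, 15 < a -> exec m (work L) r a = r a].
Proof.
move=> r0 r1 r2 r12 r15; rewrite /work 3!exec_cat.
have raE a : exec m [:: Op OpSub 1 1 2; Op OpDiv 3 1 2] r a
             = if a \in [:: 1; 3] then k else r a.
  by rewrite !inE /= r1 r2 subn1 divn1; case: (a == 1) (a == 3) => [] [].
move: (exec m [:: Op OpSub 1 1 2; Op OpDiv 3 1 2] r) raE => ra raE.
have ra0 : ra 0 = n by rewrite raE.
have ra1 : ra 1 = k by rewrite raE.
have ra2 : ra 2 = 1 by rewrite raE.
have ra3 : ra 3 = k by rewrite raE.
have ra12 : ra 12 = 0 by rewrite raE.
have ra15 : ra 15 = 0 by rewrite raE.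
case: (exec_match (L := L) ra0 ra1 ra2 ra3 ra12 ra15 (erefl _) (erefl _) (erefl _)) => e0 e1 e2 e15 ea.
split; [exact e0|exact e1|exact e2|exact e15|move=> a a15].
by rewrite (ea a a15) raE ifF // !inE; lia.
Qed.

Lemma halts_within_le P s B T T' b : T <= T' -> halts_within P s B T b ->
  halts_within P s B T' b.
Proof. by move=> TT [wt [t tT ans]]; split=> //; exists t => //; apply: leq_trans TT. Qed.

Lemma step_jump P l r a l' : fetch P (Config l r m) = Jump_pos a l' ->
  step P (Config l r m) = Config (if 0 < r a then l' else l.+1) r m.
Proof. by move=> /= ->. Qed.

(** After [clear] the only nonzero registers are [n], the counter and the constant 1, all below
    [(n + 1) ^ 8]; the bound for a round is therefore the same however many rounds went before. *)
Lemma exec_body_bound L B r :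
    n.+1 ^ iter (size (work L)) (grow (max_const L)) 8 <= B ->
    r 0 = n -> r 1 <= n ^ 8 -> r 2 = 1 -> (forall a, 15 < a -> r a = 0) ->
    (forall a, r a < B) ->
  forall k a, exec m (take k (clear ++ work L)) r a < B.
Proof.
move=> wB r0 r1 r2 r15 rB k a; rewrite take_cat; case: ifP => _.
  by rewrite /clear -map_take exec_clear; case: ifP => // _; apply: leq_ltn_trans (rB a).
rewrite exec_cat; apply: leq_trans wB; apply: exec_take_bound => //.
- exact: store_lt2.
- exact: consts_work.
have n8 : 1 < n.+1 ^ 8 by rewrite -(expn0 n.+1) ltn_exp2l.
move=> {}a; rewrite /clear exec_clear mem_iota; case: ifP => [_|a3]; first exact: ltnW.
case: (ltngtP a 15) => [a15|/r15->|a15]; [|exact: ltnW|by rewrite a15 in a3].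
have : a < 3 by lia.
case: a a3 a15 => [|[|[|//]]] _ _ _; rewrite ?r0 ?r2 //.
  by apply: (@leq_trans (n.+1 ^ 1)); rewrite // leq_exp2l.
by apply: leq_ltn_trans r1 _; rewrite ltn_exp2r.
Qed.

Definition no_match (L : seq nat) t := encode (tuple_pattern (nth_tuple t)) \notin L.

(** With the counter at [k + 1] the tuples [k, ..., 0] are still to be tested. A full round costs
    the body and two jumps; a match ends the run after the first jump. *)
Lemma program_loop L B k r :
    n.+1 ^ iter (size (work L)) (grow (max_const L)) 8 <= B ->
    r 0 = n -> r 1 = k.+1 -> k < n ^ 8 -> r 2 = 1 -> (forall a, 15 < a -> r a = 0) ->
    (forall a, r a < B) ->
  halts_within (search_program L) (Config (size prologue) r m) B
    (k.+1 * (size (clear ++ work L) + 2)) (all (no_match L) (iota 0 k.+1)).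
Proof.
move=> wB; have mB a : m a < B.
  apply: leq_trans (store_lt2 a) _; apply: leq_trans wB.
  rewrite -(expn0 n.+1) ltn_exp2l //.
  by elim: (size _) => //= w IH; rewrite addn_gt0 muln_gt0 IH.
set body := clear ++ work L; set l := size prologue + size body.
have fetchE i r' : fetch (search_program L) (Config (l + i) r' m) =
    nth (Halt false) [:: Jump_pos 15 (l + 3); Jump_pos 1 (size prologue); Halt true; Halt false] i.
  rewrite /fetch /search_program [pc _]/= catA nth_cat size_cat ltnNge leq_addr /=.
  by rewrite addKn.
have jump0 r' : step (search_program L) (Config l r' m) =
    Config (if 0 < r' 15 then l + 3 else l.+1) r' m.
  by apply: step_jump; rewrite -[l in Config l]addn0 fetchE.
have jump1 r' : step (search_program L) (Config l.+1 r' m) =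
    Config (if 0 < r' 1 then size prologue else l.+2) r' m.
  by apply: step_jump; rewrite -addn1 fetchE.
have halt2 r' : fetch (search_program L) (Config l.+2 r' m) = Halt true by rewrite -addn2 fetchE.
have halt3 r' := fetchE 3 r'.
have body_exec k' r' : r' 0 = n -> r' 1 = k'.+1 -> r' 2 = 1 -> (forall a, 15 < a -> r' a = 0) ->
    [/\ exec m body r' 0 = n, exec m body r' 1 = k', exec m body r' 2 = 1,
        (0 < exec m body r' 15) = ~~ no_match L k'
      & forall a, 15 < a -> exec m body r' a = 0].
  move=> r0 r1 r2 r15; rewrite /body exec_cat.
  have clE a : exec m clear r' a = if a \in iota 3 13 then 0 else r' a by apply: exec_clear.
  move: (exec m clear r') clE => rc clE.
  have rc0 : rc 0 = n by rewrite clE.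
  have rc1 : rc 1 = k'.+1 by rewrite clE.
  have rc2 : rc 2 = 1 by rewrite clE.
  have rc12 : rc 12 = 0 by rewrite clE.
  have rc15 : rc 15 = 0 by rewrite clE.
  case: (exec_work L rc0 rc1 rc2 rc12 rc15) => e0 e1 e2 e15 ea.
  split; [exact e0|exact e1|exact e2|by rewrite e15 negbK|move=> a a15].
  by rewrite (ea a a15) clE mem_iota r15 // if_same.
elim: k r => [|k IH] r r0 r1 kn r2 r15 rB.
all: have r1n : r 1 <= n ^ 8 by rewrite r1.
all: have bB := exec_body_bound wB r0 r1n r2 r15 rB.
all: have [e0 e1 e2 e15 ea] := body_exec _ r r0 r1 r2 r15.
all: have eB a : exec m body r a < B by have := bB (size body) a; rewrite take_size.
all: rewrite mulSn -addnA; apply: (halts_within_exec (erefl _) (straight_body L) mB bB).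
all: move: (exec m body r) e0 e1 e2 e15 ea eB => rd e0 e1 e2 e15 ea eB.
all: have wd l' : words_below B (Config l' rd m) by move=> a; split; [exact: eB|exact: mB].
all: apply: halts_within_step; first exact: wd.
(* The last number of the range is the tuple tested in the present round. *)
all: rewrite -/l jump0 e15 -[in iota _ _]addn1 iotaD all_cat [all _ (iota (_ + _) 1)]/= andbT.
all: case: (boolP (no_match L _)) => nm; rewrite ?andbT ?andbF [~~ _]/= ?[if _ then _ else _]/=.
- apply: halts_within_step; first exact: wd.
  by rewrite jump1 e1; apply: halts_within_halt.
- by apply: (@halts_within_le _ _ _ 0) => //; apply: halts_within_halt.
- apply: halts_within_step; first exact: wd.
  by rewrite jump1 e1; apply: IH => //; apply: ltnW.
- by apply: (@halts_within_le _ _ _ 0) => //; apply: halts_within_halt.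
Qed.

(** The first term of [w] serves the rounds of the loop, the second one the four instructions of the
    prologue, which start from cells below [n + 1]. *)
Lemma program_spec L (w := iter (size (work L)) (grow (max_const L)) 8 + iter 4 (grow 1) 1) :
  halts_within (search_program L) (input v) (n.+1 ^ w)
    (4 + n ^ 8 * (size (clear ++ work L) + 2)) (all (no_match L) (iota 0 (n ^ 8))).
Proof.
have n8 : 0 < n ^ 8 by rewrite expn_gt0 n_gt0.
have N_le u : u <= w -> n.+1 ^ u <= n.+1 ^ w by move=> uw; rewrite leq_exp2l.
have pB := @exec_take_bound m n 1 1 prologue (reg (input v)) n_gt0 isT store_lt2 isT.
apply: (@halts_within_exec m _ [::] prologue) => //.
- move=> a; apply: leq_trans (store_lt2 a) (leq_trans (_ : _ <= n.+1 ^ 1) (N_le _ _)) => //.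
  exact: (@leq_trans (iter 4 (grow 1) 1)) (leq_addl _ _).
- move=> k a; apply: leq_trans (pB _ k a) (N_le _ _); last by rewrite /w leq_addl.
  by move=> {}a /=; case: ifP => _ //; rewrite expn1.
rewrite -(prednK n8); apply: program_loop => //.
- by apply: N_le; rewrite /w leq_addr.
- by rewrite prednK //= !mulnn -!expnM.
- by rewrite prednK.
- by case=> [//|[//|[//|a]]] _ /=.
- move=> a; rewrite -[prologue](take_size) ; apply: leq_trans (pB _ _ a) (N_le _ _).
    by move=> {}a /=; case: ifP => _ //; rewrite expn1.
  by rewrite /w leq_addl.
Qed.

End Correctness.

(** Every 8-tuple of vertices comes up, because the numbers of its vertices are the digits of some
    counter value; and [encode] is injective, so that a match means a bad pattern. *)
Lemma no_match_one_HNG (G : sgraph) n (v : 'I_n -> G) (n_gt0 : 0 < n) : bijective v ->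
  all (no_match v n_gt0 bad_codes) (iota 0 (n ^ 8)) <-> one_HNG G.
Proof.
move=> [u vK uK]; rewrite one_HNG_bad bad_patternP; split=> [/allP none [x bad_x]|none].
  have [t tn tP] := @digits_surj n 8 (fun i => u (x (inord i))) (fun i _ => ltn_ord _).
  have : no_match v n_gt0 bad_codes t by apply: none; rewrite mem_iota.
  rewrite /no_match => /negP; apply.
  rewrite (_ : tuple_pattern _ = tuple_pattern x); first exact: image_f.
  have xE i : nth_tuple v n_gt0 t i = x i.
    by rewrite /nth_tuple -[RHS]uK; congr v; apply: val_inj; rewrite /= tP // inord_val.
  by apply/ffunP=> ij; rewrite !ffunE !xE.
apply/allP=> t _; apply/negP=> /imageP[p bad_p /encode_inj pE].
by apply: none; exists (nth_tuple v n_gt0 t); rewrite pE.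
Qed.

Theorem theorem6p1 :
  recognizable_in_polynomial_time one_HNG /\
  recognizable_in one_HNG (fun n : nat => n ^ 8).
Proof.
suff main : recognizable_in one_HNG (fun n => n ^ 8) by split=> //; exists 8.
(* The four steps of the prologue occur once; they are charged to [n ^ 8], which is at least 1. *)
exists (search_program bad_codes), (4 + (size (clear ++ work bad_codes) + 2)).
exists (iter (size (work bad_codes)) (grow (max_const bad_codes)) 8 + iter 4 (grow 1) 1).
move=> G n v n_gt0 v_bij.
have [words [t tT ans]] := program_spec n_gt0 v_bij bad_codes; split=> //.
exists t, (all (no_match v n_gt0 bad_codes) (iota 0 (n ^ 8))); split=> //.
  apply: leq_trans tT _; rewrite mulnDl mulnC leq_add2r leq_pmulr //.
  by rewrite expn_gt0 n_gt0.
exact: no_match_one_HNG.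
Qed.
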